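(* There is a non-increasing function $\nu:(2,\infty)\to\mathbb{R}_+$ with the following property. Let $p>2$, $B\geq 1$, and let $n,N$ be positive integers with $N\geq 2n$. Let $X$ be a centered $n$-dimensional random vector with covariance matrix $\Sigma$ whose distribution belongs to the class $\mathcal{C}(n,p,B)$. Let $X_1,X_2,\dots,X_N$ be independent copies of $X$, and let $\Sigma_N=\frac{1}{N}\sum_{i=1}^N X_iX_i^T$. Then, with probability at least $1-\frac{1}{n}$, $$\nu(p)^{-1}\frac{\|\Sigma_N-\Sigma\|_{2\to 2}}{\|\Sigma\|_{2\to 2}}\leq \frac{1}{N}\max_{i\leq N}\langle X_i,\Sigma^{-1}X_i\rangle + B^{2/p}\Bigl(\frac{n}{N}\Bigr)^{\frac{p-2}{p}}\log^4\frac{N}{n} + B^{2/p}\Bigl(\frac{n}{N}\Bigr)^{\frac{\min(p,4)-2}{\min(p,4)}}.$$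
   Context: For $p>2$ and $B\geq 1$, $\mathcal{C}(n,p,B)$ denotes the set of distributions of centered random vectors $X$ in $\mathbb{R}^n$ with covariance matrix $\Sigma=\mathbb{E}XX^T$ satisfying $\mathbb{E}|\langle X,a\rangle|^p\leq B\,\langle a,\Sigma a\rangle^{p/2}$ for all $a\in\mathbb{R}^n$. $\|\cdot\|_{2\to 2}$ is the spectral norm. $\Sigma$ is assumed invertible so that $\Sigma^{-1}$ makes sense. $\log$ is the natural logarithm. *)

(* Defs.v *)
From HB Require Import structures.
From mathcomp Require Import all_boot all_order all_algebra.
From mathcomp Require Import all_classical all_reals all_analysis.
Set Implicit Arguments. Unset Strict Implicit. Unset Printing Implicit Defensive.
Import Order.TTheory GRing.Theory Num.Theory.
Import numFieldNormedType.Exports.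
Local Open Scope classical_set_scope.
Local Open Scope ring_scope.

Section Defs.
Context {R : realType}.

Definition vnorm2 {n : nat} (x : 'cV[R]_n) : R := Num.sqrt (\sum_i x i 0 ^+ 2).

Definition spec_norm {n : nat} (A : 'M[R]_n) : R :=
  sup [set vnorm2 (A *m x) | x in [set x : 'cV[R]_n | vnorm2 x <= 1]].

Context {d : measure_display} {T : measurableType d}.

Definition rect_pre {n : nat} (X : T -> 'cV[R]_n) (A : 'I_n -> set R) : set T :=
  [set w | forall j, A j (X w j 0)].

Definition rand_vec {n : nat} (X : T -> 'cV[R]_n) : Prop :=
  forall j, measurable_fun setT (fun w => X w j 0).

Variable P : probability T R.

(* Y has the same distribution as X (equality of laws on the product
   sigma-algebra of R^n, which is generated by measurable rectangles). *)
Definition same_law {n : nat} (Y X : T -> 'cV[R]_n) : Prop :=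
  forall A : 'I_n -> set R, (forall j, measurable (A j)) ->
    P (rect_pre Y A) = P (rect_pre X A).

(* Mutual independence of the random vectors Xs_1, ..., Xs_N
   (product rule on rectangles; subfamilies via A i = setT). *)
Definition mutually_indep {n N : nat} (Xs : 'I_N -> T -> 'cV[R]_n) : Prop :=
  forall A : 'I_N -> 'I_n -> set R, (forall i j, measurable (A i j)) ->
    P (\bigcap_(i in [set: 'I_N]) rect_pre (Xs i) (A i))
    = (\prod_(i < N) P (rect_pre (Xs i) (A i)))%E.

Definition cov_mx {n : nat} (X : T -> 'cV[R]_n) : 'M[R]_n :=
  \matrix_(j, k) fine (\int[P]_w (X w j 0 * X w k 0)%:E).

Definition in_class_C {n : nat} (p B : R) (X : T -> 'cV[R]_n) : Prop :=
  rand_vec X /\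
  (forall j, P.-integrable setT (fun w => (X w j 0 ^+ 2)%:E)) /\
  (forall j, (\int[P]_w (X w j 0)%:E = 0)%E) /\
  cov_mx X \in unitmx /\
  forall a : 'cV[R]_n,
    (\int[P]_w ((`| (a^T *m X w) 0 0 | `^ p)%:E)
      <= (B * (((a^T *m cov_mx X *m a) 0 0) `^ (p / 2)))%:E)%E.

Definition emp_cov {n N : nat} (Xs : 'I_N -> T -> 'cV[R]_n) (w : T) : 'M[R]_n :=
  N%:R^-1 *: \sum_(i < N) (Xs i w *m (Xs i w)^T).

End Defs.

(* Main.v *)
Require Import Defs.
From HB Require Import structures.
From mathcomp Require Import all_boot all_order all_algebra.
From mathcomp Require Import all_classical all_reals all_analysis.
From mathcomp Require Import measurable_realfun ring lra zify.
Import Order.TTheory GRing.Theory Num.Theory.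
Import numFieldNormedType.Exports.
Local Open Scope classical_set_scope.
Local Open Scope ring_scope.

(* Whitening. Factor Sigma = C C^T and put Z_i = C^{-1} X_i, so that E<Z_i,a>^2 = |a|^2
   and E|<Z_i,a>|^p <= B |a|^p.  Since <X,Sigma^{-1}X> = |Z|^2, it is enough to bound
   |sum_i <Z_i,x>^2 - N |x|^2| by C (max_i |Z_i|^2 + n t (1 + log(N/n))^3 + n Q) |x|^2, where
   t ~ B^{2/p} (N/n)^{2/p} and Q = B^{2/p} (N/n)^{1/2} if p >= 4, Q = 0 otherwise.

   Bulk.  For x in a net of integer vectors the truncated sum of min(<Z_i,x>^2, t|x|^2) is
   controlled by Chernoff's bound, and Markov-type counting shows that at most n indices have
   <Z_i,x>^2 > t|x|^2.  The sum over these is a sparse quadratic form, to be bounded uniformly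
   over index sets S of size at most n.

   Sparse part.  Dually, one bounds |sum_{i in S} y_i Z_i|^2 for unit y.  Sort |y_i| into dyadic
   levels of sizes 4^J.  Interactions of a level with much larger or much smaller levels are
   estimated by Cauchy-Schwarz; within a window of width e, the combination is rounded to an
   integer one with small support and small l1 norm, and a union bound over such integer
   combinations shows that only few rows i can be strongly correlated with it (independence of
   Z_i from the combination enters here, for i outside its support).  The rows with |Z_i|^2
   above n t are rare and are treated with constant e; for the others e ~ log log(N/n), and
   the cost 64^e of the window produces the power of the logarithm.

   Monotonicity of nu is arranged by proving the bound with a constant depending only on a
   lower bound p0 for p, along p0 = 2 + 1/(i+1), and adding up the constants. *)

Set Implicit Arguments. Unset Strict Implicit. Unset Printing Implicit Defensive.

(** * Sparse quadratic forms *)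

(** The maximum of [|Z_i|^2] must enter with a constant factor, although a union bound over supports
    of size k among N rows costs k log(N/n). Hence the two classes of rows: a row with
    [|Z_i|^2 > 2 n t] has probability at most n/N, so supports effectively range over n rows and no
    logarithm is paid; for the other rows the logarithm multiplies only n t. A window of width e
    gains a factor 4^e between the number 4^j of tested rows and the support size 4^(j-e), and 4^e
    has to beat log(N/n). The squared rounding error then costs (8^e)^2, a cube of the logarithm,
    which is at most a multiple of log^4 because log(N/n) >= 1/2. Summing over levels must not
    produce a factor log n either: the threshold at level j carries an extra factor theta^(J0 - j),
    paid for by half of the moment surplus p - 2, and the series becomes geometric. Far levels are
    estimated through the very bound W that is sought. This gives W <= W/2 + c sqrt W, which can be
    solved because W starts as a finite supremum. *)

Section FiniteSums.
Context {R : realType}.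

Lemma sum_CS (I : finType) (P : pred I) (a b : I -> R) :
  (\sum_(i | P i) a i * b i) ^+ 2
    <= (\sum_(i | P i) a i ^+ 2) * (\sum_(i | P i) b i ^+ 2).
Proof.
set A := \sum_(i | P i) a i ^+ 2; set B := \sum_(i | P i) b i ^+ 2.
set C := \sum_(i | P i) a i * b i.
have A0 : 0 <= A by apply: sumr_ge0 => i _; exact: sqr_ge0.
have B0 : 0 <= B by apply: sumr_ge0 => i _; exact: sqr_ge0.
have [B1|] := eqVneq B 0.
  have /psumr_eq0P b0 : B = 0 by [].
  have -> : C = 0.
    apply: big1 => i Pi.
    by have /eqP := b0 (fun i _ => sqr_ge0 _) i Pi; rewrite sqrf_eq0 => /eqP->; rewrite mulr0.
  by rewrite expr0n/= mulr_ge0.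
move=> Bn0; have Bp : 0 < B by rewrite lt_neqAle eq_sym Bn0.
have : 0 <= \sum_(i | P i) (B * a i - C * b i) ^+ 2.
  by apply: sumr_ge0 => i _; exact: sqr_ge0.
have -> : \sum_(i | P i) (B * a i - C * b i) ^+ 2 = B * (A * B - C ^+ 2).
  transitivity (\sum_(i | P i) (B ^+ 2 * a i ^+ 2 - (2 * B * C) * (a i * b i)
                                + C ^+ 2 * b i ^+ 2)).
    by apply: eq_bigr => i _; ring.
  by rewrite big_split/= sumrB -!mulr_sumr -/A -/B -/C; ring.
by rewrite pmulr_rge0// subr_ge0.
Qed.

Lemma card_markov (I : finType) (A : {set I}) (f : I -> R) (c s : R) :
  0 <= c -> 0 <= s -> (forall i, i \in A -> 0 <= f i) ->
  \sum_(i in A) f i <= s * c -> #|[set i in A | c < f i]|%:R <= s.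
Proof.
move=> c0 s0 f0 fs; set B := [set i in A | c < f i].
have BS : \sum_(i in B) f i <= s * c.
  apply: le_trans fs; rewrite [leRHS](big_setID B)/= (finset.setIidPr _).
    by rewrite lerDl sumr_ge0// => i; rewrite inE => /andP[_ /f0].
  by apply/fintype.subsetP => i; rewrite inE => /andP[].
have Bc i : i \in B -> c < f i by rewrite inE => /andP[].
have [B0|[i iB]] := set_0Vmem B; first by rewrite B0 cards0.
have h : \sum_(i in B) c < \sum_(i in B) f i.
  by apply: ltr_sum => //; apply/hasP; exists i; rewrite ?mem_index_enum.
have := lt_le_trans h BS; rewrite sumr_const.
have [c00|cn0] := eqVneq c 0.
  by rewrite c00 mulr0 mul0rn ltxx.
have cp : 0 < c by rewrite lt_neqAle eq_sym cn0.
by rewrite -[c *+ _]mulr_natl (ltr_pM2r cp); exact: ltW.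
Qed.

End FiniteSums.

(** * Rounding coefficients to integers *)

Section Rounding.
Context {R : realType}.

(** Unbiased rounding picks m with weight [1 - f] and m + 1 with weight [f]. Both lie weakly on the
    same side of 0, so the mean absolute value is unchanged; the variance [f * (1 - f)] is at most
    [|x|]. *)
Lemma frac_norm (x : R) (m := Num.floor x) (f := x - m%:~R) :
  [/\ 0 <= f, f <= 1,
    (1 - f) * `|m%:~R : R| + f * `|(m + 1)%:~R : R| = `|x| &
    (1 - f) * (m%:~R : R) ^+ 2 + f * ((m + 1)%:~R : R) ^+ 2 <= x ^+ 2 + `|x|].
Proof.
have f0 : 0 <= f by rewrite subr_ge0 ge_floor.
have f1 : f <= 1.
  by rewrite lerBlDr addrC -[1]/(1%:~R) -intrD ltW// floorD1_gt.
have xE : x = m%:~R + f by rewrite addrC subrK.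
rewrite intrD xE; have M1 : m < 0 -> m%:~R <= -1 :> R by move=> ?; rewrite -[-1]/((-1)%:~R) ler_int; lia.
move: (m%:~R : R) (ler0z R m) M1 f0 f1 => M M0E M1 f0 f1.
have [m0|m0] := leP 0 m.
  have M0 : 0 <= M by rewrite M0E.
  by split => //; rewrite !ger0_norm; try lra; nra.
have M0 := M1 m0.
split => //; rewrite !ler0_norm; try lra; nra.
Qed.

(** Method of conditional expectations, one coordinate at a time; [w] carries the error of the
    coordinates already rounded. *)
Lemma rounding_seq (I J : finType) (P : {set J}) (r : seq I) (a : J -> I -> R)
    (x c : I -> R) (c' : R) (w : J -> R) :
  uniq r -> (forall i, 0 <= c i) -> 0 <= c' ->
  exists z : I -> int, (forall i, i \notin r -> z i = 0) /\
    \sum_(p in P) (w p + \sum_(i <- r) ((z i)%:~R - x i) * a p i) ^+ 2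
    + \sum_(i <- r) (c i * `|(z i)%:~R| + c' * (z i)%:~R ^+ 2)
    <= \sum_(p in P) w p ^+ 2 + \sum_(i <- r) (\sum_(p in P) a p i ^+ 2
         + (c i * `|x i| + c' * (x i ^+ 2 + `|x i|))).
Proof.
move=> + c0 c'0; elim: r w => [|i r IH] w /=.
  move=> _; exists (fun=> 0); split => //; rewrite !big_nil !addr0.
  by apply: ler_sum => p _; rewrite big_nil addr0.
move=> /andP[ir ur].
pose m := Num.floor (x i); pose f := x i - m%:~R.
have [f0 f1 fE fS] := frac_norm (x i); rewrite -/m -/f in f0 f1 fE fS.
pose cost (k : int) := \sum_(p in P) (w p + (k%:~R - x i) * a p i) ^+ 2
    + (c i * `|k%:~R| + c' * k%:~R ^+ 2).
pose tot := \sum_(p in P) w p ^+ 2 + (\sum_(p in P) a p i ^+ 2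
         + (c i * `|x i| + c' * (x i ^+ 2 + `|x i|))).
(* The terms linear in the error cancel because the rounding is unbiased; only the variance
   [f * (1 - f) <= 1] remains in front of the sum of squares of [a]. *)
have avg : (1 - f) * cost m + f * cost (m + 1) <= tot.
  have -> : (1 - f) * cost m + f * cost (m + 1) =
    (\sum_(p in P) w p ^+ 2 + f * (1 - f) * \sum_(p in P) a p i ^+ 2)
    + (c i * ((1 - f) * `|m%:~R| + f * `|(m + 1)%:~R|)
       + c' * ((1 - f) * (m%:~R : R) ^+ 2 + f * ((m + 1)%:~R : R) ^+ 2)).
    have E : (1 - f) * \sum_(p in P) (w p + (m%:~R - x i) * a p i) ^+ 2
        + f * \sum_(p in P) (w p + ((m + 1)%:~R - x i) * a p i) ^+ 2
        = \sum_(p in P) w p ^+ 2 + f * (1 - f) * \sum_(p in P) a p i ^+ 2.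
      rewrite !mulr_sumr -!big_split/=; apply: eq_bigr => p _.
      by rewrite intrD /f; ring.
    by rewrite -E /cost; ring.
  rewrite fE /tot -!addrA lerD2l lerD//.
    by rewrite ler_piMl ?sumr_ge0// => [p _|]; [exact: sqr_ge0|nra].
  by rewrite lerD2l ler_wpM2l.
have [k kP] : exists k : int, cost k <= tot.
  have [h|h] := leP (cost m) tot; first by exists m.
  have [h'|h'] := leP (cost (m + 1)) tot; first by exists (m + 1).
  exfalso; suff : tot < (1 - f) * cost m + f * cost (m + 1) by rewrite ltNge avg.
  pose t := Num.min (cost m) (cost (m + 1)).
  have tt : tot < t by rewrite lt_min h h'.
  apply: (lt_le_trans tt); rewrite -[leLHS]mul1r -[X in X * _](subrK f) mulrDl.
  have [t1 t2] : t <= cost m /\ t <= cost (m + 1) by rewrite !ge_min !lexx orbT.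
  by apply: lerD; apply: ler_wpM2l => //; lra.
have [z [z0 zP]] := IH (fun p => w p + (k%:~R - x i) * a p i) ur.
exists (fun l => if l == i then k else z l); split => [l|].
  by rewrite inE negb_or => /andP[/negbTE-> /z0].
rewrite !big_cons eqxx.
have zr l : l \in r -> (if l == i then k else z l) = z l.
  by move=> lr; case: eqP => // li; rewrite li (negbTE ir) in lr.
rewrite (eq_big_seq (fun l => c l * `|(z l)%:~R| + c' * (z l)%:~R ^+ 2));
  last by move=> l lr /=; rewrite zr.
rewrite (eq_bigr (fun p => (w p + (k%:~R - x i) * a p i +
   \sum_(i0 <- r) ((z i0)%:~R - x i0) * a p i0) ^+ 2)); last first.
  move=> p _; rewrite big_cons eqxx addrA; congr ((_ + _) ^+ 2).
  by apply: eq_big_seq => l lr /=; rewrite zr.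
move: kP; rewrite /cost /tot => kP; lra.
Qed.

(* Derandomised unbiased rounding: each [x i] is rounded to one of the two
   neighbouring integers so that all the listed quantities stay below the value
   that independent unbiased random rounding would give on average. *)
Lemma rounding (I J : finType) (P : {set J}) (S : {set I}) (a : J -> I -> R)
    (x c : I -> R) (c' : R) :
  (forall i, 0 <= c i) -> 0 <= c' ->
  exists z : I -> int, (forall i, i \notin S -> z i = 0) /\
    \sum_(p in P) (\sum_(i in S) ((z i)%:~R - x i) * a p i) ^+ 2
    + \sum_(i in S) (c i * `|(z i)%:~R| + c' * (z i)%:~R ^+ 2)
    <= \sum_(i in S) (\sum_(p in P) a p i ^+ 2
         + (c i * `|x i| + c' * (x i ^+ 2 + `|x i|))).
Proof.
move=> c0 c'0.
have [z [z0 zP]] := @rounding_seq I J P (enum S) a x c c' (fun=> 0)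
  (enum_uniq _) c0 c'0.
exists z; split => [i iS|]; first by apply: z0; rewrite mem_enum.
have S0 : \sum_(p in P) (0 : R) ^+ 2 = 0 by apply: big1 => ? _; rewrite expr0n.
move: zP; rewrite S0 add0r !big_enum/= => zP.
apply: le_trans zP; rewrite lerD2r; apply: ler_sum => p _.
by rewrite add0r big_enum.
Qed.

End Rounding.

Section Dot.
Context {R : realType} {n : nat}.
Implicit Types x y : 'cV[R]_n.

Definition dot x y : R := \sum_k x k 0 * y k 0.

Lemma dotC x y : dot x y = dot y x.
Proof. by apply: eq_bigr => k _; rewrite mulrC. Qed.

Lemma dotDl x x' y : dot (x + x') y = dot x y + dot x' y.
Proof. by rewrite -big_split; apply: eq_bigr => k _ /=; rewrite mxE mulrDl. Qed.

Lemma dotZl c x y : dot (c *: x) y = c * dot x y.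
Proof. by rewrite mulr_sumr; apply: eq_bigr => k _ /=; rewrite mxE mulrA. Qed.

Lemma dotDr x y y' : dot x (y + y') = dot x y + dot x y'.
Proof. by rewrite dotC dotDl dotC (dotC y'). Qed.

Lemma dotZr c x y : dot x (c *: y) = c * dot x y.
Proof. by rewrite dotC dotZl dotC. Qed.

Lemma dot0l x : dot 0 x = 0.
Proof. by apply: big1 => k _; rewrite mxE mul0r. Qed.

Lemma dotNl x y : dot (- x) y = - dot x y.
Proof. by rewrite -scaleN1r dotZl mulN1r. Qed.

Lemma dotBr x y y' : dot x (y - y') = dot x y - dot x y'.
Proof. by rewrite dotDr (dotC x (- y')) dotNl (dotC y'). Qed.

Lemma dot_suml (I : Type) (r : seq I) (P : pred I) (F : I -> 'cV[R]_n) y :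
  dot (\sum_(i <- r | P i) F i) y = \sum_(i <- r | P i) dot (F i) y.
Proof.
by elim/big_rec2: _ => [|i z v _ IH]; rewrite ?dot0l// dotDl IH.
Qed.

Lemma dot_sumr (I : Type) (r : seq I) (P : pred I) (F : I -> 'cV[R]_n) y :
  dot y (\sum_(i <- r | P i) F i) = \sum_(i <- r | P i) dot y (F i).
Proof. by rewrite dotC dot_suml; apply: eq_bigr => i _; rewrite dotC. Qed.

Lemma dot_ge0 x : 0 <= dot x x.
Proof. by apply: sumr_ge0 => k _; rewrite -expr2 sqr_ge0. Qed.

Lemma dot_CS x y : dot x y ^+ 2 <= dot x x * dot y y.
Proof. exact: sum_CS. Qed.

End Dot.

(** * Rows strongly correlated with one combination *)

Section Level.
Context {R : realType} {n N : nat}.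
Variables (Y : 'I_N -> 'cV[R]_n) (S : {set 'I_N}) (W M : R).

Definition lcomb (z : 'I_N -> R) : 'cV[R]_n := \sum_(i in S) z i *: Y i.

Hypothesis W0 : 0 < W.
Hypothesis M0 : 0 < M.
Hypothesis HM : forall i, i \in S -> dot (Y i) (Y i) <= M.
Hypothesis HW : forall z, dot (lcomb z) (lcomb z) <= W * \sum_(i in S) z i ^+ 2.

(** A matrix and its transpose have the same norm: the combination with coefficients [dot (Y i) x]
    has inner product A with x, and Cauchy-Schwarz gives A^2 <= W A |x|^2. *)
Lemma lcomb_dual (x : 'cV[R]_n) :
  \sum_(i in S) dot (Y i) x ^+ 2 <= W * dot x x.
Proof.
set c := fun i => dot (Y i) x; set A := \sum_(i in S) c i ^+ 2.
have A0 : 0 <= A by apply: sumr_ge0 => i _; exact: sqr_ge0.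
have E : dot (lcomb c) x = A.
  by rewrite dot_suml; apply: eq_bigr => i _; rewrite dotZl -expr2.
have := dot_CS (lcomb c) x; rewrite E => h.
have := le_trans h (ler_wpM2r (dot_ge0 x) (HW c)); rewrite -/A.
have [->|An0] := eqVneq A 0; first by move=> _; apply: mulr_ge0; [exact: ltW|exact: dot_ge0].
have Ap : 0 < A by rewrite lt_neqAle eq_sym An0.
by rewrite expr2 mulrAC ler_pM2r.
Qed.

Lemma dot_lcomb_le (i : 'I_N) z : i \in S ->
  dot (Y i) (lcomb z) ^+ 2 <= M * (W * \sum_(i in S) z i ^+ 2).
Proof.
move=> iS; apply: le_trans (dot_CS _ _) _.
by apply: ler_pM; rewrite ?dot_ge0//; exact: HM.
Qed.

Definition icomb (z : 'I_N -> int) : 'cV[R]_n := \sum_i (z i)%:~R *: Y i.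

Lemma icomb_lcomb (z : 'I_N -> int) : (forall i, i \notin S -> z i = 0) ->
  icomb z = lcomb (fun i => (z i)%:~R).
Proof.
move=> z0; rewrite /icomb (bigID [in S])/= [X in _ + X]big1 ?addr0//.
by move=> i /z0->; rewrite scale0r.
Qed.

(* [P] collects rows at which a combination is tested; the coefficients [g] on [T]
   are rounded to multiples of [h]. *)
Lemma rounded_comb (P T T2 : {set 'I_N}) (g : 'I_N -> R) (h k l Z : R) :
  P \subset S -> P != finset.set0 -> T \subset S -> T2 \subset T ->
  0 < h -> 0 < k -> 0 < l -> 0 < Z ->
  \sum_(i in T2) `|g i| <= k * h -> \sum_(i in T) `|g i| <= l * h ->
  \sum_(i in T) (g i ^+ 2 + h * `|g i|) <= Z ->
  exists z : 'I_N -> int, [/\ forall i, i \notin T -> z i = 0,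
     \sum_(i in T2) `|(z i)%:~R : R| <= 4 * k,
     \sum_(i in T) `|(z i)%:~R : R| <= 4 * l,
     h ^+ 2 * \sum_(i in T) (z i)%:~R ^+ 2 <= 4 * Z &
     \sum_(p in P) dot (Y p) (h *: icomb z - \sum_(i in T) g i *: Y i) ^+ 2
       <= 4 * (h ^+ 2 * (#|P|%:R * (M * W)))].
Proof.
move=> PS P0 TS T2T h0 k0 l0 Z0 gk gl gZ.
have cP : 0 < #|P|%:R :> R by rewrite ltr0n card_gt0.
set V := h ^+ 2 * (#|P|%:R * (M * W)).
have V0 : 0 < V by rewrite !mulr_gt0.
(* With these normalisations the test errors, the two l1 norms together and the quadratic term
   contribute at most 1, 2 and 1. All parts are nonnegative, so each is at most 4 after rounding. *)
pose x i := g i / h.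
pose a (p i : 'I_N) := h * dot (Y p) (Y i) / Num.sqrt V.
pose c i := (if i \in T2 then k^-1 else 0) + l^-1 : R.
have c0 i : 0 <= c i.
  by rewrite /c; case: ifP => _; rewrite ?add0r ?addr_ge0 ?invr_ge0 ?ltW.
pose c' := h ^+ 2 / Z.
have c'0 : 0 <= c' by rewrite /c' divr_ge0 ?sqr_ge0// ltW.
have [z [z0 zP]] := @rounding R 'I_N 'I_N P T a x c c' c0 c'0.
have sV : Num.sqrt V ^+ 2 = V by rewrite sqr_sqrtr// ltW.
have sV0 : 0 < Num.sqrt V by rewrite sqrtr_gt0.
have xE i : `|x i| = `|g i| / h by rewrite normrM [X in _ * X]gtr0_norm ?invr_gt0.
have RHS : \sum_(i in T) (\sum_(p in P) a p i ^+ 2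
         + (c i * `|x i| + c' * (x i ^+ 2 + `|x i|))) <= 4.
  rewrite big_split/= big_split/=.
  (* By duality the squared inner products of one row with all the others sum to at most [W * M],
     whatever the size of T. *)
  have e1 : \sum_(i in T) \sum_(p in P) a p i ^+ 2 <= 1.
    rewrite exchange_big/=.
    have -> : 1 = \sum_(p in P) (#|P|%:R^-1 : R).
      by rewrite sumr_const -[RHS]mulr_natl mulfV// gt_eqF.
    apply: ler_sum => p pP.
    have -> : \sum_(i in T) a p i ^+ 2
        = h ^+ 2 / V * \sum_(i in T) dot (Y i) (Y p) ^+ 2.
      rewrite mulr_sumr; apply: eq_bigr => i _.
      by rewrite /a dotC !exprMn exprVn sV; ring.
    have pS : p \in S by exact: (fintype.subsetP PS).
    have : \sum_(i in T) dot (Y i) (Y p) ^+ 2 <= W * M.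
      apply: (@le_trans _ _ (\sum_(i in S) dot (Y i) (Y p) ^+ 2)).
        rewrite [leRHS](big_setID T)/= (finset.setIidPr TS) lerDl.
        by apply: sumr_ge0 => i _; exact: sqr_ge0.
      by apply: le_trans (lcomb_dual _) _; apply: ler_wpM2l; [exact: ltW|exact: HM].
    have hV : 0 <= h ^+ 2 / V by rewrite divr_ge0 ?sqr_ge0// ltW.
    move=> /(ler_wpM2l hV)/le_trans; apply.
    rewrite /V le_eqVlt; apply/orP; left; apply/eqP; field.
    by rewrite !gt_eqF.
  have e2 : \sum_(i in T) c i * `|x i| <= 2.
    have -> : \sum_(i in T) c i * `|x i|
        = (\sum_(i in T2) `|g i|) / (k * h) + (\sum_(i in T) `|g i|) / (l * h).
      rewrite !mulr_suml [in X in X + _](big_mkcond) [in X in X + _]/=.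
      rewrite [X in _ = X + _](_ : _ = \sum_(i in T)
          (if i \in T2 then `|g i| / (k * h) else 0)); last first.
        rewrite [in RHS]big_mkcond/=; apply: eq_bigr => i _.
        case: (boolP (i \in T2)) => [iT|]; last by case: (i \in T).
        by rewrite (fintype.subsetP T2T _ iT).
      rewrite -big_split/=; apply: eq_bigr => i _; rewrite xE /c mulrDl.
      have h1 : h != 0 by rewrite gt_eqF.
      have k1 : k != 0 by rewrite gt_eqF.
      have l1 : l != 0 by rewrite gt_eqF.
      congr (_ + _); last by field; rewrite h1 l1.
      by case: ifP => _; [field; rewrite h1 k1|rewrite mul0r].
    rewrite -[2]/(1 + 1); apply: lerD; rewrite ler_pdivrMr ?mul1r// mulr_gt0//.
  have e3 : \sum_(i in T) c' * (x i ^+ 2 + `|x i|) <= 1.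
    have -> : \sum_(i in T) c' * (x i ^+ 2 + `|x i|)
        = (\sum_(i in T) (g i ^+ 2 + h * `|g i|)) / Z.
      rewrite mulr_suml; apply: eq_bigr => i _; rewrite xE /c' /x; field.
      by rewrite !gt_eqF.
    by rewrite ler_pdivrMr// mul1r.
  lra.
have {zP RHS} := le_trans zP RHS.
rewrite big_split/=.
set A := \sum_(p in P) _; set B := \sum_(i in T) c i * _; set C := \sum_(i in T) c' * _.
have A0 : 0 <= A by apply: sumr_ge0 => p _; exact: sqr_ge0.
have B0 : 0 <= B by apply: sumr_ge0 => p _; rewrite mulr_ge0.
have C0 : 0 <= C by apply: sumr_ge0 => p _; rewrite mulr_ge0 ?sqr_ge0.
move=> ABC.
have B4 : B <= 4 by lra.
exists z; split => //.
- have : (\sum_(i in T2) `|(z i)%:~R : R|) / k <= B.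
    rewrite mulr_suml /B [leRHS](big_setID T2)/= (finset.setIidPr T2T).
    rewrite ler_wpDr//; first by apply: sumr_ge0 => p _; rewrite mulr_ge0.
    apply: ler_sum => i iT; rewrite mulrC ler_wpM2r// /c iT lerDl.
    by rewrite invr_ge0 ltW.
  by move=> /le_trans/(_ B4); rewrite ler_pdivrMr.
- have : (\sum_(i in T) `|(z i)%:~R : R|) / l <= B.
    rewrite mulr_suml /B; apply: ler_sum => i iT; rewrite mulrC ler_wpM2r// /c.
    by case: ifP; rewrite ?add0r// lerDr invr_ge0 ltW.
  by move=> /le_trans/(_ B4); rewrite ler_pdivrMr.
- have : C <= 4 by lra.
  rewrite /C -mulr_sumr /c' mulrAC ler_pdivrMr//.
- have A4 : A <= 4 by lra.
  have -> : \sum_(p in P) dot (Y p) (h *: icomb z - \sum_(i in T) g i *: Y i) ^+ 2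
      = V * A.
    rewrite /A mulr_sumr; apply: eq_bigr => p _.
    have -> : h *: icomb z = \sum_(i in T) (h * (z i)%:~R) *: Y i.
      rewrite /icomb (bigID [in T])/= [X in _ + X]big1 ?addr0; last first.
        by move=> i /z0->; rewrite scale0r.
      by rewrite scaler_sumr; apply: eq_bigr => i _; rewrite scalerA.
    rewrite -sumrB dot_sumr -[in RHS]sV -exprMn mulr_sumr; congr (_ ^+ 2).
    apply: eq_bigr => i _; rewrite -scalerBl dotZr /a /x; field.
    by rewrite !gt_eqF.
  by rewrite mulrC ler_wpM2r// ltW.
Qed.

End Level.

Section LevelBound.
Context {R : realType} {n N : nat}.
Variables (Y : 'I_N -> 'cV[R]_n) (S : {set 'I_N}) (W M : R).
Hypothesis W0 : 0 < W.
Hypothesis M0 : 0 < M.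
Hypothesis HM : forall i, i \in S -> dot (Y i) (Y i) <= M.
Hypothesis HW : forall z, dot (lcomb Y S z) (lcomb Y S z)
                            <= W * \sum_(i in S) z i ^+ 2.

(** Otherwise each row of P belongs to one of four small sets: rows outside the support with a large
    correlation to the rounded combination (fewer than q/4, by hypothesis), rows with a large
    rounding error (at most #|P|/4, Markov), rows with a large correlation to [G3] (at most q/4,
    duality and Markov), and the support itself (at most 9 k <= q/8). Together these are fewer than
    #|P|. *)
Lemma level_bound (q : nat) (k : nat) (P T T2 : {set 'I_N}) (g : 'I_N -> R)
    (G3 : 'cV[R]_n) (h l Z t r s b : R) :
  P \subset S -> (q <= #|P|)%N -> T \subset S -> T2 \subset T ->
  0 < h -> 0 < l -> 0 < Z -> 0 <= t -> 0 <= s -> 0 < r -> r ^+ 2 = q%:R ->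
  (0 < k)%N -> (72 * k <= q)%N -> (#|T :\: T2| <= k)%N ->
  \sum_(i in T2) `|g i| <= (2 * k%:R) * h -> \sum_(i in T) `|g i| <= l * h ->
  \sum_(i in T) (g i ^+ 2 + h * `|g i|) <= Z ->
  dot G3 G3 <= W * s ^+ 2 ->
  (forall z : 'I_N -> int, (forall i, i \notin S -> z i = 0) ->
     (#|[set i in S | z i != 0]| <= 9 * k)%N -> \sum_i `|(z i)%:~R : R| <= 4 * l ->
     (4 * #|[set i in S | (z i == 0) && (t ^+ 2 * dot (icomb Y z) (icomb Y z)
              < dot (Y i) (icomb Y z) ^+ 2)%R]| < q)%N) ->
  (forall p, p \in P ->
     b < `|dot (Y p) (\sum_(i in T) g i *: Y i + G3)|) ->
  b < t * Num.sqrt (4 * (W * Z)) + 4 * h * Num.sqrt (M * W) + 2 * W * s / r.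
Proof.
move=> PS qP TS T2T h0 l0 Z0 t0 s0 r0 rq k0 kq T2k gk gl gZ G3s E2 bP.
rewrite ltNge; apply/negP => bge.
have q1 : (0 < q)%N by move: k0 kq; clear; lia.
have P0 : P != finset.set0 by rewrite -card_gt0 (leq_trans q1).
have k0' : 0 < 2 * k%:R :> R by rewrite mulr_gt0// ltr0n.
have [z [z0 zk zl zZ zN]] := rounded_comb W0 M0 HM HW PS P0 TS T2T h0 k0' l0 Z0 gk gl gZ.
have zS i : i \notin S -> z i = 0.
  by move=> iS; apply: z0; apply: contra iS => /(fintype.subsetP TS).
(* All of [T :\: T2] may be used, at most k rows. On [T2] a nonzero integer has absolute value at
   least 1, so the l1 bound [4 * (2 * k)] admits at most 8 k further rows. *)
have zsup : (#|[set i in S | z i != 0%R]| <= 9 * k)%N.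
  have sub : [set i in S | z i != 0%R] \subset (T :\: T2) :|: [set i in T2 | z i != 0%R].
    apply/fintype.subsetP => i; rewrite !inE => /andP[iS zi].
    have iT : i \in T by apply: contraNT zi => /z0->.
    by rewrite iT zi andbT andbT orNb.
  apply: leq_trans (subset_leq_card sub) _.
  apply: leq_trans (leq_card_setU _ _) _.
  suff h8 : (#|[set i in T2 | z i != 0%R]| <= 8 * k)%N.
    by apply: leq_trans (leq_add T2k h8) _; clear; lia.
  rewrite -(ler_nat R) natrM; have -> : 8 * k%:R = 4 * (2 * k%:R) :> R by ring.
  apply: le_trans zk; rewrite -sum1_card natr_sum.
  rewrite [leRHS](big_setID [set i in T2 | z i != 0%R])/= ler_wpDr ?sumr_ge0//.
  rewrite (finset.setIidPr _); last first.
    by apply/fintype.subsetP => i; rewrite inE => /andP[].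
  apply: ler_sum => i; rewrite inE => /andP[_ zi].
  by rewrite -intr_norm ler1z; move: zi; clear; lia.
have zl' : \sum_i `|(z i)%:~R : R| <= 4 * l.
  rewrite (bigID [in T])/= [X in _ + X]big1 ?addr0//.
  by move=> i /z0->; rewrite normr0.
have {E2} := E2 z zS zsup zl'; set x := icomb Y z; set B := [set i in S | _] => Bq.
pose u := h *: x - \sum_(i in T) g i *: Y i.
have xu : dot (h *: x) (h *: x) <= 4 * (W * Z).
  rewrite dotZl dotZr mulrA -expr2 /x (icomb_lcomb Y zS).
  have /(ler_wpM2l (sqr_ge0 h)) := HW (fun i => (z i)%:~R).
  move=> /le_trans; apply.
  have -> : \sum_(i in S) (z i)%:~R ^+ 2 = \sum_(i in T) (z i)%:~R ^+ 2 :> R.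
    rewrite (big_setID T)/= (finset.setIidPr TS) [X in _ + X]big1 ?addr0//.
    by move=> i; rewrite inE => /andP[/z0-> _]; rewrite expr0n.
  have := ler_wpM2l (ltW W0) zZ.
  by rewrite mulrCA; move=> /le_trans; apply; rewrite mulrCA.
pose c1 := 16 * (h ^+ 2 * (M * W)).
pose c2 := 4 * W ^+ 2 * s ^+ 2 / q%:R.
have q0 : 0 < q%:R :> R by rewrite ltr0n.
have MW0 : 0 < M * W by rewrite mulr_gt0.
have c10 : 0 <= c1 by rewrite /c1 !mulr_ge0// ?sqr_ge0// ltW.
have c20 : 0 <= c2 by rewrite /c2 divr_ge0 ?mulr_ge0 ?sqr_ge0// ltW.
pose B1 := [set p in P | c1 < dot (Y p) u ^+ 2].
pose B2 := [set p in P | c2 < dot (Y p) G3 ^+ 2].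
have B1c : #|B1|%:R <= #|P|%:R / 4 :> R.
  apply: (@card_markov _ _ P (fun p => dot (Y p) u ^+ 2) c1); [exact: c10|by rewrite divr_ge0|by move=> i _; exact: sqr_ge0|].
  by apply: le_trans zN _; rewrite le_eqVlt /c1; apply/orP; left; apply/eqP; field.
have B2c : #|B2|%:R <= q%:R / 4 :> R.
  apply: (@card_markov _ _ P (fun p => dot (Y p) G3 ^+ 2) c2); [exact: c20|by rewrite divr_ge0|by move=> i _; exact: sqr_ge0|].
  apply: (@le_trans _ _ (\sum_(i in S) dot (Y i) G3 ^+ 2)).
    rewrite [leRHS](big_setID P)/= (finset.setIidPr PS) lerDl.
    by apply: sumr_ge0 => i _; exact: sqr_ge0.
  apply: le_trans (lcomb_dual W0 HW G3) _.
  apply: le_trans (ler_wpM2l (ltW W0) G3s) _.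
  rewrite /c2 le_eqVlt; apply/orP; left; apply/eqP; field.
  by rewrite gt_eqF.
pose B3 := [set i in S | z i != 0%R].
have Psub : P \subset B :|: (B1 :|: (B2 :|: B3)).
  apply/fintype.subsetP => p pP; rewrite !inE pP (fintype.subsetP PS p pP)/=.
  have [?|u2] := ltP c1 (dot (Y p) u ^+ 2); first by rewrite /= ?orbT.
  have [?|g2] := ltP c2 (dot (Y p) G3 ^+ 2); first by rewrite /= ?orbT.
  have [zp|?] := eqVneq (z p) 0; last by rewrite /= ?orbT.
  rewrite !orbF/= ltNge; apply/negP => xle.
  have := bP p pP; rewrite ltNge => /negP; apply; apply: le_trans bge.
  have -> : \sum_(i in T) g i *: Y i + G3 = h *: x - u + G3 by rewrite /u subKr.
  rewrite dotDr dotBr.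
  have uc : `|dot (Y p) u| <= 4 * h * Num.sqrt (M * W).
    rewrite -[leLHS]sqrtr_sqr.
    rewrite (_ : 4 * h * _ = Num.sqrt c1) ?ler_wsqrtr//.
    rewrite /c1 -[4 * h]ger0_norm; last by rewrite mulr_ge0// ltW.
    rewrite -sqrtr_sqr -sqrtrM ?sqr_ge0//; congr Num.sqrt; ring.
  have gc : `|dot (Y p) G3| <= 2 * W * s / r.
    rewrite -[leLHS]sqrtr_sqr.
    rewrite (_ : 2 * W * s / r = Num.sqrt c2) ?ler_wsqrtr//.
    rewrite -[LHS]ger0_norm; last by rewrite divr_ge0 ?mulr_ge0// ltW.
    rewrite -sqrtr_sqr; congr Num.sqrt; rewrite /c2 -rq; field.
    by rewrite gt_eqF.
  have xc : `|dot (Y p) (h *: x)| <= t * Num.sqrt (4 * (W * Z)).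
    rewrite -[leLHS]sqrtr_sqr.
    rewrite -[t]ger0_norm// -sqrtr_sqr -sqrtrM ?sqr_ge0// ler_wsqrtr//.
    apply: (@le_trans _ _ (t ^+ 2 * dot (h *: x) (h *: x))).
      rewrite !(dotZr, dotZl) exprMn.
      rewrite (_ : t ^+ 2 * (h * (h * dot x x)) = h ^+ 2 * (t ^+ 2 * dot x x)).
        by rewrite ler_wpM2l ?sqr_ge0.
      by ring.
    by rewrite ler_wpM2l ?sqr_ge0.
  apply: le_trans (ler_normD _ _) _; apply: lerD => //.
  apply: le_trans (ler_normB _ _) _; apply: lerD => //.
have cP : (#|P| <= #|B| + (#|B1| + (#|B2| + #|B3|)))%N.
  apply: leq_trans (subset_leq_card Psub) _.
  do 3! (apply: leq_trans (leq_card_setU _ _) _; rewrite leq_add2l).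
  exact: leqnn.
have : (4 * #|B1| <= #|P|)%N.
  by rewrite -(ler_nat R) natrM mulrC -ler_pdivlMr.
have : (4 * #|B2| <= q)%N.
  by rewrite -(ler_nat R) natrM mulrC -ler_pdivlMr.
move: Bq zsup kq qP cP; rewrite -/B3; clear; lia.
Qed.

End LevelBound.

(** * Geometric series, layer cake and a Schur test *)

Section Geometric.
Context {R : realType}.

Lemma sum_pow_le (c m : nat) : (1 < c)%N -> \sum_(j < m) (c%:R : R) ^+ j <= c%:R ^+ m.
Proof.
move=> c1; have c2 : 2 <= c%:R :> R by rewrite ler_nat.
elim: m => [|m IH]; first by rewrite big_ord0 expr0.
rewrite big_ord_recr/= exprS; apply: le_trans (lerD IH (lexx _)) _.
have : 0 <= c%:R ^+ m :> R by rewrite exprn_ge0.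
nra.
Qed.

Lemma sum_pow_lt_le (c m k : nat) : (1 < c)%N ->
  \sum_(j < m | (j < k)%N) (c%:R : R) ^+ j <= c%:R ^+ k.
Proof.
move=> c1; apply: le_trans (sum_pow_le k c1).
have [km|mk] := leqP k m.
  by rewrite (big_ord_widen_cond m xpredT (fun j => c%:R ^+ j)).
rewrite (eq_bigl xpredT); last first.
  by move=> j /=; rewrite (ltn_trans (ltn_ord j) mk).
rewrite (big_ord_widen k (fun j => c%:R ^+ j) (ltnW mk)) big_mkcond/=.
by apply: ler_sum => i _; case: ifP => // _; rewrite exprn_ge0.
Qed.

Lemma sum_sqr_le_sqr_sum (I : finType) (P : pred I) (f : I -> R) :
  (forall i, 0 <= f i) -> \sum_(i | P i) f i ^+ 2 <= (\sum_(i | P i) f i) ^+ 2.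
Proof.
move=> f0; rewrite expr2 mulr_suml; apply: ler_sum => i Pi.
rewrite expr2 ler_wpM2l// (bigD1 i)//= lerDl; exact: sumr_ge0.
Qed.

Lemma sum_inv_pow_le (r m : nat) :
  \sum_(j < m | (r <= j)%N) (2 : R) ^+ r / 2 ^+ j <= 2.
Proof.
(* The induction needs the exact remainder of the geometric series. *)
suff H : \sum_(j < m | (r <= j)%N) (2 : R) ^+ r / 2 ^+ j
    <= 2 - (if (r <= m)%N then 2 * 2 ^+ r / 2 ^+ m else 2).
  apply: le_trans H _; rewrite lerBlDr lerDl; case: ifP => // _.
elim: m => [|m IH].
  rewrite big_ord0; case: ifP; last by rewrite subrr.
  by rewrite leqn0 => /eqP->; rewrite expr0 mulr1 divr1 subrr.
rewrite big_mkcond big_ord_recr/= -big_mkcond/=.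
have p0 : (2 : R) ^+ m != 0 by rewrite expf_neq0.
case: (ltngtP r m) IH => [rm|mr|->] IH.
  rewrite (leqW (ltnW rm)) /= in IH *.
  apply: le_trans (lerD IH (lexx _)) _; rewrite exprS.
  by rewrite le_eqVlt; apply/orP; left; apply/eqP; field.
- rewrite addr0; apply: le_trans IH _; rewrite subrr.
  case: ifP => [|_]; last by rewrite subrr.
  move=> rm; have -> : r = m.+1 by lia.
  by rewrite mulfK ?subrr// expf_neq0.
- rewrite leqnSn; apply: le_trans (lerD IH (lexx _)) _.
  rewrite exprS.
  by rewrite le_eqVlt; apply/orP; left; apply/eqP; field.
Qed.

Lemma sum_rev_pow_le (x : R) m : 0 <= x -> x < 1 ->
  \sum_(j < m.+1) x ^+ (m - j) <= (1 - x)^-1.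
Proof.
move=> x0 x1; rewrite (reindex_inj rev_ord_inj)/=.
rewrite (eq_bigr (fun j : 'I_m.+1 => x ^+ j)); last first.
  by move=> j _; rewrite subSS subKn// -ltnS.
have x1' : 0 < 1 - x by rewrite subr_gt0.
rewrite -[leRHS]div1r ler_pdivlMr//.
have -> : (\sum_(j < m.+1) x ^+ j) * (1 - x) = 1 - x ^+ m.+1.
  by rewrite mulrC -opprB mulNr -subrX1 opprB.
by rewrite lerBlDr lerDl exprn_ge0.
Qed.

(** No index exceeds [b 0], since fewer than 4^0 = 1 do. An index above [b j.+1] is charged [b j],
    and the factor 4 absorbs this shift of j. *)
Lemma layer_cake (I : finType) (A : {set I}) (f : I -> R) (b : nat -> R) (J : nat) :
  (forall j, 0 <= b j) -> (#|A| <= 4 ^ J)%N ->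
  (forall j, (j <= J)%N -> (#|[set i in A | (b j < f i)%R]| < 4 ^ j)%N) ->
  \sum_(i in A) f i <= 4 * \sum_(j < J.+1) 4 ^+ j * b j.
Proof.
move=> b0 cA cb.
have pt i : i \in A ->
    f i <= b J + \sum_(j < J) (if b j.+1 < f i then b j else 0).
  move=> iA; have f0 : f i <= b 0%N.
    rewrite leNgt; apply/negP => h; have := cb 0%N isT.
    by rewrite expn0 ltnS leqn0 => /eqP/cards0_eq/setP/(_ i); rewrite !inE iA h.
  elim: (J) => [|m IH]; first by rewrite big_ord0 addr0.
  rewrite big_ord_recr/=; case: ltP => [h|h].
    by have := b0 m.+1; lra.
  by rewrite addr0 (le_trans h)// lerDl sumr_ge0// => j _; case: ifP.
apply: le_trans (ler_sum _ pt) _.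
rewrite big_split/= sumr_const exchange_big/= big_ord_recr/= mulrDr addrC.
apply: lerD.
  rewrite mulr_sumr; apply: ler_sum => j _.
  rewrite -big_mkcondr/= sumr_const -[b j *+ _]mulr_natl mulrA.
  rewrite ler_wpM2r// -exprS -natrX ler_nat ltnW//.
  rewrite (eq_card (B := [set i in A | b j.+1 < f i])); last by move=> i; rewrite !inE.
  by rewrite cb.
rewrite -[b J *+ _]mulr_natl mulrA ler_wpM2r//.
rewrite -natrX -natrM ler_nat; lia.
Qed.

(** Schur test: u_J u_r is at most the mean of the two squares, and the kernel 2^(r - J) on r <= J
    has row and column sums at most 2. *)
Lemma schur_sum (u : nat -> R) (m : nat) : (forall j, 0 <= u j) ->
  \sum_(J < m) \sum_(r < m | (r <= J)%N) (2 ^+ r / 2 ^+ J) * (u J * u r)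
    <= 2 * \sum_(J < m) u J ^+ 2.
Proof.
move=> u0.
have -> : 2 * \sum_(J < m) u J ^+ 2 = \sum_(J < m) u J ^+ 2 + \sum_(J < m) u J ^+ 2.
  by rewrite mulr2n mulrDl mul1r.
apply: (@le_trans _ _
  (\sum_(J < m) \sum_(r < m | (r <= J)%N) (2 ^+ r / 2 ^+ J) * (u J ^+ 2 / 2)
 + \sum_(J < m) \sum_(r < m | (r <= J)%N) (2 ^+ r / 2 ^+ J) * (u r ^+ 2 / 2))).
  rewrite -big_split/=; apply: ler_sum => J _; rewrite -big_split/=.
  apply: ler_sum => r _; rewrite -mulrDr ler_wpM2l ?divr_ge0 ?exprn_ge0//.
  have := sqr_ge0 (u J - u r); nra.
apply: lerD.
  apply: ler_sum => J _; rewrite -mulr_suml -mulr_suml.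
  have J0 : 0 < (2 : R) ^+ J by rewrite exprn_gt0.
  have h : (\sum_(r < m | (r <= J)%N) (2 : R) ^+ r) / 2 ^+ J <= 2.
    rewrite ler_pdivrMr// -exprS; apply: le_trans (sum_pow_lt_le m J.+1 (isT : 1 < 2)%N).
    by rewrite le_eqVlt; apply/orP; left; apply/eqP; apply: eq_bigl => r; rewrite ltnS.
  have := ler_wpM2r (divr_ge0 (sqr_ge0 (u J)) (ler0n R 2)) h.
  by move=> /le_trans; apply; rewrite mulrCA mulfV ?mulr1.
rewrite (exchange_big_dep xpredT)//=.
apply: ler_sum => r _; rewrite -mulr_suml.
have := ler_wpM2r (divr_ge0 (sqr_ge0 (u r)) (ler0n R 2)) (sum_inv_pow_le r m).
by move=> /le_trans; apply; rewrite mulrCA mulfV ?mulr1.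
Qed.

(** Summing over j first turns 2^j into K 2^r and leaves the kernel of the Schur test. It serves
    both for [j <= r + e], with K = 2 * 2^e, and for [j + 10 <= r], with K = 2 / 2^10. *)
Lemma tri_sum (u : nat -> R) (m : nat) (p : rel nat) (K : R) : (forall j, 0 <= u j) ->
  0 <= K -> (forall J r, \sum_(j < J | p j r) (2 : R) ^+ j <= K * 2 ^+ r) ->
  \sum_(J < m) \sum_(j < J.+1) (2 ^+ j / 2 ^+ J)
      * (u J * \sum_(r < m | (r <= J)%N && p j r) u r)
    <= K * (2 * \sum_(J < m) u J ^+ 2).
Proof.
move=> u0 K0 pK; apply: le_trans (ler_wpM2l K0 (schur_sum m u0)).
rewrite mulr_sumr; apply: ler_sum => J _.
have -> : \sum_(j < J.+1) (2 ^+ j / 2 ^+ J) * (u J * \sum_(r < m | (r <= J)%N && p j r) u r)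
  = \sum_(r < m | (r <= J)%N) (\sum_(j < J.+1 | p j r) (2 : R) ^+ j) * (u J * u r / 2 ^+ J).
  transitivity (\sum_(j < J.+1) \sum_(r < m | (r <= J)%N)
     (if p j r then (2 : R) ^+ j else 0) * (u J * u r / 2 ^+ J)).
    apply: eq_bigr => j _; rewrite big_mkcondr/= mulrA mulr_sumr.
    by apply: eq_bigr => r _; case: ifP => _; [ring|rewrite mulr0 mul0r].
  by rewrite exchange_big/=; apply: eq_bigr => r _; rewrite -mulr_suml -big_mkcond.
rewrite mulr_sumr; apply: ler_sum => r _.
apply: le_trans (ler_wpM2r _ (pK J.+1 r)) _.
  by rewrite divr_ge0 ?mulr_ge0 ?exprn_ge0.
by rewrite le_eqVlt; apply/orP; left; apply/eqP; ring.
Qed.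

End Geometric.

(** * Summation over dyadic levels *)

Section Blocks.
Context {R : realType} {n N : nat}.
Variables (Y : 'I_N -> 'cV[R]_n) (S : {set 'I_N}) (W M : R).
Hypothesis W0 : 0 < W.
Hypothesis M0 : 0 < M.
Hypothesis HM : forall i, i \in S -> dot (Y i) (Y i) <= M.
Hypothesis HW : forall z, dot (lcomb Y S z) (lcomb Y S z)
                            <= W * \sum_(i in S) z i ^+ 2.
Variables (lev : 'I_N -> nat) (y : 'I_N -> R) (beta : nat -> R) (J0 e j0 : nat).
Variables (tau theta : R).
Hypothesis levJ : forall i, i \in S -> (lev i <= J0)%N.
Hypothesis cblk : forall J, (#|[set i in S | lev i == J]| <= 4 ^ J)%N.
Hypothesis ybeta : forall i, i \in S -> `|y i| <= beta (lev i).
Hypothesis beta0 : forall J, 0 <= beta J.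
Let u J : R := 2 ^+ J * beta J.
Hypothesis hu : \sum_(J < J0.+1) u J ^+ 2 <= 5.
Hypothesis e4 : (4 <= e)%N.
Hypothesis ej0 : (e <= j0)%N.
Hypothesis tau0 : 0 <= tau.
Hypothesis theta0 : 0 <= theta.
Hypothesis theta1 : theta < 1.

(** 4^j rows at the threshold tau / 2^j carry a sum of squares tau^2; the power of [theta] makes the
    sum over levels converge. *)
Definition tlev j : R := tau * theta ^+ (J0 - j) / 2 ^+ j.

Hypothesis E2 : forall j, (j0 <= j)%N -> (j <= J0)%N ->
  forall z : 'I_N -> int, (forall i, i \notin S -> z i = 0) ->
     (#|[set i in S | z i != 0]| <= 9 * 4 ^ (j - e))%N ->
     \sum_i `|(z i)%:~R : R| <= 32 * 2 ^+ (j - e + J0) ->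
     (4 * #|[set i in S | (z i == 0) && (tlev j ^+ 2 * dot (icomb Y z) (icomb Y z)
              < dot (Y i) (icomb Y z) ^+ 2)%R]| < 4 ^ j)%N.

Let u0 J : 0 <= u J. Proof. by rewrite mulr_ge0 ?exprn_ge0. Qed.

Let u3 J : (J <= J0)%N -> u J <= 3.
Proof.
move=> JJ; have : u J ^+ 2 <= 5.
  apply: le_trans hu; rewrite (bigD1 (Ordinal (JJ : J < J0.+1)%N))//= lerDl.
  by apply: sumr_ge0 => i _; exact: sqr_ge0.
by have := u0 J; nra.
Qed.

Lemma blk_sum (p : pred nat) (f : nat -> R) : (forall r, 0 <= f r) ->
  \sum_(i in S | p (lev i)) f (lev i) <= \sum_(r < J0.+1 | p r) 4 ^+ r * f r.
Proof.
move=> f0; pose F i : 'I_J0.+1 := inord (lev i).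
have FE i : i \in S -> F i = lev i :> nat.
  by move=> iS; rewrite inordK// ltnS levJ.
rewrite (partition_big F (fun r : 'I_J0.+1 => p r))/=; last first.
  by move=> i /andP[iS]; rewrite FE.
apply: ler_sum => r pr.
apply: (@le_trans _ _ (\sum_(i in [set i in S | lev i == r]) f r)).
  rewrite big_mkcond [leRHS]big_mkcond/=; apply: ler_sum => i _; rewrite inE.
  case: (boolP (i \in S)) => iS //=; rewrite -val_eqE/= FE//.
  by case: eqP => [->|]; rewrite ?pr ?andbF.
by rewrite sumr_const -[leLHS]mulr_natl ler_wpM2r// -natrX ler_nat.
Qed.

Definition wcoef J i : R := if (lev i < J)%N then 2 else if lev i == J then 1 else 0.

(** By symmetry every pair of distinct levels can be charged to the larger one with weight 2, so
    that a row meets only levels up to its own. *)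
Lemma block_decomposition :
  dot (lcomb Y S y) (lcomb Y S y)
   = \sum_(i in S) y i * dot (Y i) (lcomb Y S (fun k => wcoef (lev i) k * y k)).
Proof.
pose D i k := (y i * y k) * dot (Y i) (Y k).
have L : dot (lcomb Y S y) (lcomb Y S y) = \sum_(i in S) \sum_(k in S) D i k.
  rewrite dot_suml; apply: eq_bigr => i _; rewrite dotZl dot_sumr mulr_sumr.
  by apply: eq_bigr => k _; rewrite dotZr /D; ring.
have RR : \sum_(i in S) y i * dot (Y i) (lcomb Y S (fun k => wcoef (lev i) k * y k))
   = \sum_(i in S) \sum_(k in S) wcoef (lev i) k * D i k.
  apply: eq_bigr => i _; rewrite dot_sumr mulr_sumr.
  by apply: eq_bigr => k _; rewrite dotZr /D; ring.
have RR' : \sum_(i in S) \sum_(k in S) wcoef (lev i) k * D i k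
   = \sum_(i in S) \sum_(k in S) wcoef (lev k) i * D i k.
  rewrite exchange_big/=; apply: eq_bigr => i _; apply: eq_bigr => k _.
  by rewrite /D dotC [y k * y i]mulrC.
rewrite L RR; set B := RHS.
suff : B + B = 2 * (\sum_(i in S) \sum_(k in S) D i k) by lra.
rewrite {2}/B RR' /B -big_split/= mulr_sumr; apply: eq_bigr => i _.
rewrite -big_split/= mulr_sumr; apply: eq_bigr => k _; rewrite -mulrDl.
congr (_ * _); rewrite /wcoef eq_sym.
by case: ltngtP => _; rewrite ?addr0 ?add0r.
Qed.

Lemma wcoef_bound J i : i \in S -> `|wcoef J i * y i| <= 2 * beta (lev i).
Proof.
move=> iS; rewrite normrM; apply: ler_pM => //; last exact: ybeta.
by rewrite /wcoef; case: ifP => _; [|case: ifP => _]; rewrite ?normr0 ?normr1 ?normr_nat// ler1n.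
Qed.

Let D : R := 3 * (e + 10)%:R.
(** Bounds the sum of g^2 + h |g| that the rounding needs: 20 is 4 times the bound 5 on the squares,
    and the product bounds h times the l1 norm. [D] accounts for at most e + 10 window levels, on
    each of which u <= 3. *)
Definition Zlev : R := 20 + (4 ^+ e * 2 ^+ 10 * D + 1) * (8 + 2 ^+ 11 * D).

(** At scale j the level r lies in the window if j - e <= r < j + 10 ([s2]) and is far if r >= j +
    10 ([s3]). Lower levels hold so few indices that all of them may enter the support. *)
Let s2 J j : R :=
  \sum_(r < J0.+1 | [&& r <= J, j <= r + e & r < j + 10]%N) u r.
Let s3 J j : R := \sum_(r < J0.+1 | (r <= J)%N && (j + 10 <= r)%N) u r.
(** Rounding step h. The first term makes the l1 norm of the window at most 2 k h for k = 4^(j-e);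
    the second keeps h positive and bounds the l1 norm of the lower levels in units of h. *)
Let hh J j : R := 4 ^+ e * 2 ^+ 10 * s2 J j / 2 ^+ j + (2 ^+ J0)^-1.

Let s20 J j : 0 <= s2 J j. Proof. by apply: sumr_ge0. Qed.
Let s30 J j : 0 <= s3 J j. Proof. by apply: sumr_ge0. Qed.

Let s2D J j : s2 J j <= D.
Proof.
rewrite /s2 (_ : D = \sum_(k < e + 10) 3); last first.
  by rewrite sumr_const card_ord /D mulr_natr.
rewrite [leLHS](_ : _ = \sum_(r < J0.+1) (if [&& r <= J, j <= r + e & r < j + 10]%N
   then u r else 0)); last by rewrite big_mkcond.
apply: (@le_trans _ _ (\sum_(r < J0.+1 | (j <= r + e)%N && (r < j + 10)%N) 3)).
  rewrite [leRHS]big_mkcond/=; apply: ler_sum => r _.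
  case: ifP => [/and3P[_ -> ->]|_]; first by rewrite u3// -ltnS.
  by case: ifP.
rewrite !sumr_const card_ord -[leLHS]mulr_natl -[leRHS]mulr_natl ler_wpM2r// ler_nat.
pose F (r : 'I_J0.+1) : 'I_(e + 10).+1 := inord (r + e - j).
have FE (r : 'I_J0.+1) : (j <= r + e)%N && (r < j + 10)%N -> F r = (r + e - j)%N :> nat.
  by move=> /andP[h1 h2]; rewrite inordK//; move: h1 h2; clear; lia.
rewrite -(card_in_image (f := F)); last first.
  move=> r r' hr hr' /(congr1 val)/=; rewrite !FE// => h.
  apply/val_inj => /=; move: h hr hr'; rewrite !unfold_in/= => h /andP[a1 _] /andP[a2 _].
  by move: h a1 a2; clear; lia.
apply: (@leq_trans #|[pred k : 'I_(e + 10).+1 | k != ord_max]|); last first.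
  by rewrite cardC1 card_ord.
apply: subset_leq_card; apply/fintype.subsetP => k /fintype.imageP[r hr ->]; rewrite inE.
apply/eqP => /(congr1 val)/=; rewrite FE//.
by move: hr; rewrite unfold_in/= => /andP[a1 a2]; move: a1 a2; clear; lia.
Qed.

(** The contributions of the integer combination, of the rounding error, of the far levels (through
    W) and, for j < j0, of plain Cauchy-Schwarz. *)
Definition blev J j : R :=
  tlev j * Num.sqrt (4 * (W * Zlev)) + 4 * hh J j * Num.sqrt (M * W)
  + 4 * W * s3 J j / 2 ^+ j + (if (j < j0)%N then Num.sqrt (20 * (M * W)) else 0).

Let hh0 J j : 0 < hh J j.
Proof.
rewrite /hh ltr_wpDl// ?invr_gt0 ?exprn_gt0// divr_ge0 ?exprn_ge0//.
by rewrite !mulr_ge0 ?exprn_ge0.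
Qed.

Lemma tlev_ge0 j : 0 <= tlev j.
Proof. by rewrite /tlev divr_ge0 ?mulr_ge0 ?exprn_ge0. Qed.

Lemma blev_ge0 J j : 0 <= blev J j.
Proof.
rewrite /blev !addr_ge0//; last by case: ifP => // _; exact: sqrtr_ge0.
- by rewrite mulr_ge0 ?tlev_ge0 ?sqrtr_ge0.
- by rewrite !mulr_ge0 ?sqrtr_ge0// ltW.
- by rewrite divr_ge0 ?exprn_ge0// !mulr_ge0// ltW.
Qed.

Lemma sum_sqr_g J (p : pred nat) :
  \sum_(i in S | p (lev i)) (wcoef J i * y i) ^+ 2
    <= 4 * \sum_(r < J0.+1 | p r) u r ^+ 2.
Proof.
apply: (@le_trans _ _ (\sum_(i in S | p (lev i)) (2 * beta (lev i)) ^+ 2)).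
  apply: ler_sum => i /andP[iS _]; rewrite -real_normK ?num_real//.
  by rewrite lerXn2r// ?nnegrE ?mulr_ge0 ?wcoef_bound.
apply: le_trans (blk_sum p (f := fun r => (2 * beta r) ^+ 2) _) _.
  by move=> r; exact: sqr_ge0.
rewrite mulr_sumr; apply: ler_sum => r _; rewrite /u.
have -> : 4 ^+ r = 2 ^+ r * 2 ^+ r :> R.
  by rewrite -exprMn; congr (_ ^+ _); rewrite -natrM.
by rewrite le_eqVlt; apply/orP; left; apply/eqP; ring.
Qed.

Lemma sum_abs_g J (p : pred nat) :
  \sum_(i in S | p (lev i)) `|wcoef J i * y i|
    <= 2 * \sum_(r < J0.+1 | p r) 2 ^+ r * u r.
Proof.
apply: (@le_trans _ _ (\sum_(i in S | p (lev i)) (2 * beta (lev i)))).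
  by apply: ler_sum => i /andP[iS _]; exact: wcoef_bound.
apply: le_trans (blk_sum p (f := fun r => 2 * beta r) _) _.
  by move=> r; rewrite mulr_ge0.
rewrite mulr_sumr; apply: ler_sum => r _; rewrite /u.
have -> : 4 ^+ r = 2 ^+ r * 2 ^+ r :> R.
  by rewrite -exprMn; congr (_ ^+ _); rewrite -natrM.
by rewrite le_eqVlt; apply/orP; left; apply/eqP; ring.
Qed.

Let G J := lcomb Y S (fun k => wcoef J k * y k).

Lemma wcoef_gt J i : (J < lev i)%N -> wcoef J i = 0.
Proof. by rewrite /wcoef => h; rewrite ltnNge (ltnW h)/= gtn_eqF. Qed.

(** For j < j0 the Cauchy-Schwarz term excludes every row. For j >= j0 this is [level_bound] with q
    = 4^j and k = 4^(j-e): the levels below j - e hold at most k indices in total, the window is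
    what [T2] denotes there, and the far levels form [G3]. *)
Lemma block_level J j : (J <= J0)%N -> (j <= J)%N ->
  (#|[set i in [set i in S | lev i == J] | (blev J j < `|dot (Y i) (G J)|)%R]| < 4 ^ j)%N.
Proof.
move=> JJ jJ; set P := [set i in _ | _]; rewrite ltnNge; apply/negP => cP.
have PS : P \subset S.
  by apply/fintype.subsetP => i; rewrite !inE => /andP[/andP[]].
have Pb p : p \in P -> blev J j < `|dot (Y p) (G J)| by rewrite inE => /andP[].
have [jj0|jj0] := ltnP j j0.
  have [p pP] : exists p, p \in P.
    by apply/set0Pn; rewrite -card_gt0 (leq_trans _ cP)// expn_gt0.
  have := Pb p pP; rewrite ltNge => /negP; apply.
  apply: (@le_trans _ _ (Num.sqrt (20 * (M * W)))); last first.
    rewrite /blev jj0 lerDr !addr_ge0//.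
    - by rewrite mulr_ge0 ?tlev_ge0 ?sqrtr_ge0.
    - by rewrite !mulr_ge0 ?sqrtr_ge0// ltW.
    - by rewrite divr_ge0 ?exprn_ge0// !mulr_ge0// ltW.
  rewrite -sqrtr_sqr ler_wsqrtr//.
  apply: le_trans (dot_lcomb_le HM HW _ (fintype.subsetP PS _ pP)) _.
  rewrite (_ : 20 * (M * W) = M * (W * (4 * 5))); last by ring.
  rewrite !ler_wpM2l ?(ltW M0) ?(ltW W0)//.
  rewrite (eq_bigl (fun i => (i \in S) && xpredT (lev i))); last first.
    by move=> i; rewrite andbT.
  by apply: le_trans (sum_sqr_g J xpredT) _; rewrite ler_wpM2l.
pose T := [set i in S | (lev i <= J)%N && (lev i < j + 10)%N].
pose T2 := [set i in S | [&& (lev i <= J), (j <= lev i + e) & (lev i < j + 10)]%N].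
pose g i := wcoef J i * y i.
pose g3 i := if (lev i <= J)%N && (j + 10 <= lev i)%N then g i else 0.
have ej : (e <= j)%N := leq_trans ej0 jj0.
have jJ0 := leq_trans jJ JJ.
have p2 m : 0 < (2 : R) ^+ m by rewrite exprn_gt0.
have four m : 4 ^+ m = 2 ^+ m * 2 ^+ m :> R.
  by rewrite -exprMn; congr (_ ^+ _); rewrite -natrM.
set k := (4 ^ (j - e))%N.
have kR : k%:R = 2 ^+ (j - e) * 2 ^+ (j - e) :> R by rewrite natrX -four.
have jsplit : 2 ^+ j = 2 ^+ (j - e) * 2 ^+ e :> R by rewrite -exprD subnK.
have T2sum : \sum_(i in T2) `|g i| <= 2 * (2 ^+ (j + 10) * s2 J j).
  rewrite (eq_bigl (fun i => (i \in S) &&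
    (fun l => [&& (l <= J), (j <= l + e) & (l < j + 10)]%N) (lev i))); last first.
    by move=> i; rewrite inE.
  apply: le_trans (sum_abs_g J (fun l => [&& l <= J, j <= l + e & l < j + 10]%N)) _.
  rewrite ler_wpM2l// mulr_sumr.
  apply: ler_sum => r /and3P[_ _ rj]; rewrite ler_wpM2r//.
  by rewrite ler_weXn2l ?ler1n// ltnW.
have T1sum : \sum_(i in T :\: T2) `|g i| <= 6 * 2 ^+ (j - e).
  apply: (@le_trans _ _ (\sum_(i in S | (lev i < j - e)%N && (lev i <= J)%N) `|g i|)).
    rewrite big_mkcond [leRHS]big_mkcond/=; apply: ler_sum => i _; rewrite !inE.
    case: (boolP (i \in S)) => //= iS; case: (boolP (lev i <= J)%N) => //= lJ;
      case: (boolP (lev i < j + 10)%N) => //= lj; rewrite ?andbT ?andbF//.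
    + by rewrite -ltnNge -ltn_subRL ltn_subRL addnC -ltn_subRL; case: ifP.
    + by case: ifP.
  apply: le_trans (sum_abs_g J (fun l => (l < j - e)%N && (l <= J)%N)) _.
  rewrite (_ : 6 * 2 ^+ (j - e) = 2 * (3 * 2 ^+ (j - e))) ?ler_wpM2l//; last by ring.
  apply: le_trans (ler_wpM2l _ (sum_pow_lt_le J0.+1 (j - e) (isT : 1 < 2)%N)); last by [].
  rewrite mulr_sumr big_mkcond [leRHS]big_mkcond/=; apply: ler_sum => r _.
  case: (ltnP r (j - e)) => //= rj.
  case: ifP => _; last by rewrite mulr_ge0 ?exprn_ge0.
  by rewrite mulrC ler_wpM2r ?exprn_ge0// u3// -ltnS.
have TT2 : T2 \subset T.
  by apply/fintype.subsetP => i; rewrite !inE => /andP[-> /and3P[-> _ ->]].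
have Tsum : \sum_(i in T) `|g i| <= 6 * 2 ^+ (j - e) + 2 * (2 ^+ (j + 10) * s2 J j).
  rewrite (big_setID T2)/= (finset.setIidPr TT2) addrC.
  exact: lerD.
have h20 : 2 ^+ (j + 10) * s2 J j <= k%:R * hh J j.
  rewrite /hh mulrDr ler_wpDr ?mulr_ge0 ?invr_ge0//.
  rewrite le_eqVlt; apply/orP; left; apply/eqP.
  rewrite kR four exprD jsplit; field.
  by rewrite !gt_eqF.
have hJ0 : (2 ^+ J0)^-1 <= hh J j.
  by rewrite /hh lerDr divr_ge0// !mulr_ge0// exprn_ge0.
have l0 : 0 < 8 * 2 ^+ (j - e + J0) :> R by rewrite mulr_gt0.
have kl : k%:R <= 2 ^+ (j - e + J0) :> R.
  by rewrite kR exprD ler_wpM2l// ler_weXn2l ?ler1n// (leq_trans (leq_subr _ _)).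
have hj : hh J j * 2 ^+ j <= 4 ^+ e * 2 ^+ 10 * D + 1.
  rewrite /hh mulrDl; apply: lerD.
    by rewrite divfK ?gt_eqF// ler_wpM2l// mulr_ge0 ?exprn_ge0.
  by rewrite mulrC ler_pdivrMr// mul1r ler_weXn2l ?ler1n.
have D0 : 0 <= D by rewrite mulr_ge0.
have Z0 : 0 < Zlev.
  by rewrite /Zlev ltr_wpDr// mulr_ge0 ?addr_ge0// !mulr_ge0// exprn_ge0.
have GE : G J = \sum_(i in T) g i *: Y i + lcomb Y S g3.
  have -> : \sum_(i in T) g i *: Y i =
      \sum_(i in S) (if (lev i <= J)%N && (lev i < j + 10)%N then g i else 0) *: Y i.
    rewrite big_mkcond [RHS]big_mkcond/=; apply: eq_bigr => i _; rewrite inE.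
    by case: (i \in S) => //=; case: ifP; rewrite ?scale0r.
  rewrite -big_split/=; apply: eq_bigr => i iS; rewrite -scalerDl; congr (_ *: _).
  rewrite /g3 leqNgt; case: (leqP (lev i) J) => [lJ|/wcoef_gt]/=; last first.
    by rewrite /g => ->; rewrite mul0r addr0.
  by rewrite -/(g i); case: ltnP; rewrite ?addr0 ?add0r.
suff : blev J j < tlev j * Num.sqrt (4 * (W * Zlev)) + 4 * hh J j * Num.sqrt (M * W)
    + 2 * W * (2 * s3 J j) / 2 ^+ j.
  have -> : 2 * W * (2 * s3 J j) / 2 ^+ j = 4 * W * s3 J j / 2 ^+ j by ring.
  have -> : blev J j = tlev j * Num.sqrt (4 * (W * Zlev))
     + 4 * hh J j * Num.sqrt (M * W) + 4 * W * s3 J j / 2 ^+ j.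
    by rewrite /blev ltnNge jj0/= addr0.
  by rewrite ltxx.
apply: (@level_bound R n N Y S W M W0 M0 HM HW (4 ^ j) k P T T2 g (lcomb Y S g3)
  (hh J j) (8 * 2 ^+ (j - e + J0)) Zlev (tlev j) (2 ^+ j) (2 * s3 J j) (blev J j)
  PS cP _ TT2 (hh0 J j) l0 Z0 (tlev_ge0 j) _ (p2 j)).
- by apply/fintype.subsetP => i; rewrite inE => /andP[].
- by rewrite mulr_ge0.
- by rewrite natrX four expr2.
- by rewrite expn_gt0.
(* Here [4 <= e] enters: 72 <= 4^4 <= 4^e. *)
- rewrite /k -[in leqRHS](subnK ej) expnD mulnC leq_mul2l; apply/orP; right.
  apply: (@leq_trans (4 ^ 4)) => //; by rewrite leq_exp2l.
- rewrite -(ler_nat R) -sum1_card natr_sum.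
  apply: (@le_trans _ _ (\sum_(i in S | (lev i < j - e)%N) 1)).
    rewrite big_mkcond [leRHS]big_mkcond/=; apply: ler_sum => i _; rewrite !inE.
    case: (boolP (i \in S)) => //= iS; case: (boolP (lev i <= J)%N) => //= lJ;
      case: (boolP (lev i < j + 10)%N) => //= lj; rewrite ?andbT ?andbF//.
    + by rewrite -ltnNge -ltn_subRL ltn_subRL addnC -ltn_subRL; case: ifP.
    + by case: ifP.
    + by case: ifP.
    + by case: ifP.
  apply: le_trans (blk_sum (fun l => (l < j - e)%N) (f := fun=> 1) _) _; first by [].
  under eq_bigr do rewrite mulr1.
  by rewrite /k natrX; exact: sum_pow_lt_le.
- by apply: le_trans T2sum _; rewrite -mulrA ler_wpM2l.
- apply: le_trans Tsum _.
  have e1 : 2 ^+ (j - e) <= 2 ^+ (j - e + J0) * hh J j.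
    apply: le_trans (ler_wpM2l (ltW (p2 _)) hJ0).
    by rewrite exprD mulfK// gt_eqF.
  have e2 := ler_wpM2r (ltW (hh0 J j)) kl.
  by move: e1 e2 h20; lra.
- rewrite big_split/= -mulr_sumr.
  have e1 : \sum_(i in T) g i ^+ 2 <= 20.
    apply: (@le_trans _ _ (\sum_(i in S | xpredT (lev i)) g i ^+ 2)).
      rewrite big_mkcond [leRHS]big_mkcond/=; apply: ler_sum => i _; rewrite inE andbT.
      by case: (i \in S) => //=; case: ifP => // _; exact: sqr_ge0.
    apply: le_trans (sum_sqr_g J xpredT) _.
    by move: hu; lra.
  rewrite /Zlev; apply: lerD => //.
  apply: le_trans (ler_wpM2l (ltW (hh0 J j)) Tsum) _.
  apply: (@le_trans _ _ ((hh J j * 2 ^+ j) * (8 + 2 ^+ 11 * s2 J j))).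
    rewrite -mulrA ler_wpM2l ?(ltW (hh0 J j))//.
    have e3 : 2 ^+ (j - e) <= 2 ^+ j :> R by rewrite ler_weXn2l ?ler1n// leq_subr.
    have -> : 2 * (2 ^+ (j + 10) * s2 J j) = 2 ^+ j * (2 ^+ 11 * s2 J j).
      by rewrite exprD (exprS _ 10); ring.
    rewrite mulrDr lerD2r; move: (p2 j) e3; lra.
  apply: ler_pM => //; first by rewrite mulr_ge0// ltW.
    by rewrite addr_ge0// mulr_ge0.
  by rewrite lerD2l ler_wpM2l.
- apply: le_trans (HW _) _; rewrite ler_wpM2l ?(ltW W0)//.
  have -> : \sum_(i in S) g3 i ^+ 2 =
      \sum_(i in S | (lev i <= J)%N && (j + 10 <= lev i)%N) g i ^+ 2.
    rewrite big_mkcondr/=; apply: eq_bigr => i _; rewrite /g3.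
    by case: ifP => // _; rewrite expr0n.
  apply: le_trans (sum_sqr_g J (fun l => (l <= J)%N && (j + 10 <= l)%N)) _.
  have -> : (2 * s3 J j) ^+ 2 = 4 * s3 J j ^+ 2 by ring.
  by rewrite ler_wpM2l// sum_sqr_le_sqr_sum.
- move=> z z0 zs zl; apply: E2 => //; apply: le_trans zl _.
  by rewrite mulrA -natrM.
- by move=> p pP; rewrite -GE; apply: le_lt_trans (Pb p pP); rewrite /blev ltnNge jj0/= addr0.
Qed.

(** The offset 10 of the far levels is chosen so that their contribution 16 W (2 / 2^10) (2 * 5)
    stays below W / 2. In the rounding term 8^e = 4^e 2^e, with 4^e from the step h and 2^e from the
    window reaching down to r = j - e. *)
Lemma block_bound :
  dot (lcomb Y S y) (lcomb Y S y) <= W / 2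
    + (48 * tau / (1 - theta)) * Num.sqrt (W * Zlev)
    + (320 * 8 ^+ e * 2 ^+ 10 + 384 + 120 * 4 ^+ j0) * Num.sqrt (M * W).
Proof.
have p2 m : 0 < (2 : R) ^+ m by rewrite exprn_gt0.
have four m : 4 ^+ m = 2 ^+ m * 2 ^+ m :> R.
  by rewrite -exprMn; congr (_ ^+ _); rewrite -natrM.
set sMW := Num.sqrt (M * W); set sWZ := Num.sqrt (W * Zlev).
have sMW0 : 0 <= sMW := sqrtr_ge0 _; have sWZ0 : 0 <= sWZ := sqrtr_ge0 _.
have s4 : Num.sqrt (4 * (W * Zlev)) = 2 * sWZ.
  rewrite sqrtrM// (_ : 4 = 2 ^+ 2 :> R); last by rewrite -natrX.
  by rewrite sqrtr_sqr ger0_norm.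
have s20MW : Num.sqrt (20 * (M * W)) <= 5 * sMW.
  rewrite sqrtrM// ler_wpM2r//.
  rewrite -[5]ger0_norm// -sqrtr_sqr ler_wsqrtr// -natrX ler_nat//.
rewrite block_decomposition.
apply: (@le_trans _ _ (\sum_(J < J0.+1) \sum_(j < J.+1) 4 * (4 ^+ j * blev J j * beta J))).
  pose F i : 'I_J0.+1 := inord (lev i).
  have FE i : i \in S -> F i = lev i :> nat by move=> iS; rewrite inordK// ltnS levJ.
  rewrite (partition_big F xpredT)//=; apply: ler_sum => J _.
  rewrite -mulr_sumr -mulr_suml mulrA.
  apply: (@le_trans _ _ ((\sum_(i in [set i in S | lev i == J]) `|dot (Y i) (G J)|) * beta J)).
    rewrite mulr_suml big_mkcond [leRHS]big_mkcond/=; apply: ler_sum => i _; rewrite inE.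
    case: (boolP (i \in S)) => iS //=; rewrite -val_eqE/= FE//.
    case: eqP => // <-; apply: le_trans (ler_norm _) _; rewrite normrM mulrC.
    by rewrite ler_wpM2l// ybeta.
  rewrite ler_wpM2r//; apply: layer_cake => //; first by move=> j; exact: blev_ge0.
  by move=> j jJ; apply: block_level => //; rewrite -ltnS.
(* In order: the thresholds, the window part of the rounding step, its part 2^-J0, the far levels,
   and the scales j < j0. *)
pose P1 J j : R := 8 * sWZ * tau * (u J * (2 ^+ j / 2 ^+ J) * theta ^+ (J0 - j)).
pose P2 J j : R := 16 * sMW * 4 ^+ e * 2 ^+ 10 * ((2 ^+ j / 2 ^+ J) * (u J *
   \sum_(r < J0.+1 | (r <= J)%N && (j <= r + e)%N) u r)).
pose P3 J j : R := 16 * sMW * (u J * (4 ^+ j / 2 ^+ J / 2 ^+ J0)).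
pose P4 J j : R := 16 * W * ((2 ^+ j / 2 ^+ J) * (u J *
   \sum_(r < J0.+1 | (r <= J)%N && (j + 10 <= r)%N) u r)).
pose P5 J j : R := 20 * sMW * (u J / 2 ^+ J * (if (j < j0)%N then 4 ^+ j else 0)).
have pw J j : 4 * (4 ^+ j * blev J j * beta J) <= P1 J j + P2 J j + P3 J j + P4 J j + P5 J j.
  have bE : beta J = u J / 2 ^+ J by rewrite /u mulrC mulKf ?gt_eqF.
  have s2le : s2 J j <= \sum_(r < J0.+1 | (r <= J)%N && (j <= r + e)%N) u r.
    rewrite /s2 big_mkcond [leRHS]big_mkcond/=; apply: ler_sum => r _.
    case: (r <= J)%N => //=; case: (j <= r + e)%N => //=; case: ifP => //.
  set s2' := \sum_(r < J0.+1 | (r <= J)%N && (j <= r + e)%N) u r in s2le *.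
  have -> : P1 J j + P2 J j + P3 J j + P4 J j + P5 J j =
    4 * (4 ^+ j * (tlev j * (2 * sWZ) + 4 * (4 ^+ e * 2 ^+ 10 * s2' / 2 ^+ j + (2 ^+ J0)^-1) * sMW
      + 4 * W * s3 J j / 2 ^+ j + (if (j < j0)%N then 5 * sMW else 0)) * (u J / 2 ^+ J)).
    rewrite /P1 /P2 /P3 /P4 /P5 /tlev -/s2' -/(s3 J j) four.
    by case: ifP => _; field; rewrite !gt_eqF.
  rewrite bE ler_wpM2l// ler_wpM2r ?divr_ge0 ?exprn_ge0//.
  rewrite ler_wpM2l ?exprn_ge0// /blev s4; apply: lerD; last by case: ifP.
  rewrite lerD2r lerD2l ler_wpM2r// ler_wpM2l// /hh lerD2r.
  by rewrite ler_wpM2r ?invr_ge0 ?exprn_ge0// ler_wpM2l.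
apply: (@le_trans _ _ (\sum_(J < J0.+1) \sum_(j < J.+1)
    (P1 J j + P2 J j + P3 J j + P4 J j + P5 J j))).
  by apply: ler_sum => J _; apply: ler_sum => j _.
have split5 : \sum_(J < J0.+1) \sum_(j < J.+1)
    (P1 J j + P2 J j + P3 J j + P4 J j + P5 J j)
  = \sum_(J < J0.+1) \sum_(j < J.+1) P1 J j + \sum_(J < J0.+1) \sum_(j < J.+1) P2 J j
  + \sum_(J < J0.+1) \sum_(j < J.+1) P3 J j + \sum_(J < J0.+1) \sum_(j < J.+1) P4 J j
  + \sum_(J < J0.+1) \sum_(j < J.+1) P5 J j.
  rewrite -!big_split/=; apply: eq_bigr => J _.
  by rewrite -!big_split/=; apply: eq_bigr => j _.
rewrite split5.
have geo J : \sum_(j < J.+1) (2 : R) ^+ j / 2 ^+ J <= 2.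
  by rewrite -mulr_suml ler_pdivrMr// -exprS; exact: sum_pow_le.
have u3' (J : 'I_J0.+1) : u J <= 3 by rewrite u3// -ltnS.
have S1 : \sum_(J < J0.+1) \sum_(j < J.+1) P1 J j <= 48 * tau / (1 - theta) * sWZ.
  apply: (@le_trans _ _ (\sum_(J < J0.+1) 8 * sWZ * tau * (6 * theta ^+ (J0 - J)))).
    apply: ler_sum => J _; rewrite -mulr_sumr ler_wpM2l ?mulr_ge0//.
    apply: (@le_trans _ _ (\sum_(j < J.+1) (2 ^+ j / 2 ^+ J) * (3 * theta ^+ (J0 - J)))).
      apply: ler_sum => j _; rewrite mulrAC mulrC ler_wpM2l ?divr_ge0 ?exprn_ge0//.
      apply: ler_pM; rewrite ?exprn_ge0//.
      by rewrite ler_wiXn2l// ?ltW// leq_sub2l// -ltnS.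
    rewrite -mulr_suml (_ : 6 * _ = 2 * (3 * theta ^+ (J0 - J))); last by ring.
    by rewrite ler_wpM2r ?mulr_ge0 ?exprn_ge0.
  rewrite -!mulr_sumr; have := sum_rev_pow_le J0 theta0 theta1.
  move=> /(ler_wpM2l (_ : 0 <= 48 * tau * sWZ)) => /(_ _)/le_trans h.
  rewrite (_ : 8 * sWZ * tau * _ = 48 * tau * sWZ * \sum_(i < J0.+1) theta ^+ (J0 - i));
    last by ring.
  rewrite (_ : 48 * tau / (1 - theta) * sWZ = 48 * tau * sWZ * (1 - theta)^-1); last by ring.
  by apply: h; rewrite ?mulr_ge0.
have S2 : \sum_(J < J0.+1) \sum_(j < J.+1) P2 J j <= 320 * 8 ^+ e * 2 ^+ 10 * sMW.
  under eq_bigr do rewrite -mulr_sumr.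
  rewrite -mulr_sumr.
  have h := @tri_sum R u J0.+1 (fun j r => (j <= r + e)%N) (2 * 2 ^+ e) u0 _ _.
  apply: le_trans (ler_wpM2l _ (h _ _)) _.
  - by rewrite !mulr_ge0 ?exprn_ge0.
  - by rewrite mulr_ge0 ?exprn_ge0.
  - move=> J r; rewrite (eq_bigl (fun j : 'I_J => (j < (r + e).+1)%N)); last first.
      by move=> j; rewrite ltnS.
    apply: le_trans (sum_pow_lt_le J (r + e).+1 (isT : 1 < 2)%N) _.
    by rewrite exprS exprD -mulrA [2 ^+ r * _]mulrC.
  - have -> : 320 * 8 ^+ e * 2 ^+ 10 * sMW
       = (16 * sMW * 4 ^+ e * 2 ^+ 10) * (2 * 2 ^+ e * (2 * 5)).
      have -> : 8 ^+ e = 4 ^+ e * 2 ^+ e :> R.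
        by rewrite -exprMn; congr (_ ^+ _); rewrite -natrM.
      by ring.
    rewrite ler_wpM2l ?mulr_ge0 ?exprn_ge0// ler_wpM2l ?mulr_ge0 ?exprn_ge0//.
    by rewrite ler_wpM2l.
have S3 : \sum_(J < J0.+1) \sum_(j < J.+1) P3 J j <= 384 * sMW.
  rewrite (_ : 384 * sMW = 16 * sMW * 24); last by ring.
  under eq_bigr do rewrite -mulr_sumr.
  rewrite -mulr_sumr ler_wpM2l ?mulr_ge0//.
  apply: (@le_trans _ _ (\sum_(J < J0.+1) 12 * (2 ^+ J / 2 ^+ J0))).
    apply: ler_sum => J _; rewrite -mulr_sumr (_ : 12 * _ = 3 * (4 * (2 ^+ J / 2 ^+ J0)));
      last by ring.
    apply: ler_pM => //; first by apply: sumr_ge0 => j _; rewrite !divr_ge0 ?exprn_ge0.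
    rewrite -mulr_suml -mulr_suml mulrA ler_wpM2r ?invr_ge0 ?exprn_ge0//.
    rewrite ler_pdivrMr// -mulrA -four -exprS; exact: sum_pow_le.
  rewrite -mulr_sumr -mulr_suml (_ : 24 = 12 * 2); last by ring.
  rewrite ler_wpM2l// ler_pdivrMr// -exprS; exact: sum_pow_le.
have S4 : \sum_(J < J0.+1) \sum_(j < J.+1) P4 J j <= W / 2.
  under eq_bigr do rewrite -mulr_sumr.
  rewrite -mulr_sumr.
  have h := @tri_sum R u J0.+1 (fun j r => (j + 10 <= r)%N) (2 / 2 ^+ 10) u0 _ _.
  apply: le_trans (ler_wpM2l _ (h _ _)) _.
  - by rewrite !mulr_ge0// ltW.
  - by rewrite divr_ge0 ?exprn_ge0.
  - move=> J r; have [r9|r9] := leqP r 9.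
      rewrite big1 ?mulr_ge0 ?divr_ge0 ?exprn_ge0// => j.
      by move: r9; clear; lia.
    rewrite (eq_bigl (fun j : 'I_J => (j < r - 9)%N)); last first.
      by move=> j; move: r9; clear; lia.
    apply: le_trans (sum_pow_lt_le J (r - 9) (isT : 1 < 2)%N) _.
    rewrite mulrAC ler_pdivlMr// -exprD -exprS.
    by rewrite ler_weXn2l ?ler1n//; move: r9; clear; lia.
  - apply: (@le_trans _ _ (16 * W * (2 / 2 ^+ 10 * (2 * 5)))).
      rewrite ler_wpM2l ?mulr_ge0 ?(ltW W0)// ler_wpM2l ?divr_ge0 ?exprn_ge0//.
      by rewrite ler_wpM2l.
    rewrite (_ : W / 2 = 16 * W * (1 / 32)); last by field.
    rewrite ler_wpM2l ?mulr_ge0 ?(ltW W0)// !exprS expr0.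
    lra.
have S5 : \sum_(J < J0.+1) \sum_(j < J.+1) P5 J j <= 120 * 4 ^+ j0 * sMW.
  rewrite (_ : 120 * 4 ^+ j0 * sMW = 20 * sMW * (6 * 4 ^+ j0)); last by ring.
  under eq_bigr do rewrite -mulr_sumr.
  rewrite -mulr_sumr ler_wpM2l ?mulr_ge0//.
  apply: (@le_trans _ _ (\sum_(J < J0.+1) (2 ^+ 0 / 2 ^+ J) * (3 * 4 ^+ j0))).
    apply: ler_sum => J _; rewrite -mulr_sumr expr0.
    rewrite [u J / _]mulrC -[leLHS]mulrA [1 / _]mul1r ler_wpM2l ?invr_ge0 ?exprn_ge0//.
    apply: ler_pM => //; first by apply: sumr_ge0 => j _; case: ifP; rewrite ?exprn_ge0.
    by rewrite -big_mkcond/=; exact: (@sum_pow_lt_le _ 4).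
  rewrite -mulr_suml (_ : 6 * _ = 2 * (3 * 4 ^+ j0)); last by ring.
  rewrite ler_wpM2r ?mulr_ge0 ?exprn_ge0//.
  by apply: le_trans (sum_inv_pow_le 0 J0.+1).
lra.
Qed.

End Blocks.

(** * Dyadic levels of a unit vector *)

Section Levels.
Context {R : realType}.

(** The number (4^J - 1) / 3 = 1 + 4 + ... + 4^(J-1) of ranks on levels below J. *)
Fixpoint lstart (J : nat) : nat := if J is K.+1 then (4 * lstart K).+1 else 0.

Lemma lstartE J : (3 * lstart J).+1 = (4 ^ J)%N.
Proof. by elim: J => //= J IH; rewrite expnS -IH; lia. Qed.

Lemma lstartS J : lstart J.+1 = (lstart J + 4 ^ J)%N.
Proof. by rewrite /= -lstartE; lia. Qed.

(** Sort |y| decreasingly; level J takes the next 4^J ranks, and [beta J] is its largest entry. Then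
    4^(J+1) (beta (J+1))^2 is at most 4 times the mass of level J, and the sum is at most 1 + 4 =
    5. *)
Lemma levels_exist (N : nat) (S : {set 'I_N}) (y : 'I_N -> R) (J0 : nat) :
  (3 * #|S| < 4 ^ J0.+1)%N -> \sum_(i in S) y i ^+ 2 <= 1 ->
  exists (lev : 'I_N -> nat) (beta : nat -> R),
  [/\ forall i, i \in S -> (lev i <= J0)%N,
      forall J, (#|[set i in S | lev i == J]| <= 4 ^ J)%N,
      forall i, i \in S -> `|y i| <= beta (lev i),
      forall J, 0 <= beta J &
      \sum_(J < J0.+1) (2 ^+ J * beta J) ^+ 2 <= 5].
Proof.
move=> cS y1.
pose ler_y (i k : 'I_N) := `|y k| <= `|y i|.
pose s := sort ler_y (enum S).
have ss : size s = #|S| by rewrite size_sort -cardE.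
have ms i : (i \in s) = (i \in S) by rewrite mem_sort mem_enum.
have us : uniq s by rewrite sort_uniq enum_uniq.
have srt : sorted ler_y s.
  by apply: sort_sorted => i k; exact: le_total.
have trs : transitive ler_y by move=> i k l h1 h2; exact: le_trans h2 h1.
(* The entry of rank r, extended by 0. The match supplies a default element for [nth], which ['I_N]
   need not have. *)
pose a r : R := if s is i0 :: _ then (if (r < size s)%N then `|y (nth i0 s r)| else 0) else 0.
have aE i0 r : (r < size s)%N -> a r = `|y (nth i0 s r)|.
  rewrite /a; case: (s) => [|i1 s'] // rs.
  by rewrite rs; congr `|y _|; exact: set_nth_default.
have a0 r : 0 <= a r by rewrite /a; case: (s) => // i1 s'; case: ifP.
have adec r r' : (r <= r')%N -> a r' <= a r.
  move=> rr; have [r's|r's] := ltnP r' (size s); last first.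
    rewrite {1}/a; case E : (s) => [|i1 s'] //; rewrite -E ltnNge r's; exact: a0.
  have [i0 _] : exists i0 : 'I_N, i0 \in s.
    by case: (s) r's => // i1 s' _; exists i1; rewrite mem_head.
  rewrite !(aE i0)// ?(leq_ltn_trans rr)//.
  apply: (sorted_leq_nth trs _ i0 srt) => //; first by move=> i; exact: lexx.
  by rewrite inE (leq_ltn_trans rr).
have asum : \sum_(0 <= r < size s) a r ^+ 2 <= 1.
  apply: le_trans y1; rewrite le_eqVlt; apply/orP; left; apply/eqP.
  rewrite -big_enum (perm_big s); last by rewrite perm_sym perm_sort.
  case E : (s) => [|i0 s']; first by rewrite big_nil big_nil.
  rewrite -E (big_nth i0); apply: eq_big_nat => r /andP[_ rs].
  by rewrite (aE i0)// real_normK ?num_real.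
(* 3 rank + 1 >= 4^J means rank >= [lstart J], so this logarithm is the level. *)
exists (fun i => trunc_log 4 (3 * index i s).+1), (fun J => a (lstart J)).
have levP i J : (trunc_log 4 (3 * index i s).+1 == J) ->
    (lstart J <= index i s < lstart J.+1)%N.
  move=> /eqP <-; set J' := trunc_log _ _.
  have /andP[h1 h2] : (4 ^ J' <= (3 * index i s).+1 < 4 ^ J'.+1)%N.
    by apply: trunc_log_bounds.
  move: h1 h2; rewrite -(lstartE J') -(lstartE J'.+1).
  by move: (lstart J') (lstart J'.+1) (index i s) => A B C; clear; lia.
split => //.
- move=> i iS.
  have : (index i s < #|S|)%N by rewrite -ss index_mem ms.
  have /andP[+ _] := levP i _ (eqxx _); set J := trunc_log _ _ => h1 h2.
  rewrite -ltnS -(ltn_exp2l _ _ (isT : 1 < 4)%N).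
  move: h1 h2 cS; rewrite -(lstartE J).
  by move: (lstart J) (index i s) (4 ^ J0.+1)%N #|S| => A B C E; clear; lia.
- move=> J; rewrite cardE -(size_map (index^~ s)) -(size_iota (lstart J) (4 ^ J)).
  apply: uniq_leq_size.
    rewrite map_inj_in_uniq ?enum_uniq// => i k; rewrite !mem_enum !inE.
    by move=> /andP[iS _] /andP[kS _]; apply: index_inj; rewrite ?ms.
  move=> r /mapP[i]; rewrite mem_enum inE => /andP[_ /levP h] ->.
  by rewrite mem_iota -lstartS.
- move=> i iS; have /andP[h _] := levP i _ (eqxx _).
  apply: le_trans (adec _ _ h); rewrite (aE i) ?index_mem ?ms//.
  by rewrite nth_index// ms.
have step J : 4 ^+ J * a (lstart J.+1) ^+ 2
    <= \sum_(lstart J <= r < lstart J.+1) a r ^+ 2.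
  have -> : 4 ^+ J * a (lstart J.+1) ^+ 2
     = \sum_(lstart J <= r < lstart J.+1) a (lstart J.+1) ^+ 2.
    by rewrite sumr_const_nat lstartS addKn -natrX mulr_natl.
  apply: ler_sum_nat => r /andP[_ h]; rewrite lerXn2r ?nnegrE//.
  by apply: adec; exact: ltnW.
have anil r : (size s <= r)%N -> a r = 0.
  by rewrite /a; case: (s) => // i1 s' h; rewrite ltnNge h.
have tot m : \sum_(0 <= r < m) a r ^+ 2 <= 1.
  have [h|h] := leqP (size s) m.
    rewrite (big_cat_nat (n := size s))//= [X in _ + X]big_nat_cond [X in _ + X]big1 ?addr0//.
    by move=> r /andP[/andP[/anil-> _] _]; rewrite expr0n.
  apply: le_trans asum; rewrite (big_cat_nat (n := m) (leq0n m) (ltnW h))/= lerDl.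
  by apply: sumr_ge0 => r _; exact: sqr_ge0.
have tele m : \sum_(J < m) 4 ^+ J * a (lstart J.+1) ^+ 2 <= \sum_(0 <= r < lstart m) a r ^+ 2.
  elim: m => [|m IH]; first by rewrite big_ord0 big_geq.
  rewrite big_ord_recr (big_cat_nat (n := lstart m)) ?lstartS ?leq_addr//=.
  by apply: lerD => //; rewrite -lstartS.
rewrite big_ord_recl expr0 mul1r.
have -> : \sum_(i < J0) (2 ^+ bump 0 i * a (lstart (bump 0 i))) ^+ 2
   = 4 * \sum_(J < J0) 4 ^+ J * a (lstart J.+1) ^+ 2.
  rewrite mulr_sumr; apply: eq_bigr => J _; rewrite /bump add1n exprMn.
  have -> : ((2 : R) ^+ J.+1) ^+ 2 = 4 * 4 ^+ J.
    by rewrite exprAC -exprS; congr (_ ^+ _); rewrite -natrX.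
  by rewrite mulrA.
have h1 := le_trans (tele J0) (tot _).
have h0 : a 0%N ^+ 2 <= 1.
  apply: le_trans (tot 1%N); rewrite big_nat1//.
by move: h0 h1; rewrite [lstart ord0]/=; lra.
Qed.

End Levels.

(** * Self-bounding argument for sparse quadratic forms *)

Section SparseBound.
Context {R : realType} {n N : nat}.
Variables (Y : 'I_N -> 'cV[R]_n) (C : {set 'I_N}) (M : R) (J0 e j0 : nat) (tau theta : R).
Hypothesis M0 : 0 < M.
Hypothesis HM : forall i, i \in C -> dot (Y i) (Y i) <= M.
Hypothesis e4 : (4 <= e)%N.
Hypothesis ej0 : (e <= j0)%N.
Hypothesis tau0 : 0 <= tau.
Hypothesis theta0 : 0 <= theta.
Hypothesis theta1 : theta < 1.
Hypothesis E2 : forall j, (j0 <= j)%N -> (j <= J0)%N ->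
  forall z : 'I_N -> int, (forall i, i \notin C -> z i = 0) ->
     (#|[set i in C | z i != 0]| <= 9 * 4 ^ (j - e))%N ->
     \sum_i `|(z i)%:~R : R| <= 32 * 2 ^+ (j - e + J0) ->
     (4 * #|[set i in C | (z i == 0) && (tlev J0 tau theta j ^+ 2 * dot (icomb Y z) (icomb Y z)
              < dot (Y i) (icomb Y z) ^+ 2)%R]| < 4 ^ j)%N.

(** Solution of W <= W/2 + a sqrt(W Z) + b sqrt(M W): dividing by sqrt W gives W <= 4 (a sqrt Z + b
    sqrt M)^2, and squaring the sum doubles 4 to 8. *)
Definition sparse_const : R :=
  8 * ((48 * tau / (1 - theta)) ^+ 2 * Zlev e
       + (320 * 8 ^+ e * 2 ^+ 10 + 384 + 120 * 4 ^+ j0) ^+ 2 * M).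

Lemma sparse_bound (S : {set 'I_N}) (x : 'cV[R]_n) : S \subset C ->
  (3 * #|S| < 4 ^ J0.+1)%N ->
  \sum_(i in S) dot (Y i) x ^+ 2 <= sparse_const * dot x x.
Proof.
pose A := [set t : R | exists (S : {set 'I_N}) (z : 'I_N -> R),
  [/\ S \subset C, (3 * #|S| < 4 ^ J0.+1)%N, \sum_(i in S) z i ^+ 2 <= 1 &
      t = dot (lcomb Y S z) (lcomb Y S z)]].
(* A crude bound, only to make the supremum finite before the self-bounding inequality is solved. *)
have Aub : ubound A (N%:R * M).
  move=> _ [S' [z [SC _ z1 ->]]].
  have nn : \sum_(i in S') dot (Y i) (Y i) <= N%:R * M.
    apply: (@le_trans _ _ (\sum_(i in S') M)).
      by apply: ler_sum => i iS; apply: HM; exact: (fintype.subsetP SC).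
    rewrite sumr_const -[leLHS]mulr_natl ler_wpM2r ?(ltW M0)// ler_nat.
    by rewrite (leq_trans (max_card _))// card_ord.
  apply: le_trans _ nn; rewrite {1}/dot.
  apply: (@le_trans _ _ (\sum_k (\sum_(i in S') z i ^+ 2) * (\sum_(i in S') Y i k 0 ^+ 2))).
    apply: ler_sum => k _; rewrite -expr2 summxE.
    apply: le_trans (sum_CS [in S'] z (fun i => Y i k 0)).
    rewrite le_eqVlt; apply/orP; left; apply/eqP; congr (_ ^+ 2).
    by apply: eq_bigr => i _; rewrite mxE.
  rewrite -mulr_sumr exchange_big/=.
  have -> : \sum_(i in S') \sum_k Y i k 0 ^+ 2 = \sum_(i in S') dot (Y i) (Y i).
    by apply: eq_bigr => i _; apply: eq_bigr => k _; rewrite expr2.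
  by apply: ler_piMl => //; apply: sumr_ge0 => i _; exact: dot_ge0.
have A0 : A 0.
  exists finset.set0, (fun=> 0); split; rewrite ?finset.sub0set ?big_set0 ?cards0//.
    by rewrite muln0 expn_gt0.
  by rewrite /lcomb big_set0 dot0l.
have Asup : has_sup A by split; [exists 0|exists (N%:R * M)].
pose a := 48 * tau / (1 - theta).
have [b bE] : exists b : R, b = 320 * 8 ^+ e * 2 ^+ 10 + 384 + 120 * 4 ^+ j0 by eexists.
have om0 : 0 < sparse_const.
  have b1 : 0 < b.
    rewrite bE.
    have p1 : 0 <= 8 ^+ e * 2 ^+ 10 :> R by apply: mulr_ge0; exact: exprn_ge0.
    have p2 : 0 <= 4 ^+ j0 :> R by exact: exprn_ge0.
    by rewrite -mulrA; move: (8 ^+ e * 2 ^+ 10 : R) (4 ^+ j0 : R) p1 p2 => p q p1 p2; lra.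
  have Z0 : 0 <= Zlev e :> R.
    by rewrite /Zlev addr_ge0// mulr_ge0 ?addr_ge0 ?mulr_ge0 ?exprn_ge0.
  rewrite /sparse_const -bE.
  apply: mulr_gt0 => //; apply: ltr_wpDl.
    by apply: mulr_ge0 => //; exact: sqr_ge0.
  by apply: mulr_gt0 => //; exact: exprn_gt0.
(* The maximum makes W positive. If [sup A] were larger than [sparse_const], then W would be
   [sup A], and [keyA] would contradict this. *)
pose W := Num.max (sup A) sparse_const.
have W0 : 0 < W by rewrite lt_max om0 orbT.
have HWA (S' : {set 'I_N}) : S' \subset C -> (3 * #|S'| < 4 ^ J0.+1)%N ->
    forall z, dot (lcomb Y S' z) (lcomb Y S' z) <= W * \sum_(i in S') z i ^+ 2.
  move=> SC cS z; set s := \sum_(i in S') z i ^+ 2.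
  have s0 : 0 <= s by apply: sumr_ge0 => i _; exact: sqr_ge0.
  have [s00|sn0] := eqVneq s 0.
    rewrite s00 mulr0 /lcomb big1 ?dot0l// => i iS.
    have /psumr_eq0P h : s = 0 by [].
    by have /eqP := h (fun i _ => sqr_ge0 _) i iS; rewrite sqrf_eq0 => /eqP->; rewrite scale0r.
  have sp : 0 < s by rewrite lt_neqAle eq_sym sn0.
  rewrite -ler_pdivrMr//; apply: (@le_trans _ _ (sup A)); last by rewrite le_max lexx.
  apply: ub_le_sup; first by exists (N%:R * M).
  have rs : Num.sqrt s ^+ 2 = s by rewrite sqr_sqrtr.
  have rs0 : Num.sqrt s != 0 by rewrite gt_eqF// sqrtr_gt0.
  exists S', (fun i => z i / Num.sqrt s); split => //.
    have -> : \sum_(i in S') (z i / Num.sqrt s) ^+ 2 = s / s.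
      by rewrite mulr_suml; apply: eq_bigr => i _; rewrite exprMn exprVn rs.
    by rewrite mulfV.
  have -> : lcomb Y S' (fun i => z i / Num.sqrt s) = (Num.sqrt s)^-1 *: lcomb Y S' z.
    by rewrite scaler_sumr; apply: eq_bigr => i _; rewrite scalerA mulrC.
  by rewrite dotZl dotZr mulrA -expr2 exprVn rs mulrC.
have keyA t : A t -> t <= W / 2 + a * Num.sqrt (W * Zlev e) + b * Num.sqrt (M * W).
  move=> [S' [z [SC cS z1 ->]]].
  have [lev [beta [h1 h2 h3 h4 h5]]] := levels_exist cS z1.
  rewrite /a bE; apply: (block_bound W0 M0 _ (HWA S' SC cS) h1 h2 h3 h4 h5 e4 ej0 tau0 theta0 theta1).
    by move=> i iS; apply: HM; exact: (fintype.subsetP SC).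
  move=> j jj0 jJ0 w w0 w1 w2.
  have w0' i : i \notin C -> w i = 0.
    by move=> iC; apply: w0; apply: contra iC => /(fintype.subsetP SC).
  apply: leq_ltn_trans (E2 jj0 jJ0 w0' _ w2); rewrite ?leq_mul2l/=.
    by apply: subset_leq_card; apply/fintype.subsetP => i; rewrite !inE => /andP[/(fintype.subsetP SC)->].
  apply: leq_trans w1; apply: subset_leq_card; apply/fintype.subsetP => i; rewrite !inE.
  move=> /andP[_ wi]; rewrite wi andbT.
  by apply: contraNT wi => /w0->.
have supA : sup A <= W / 2 + a * Num.sqrt (W * Zlev e) + b * Num.sqrt (M * W).
  by apply: ge_sup; [exists 0|move=> t; exact: keyA].
have WE : W = sparse_const.
  rewrite /W; have [//|h] := leP (sup A) sparse_const.
  exfalso; have WS : W = sup A by rewrite /W max_l// ltW.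
  have w2 : Num.sqrt W ^+ 2 = W by rewrite sqr_sqrtr// ltW.
  have Z0 : 0 <= Zlev e :> R.
    by rewrite /Zlev addr_ge0// mulr_ge0 ?addr_ge0 ?mulr_ge0 ?exprn_ge0.
  have z2 : Num.sqrt (Zlev e) ^+ 2 = Zlev e :> R by rewrite sqr_sqrtr.
  have m2 : Num.sqrt M ^+ 2 = M by rewrite sqr_sqrtr// ltW.
  have sw : 0 < Num.sqrt W by rewrite sqrtr_gt0.
  move: supA; rewrite -WS sqrtrM ?(ltW W0)// sqrtrM ?(ltW M0)//.
  move: h; rewrite -WS /sparse_const -/a -bE.
  rewrite -[in ltLHS]z2 -[in ltLHS]m2 -w2.
  set w := Num.sqrt W; set zz := Num.sqrt (Zlev e); set m := Num.sqrt M.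
  rewrite -/w in sw; have -> : Num.sqrt (w ^+ 2) = w by rewrite sqrtr_sqr ger0_norm ?ltW.
  rewrite [a * (w * zz)](_ : _ = w * (a * zz)); last by ring.
  rewrite [b * (m * w)](_ : _ = w * (b * m)); last by ring.
  rewrite -!exprMn => h1 h2; move: (a * zz) (b * m) h1 h2 => p q h1 h2.
  have w2' : w <= 2 * (p + q).
    by rewrite -(ler_pM2l sw); move: h2; rewrite expr2; lra.
  have := sqr_ge0 (p - q); have : w ^+ 2 <= (2 * (p + q)) ^+ 2.
    by apply: lerXn2r => //; rewrite nnegrE; [exact: ltW|exact: le_trans (ltW sw) w2'].
  by move: h1; rewrite !expr2; nra.
move=> SC cS; rewrite -WE.
exact: (lcomb_dual W0 (HWA S SC cS) x).
Qed.

End SparseBound.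

(** * Independent rows *)

Section Boxes.
Context {R : realType}.

Definition box m (A : 'I_m -> set R) : set (m.-tuple R) :=
  [set t | forall i, A i (tnth t i)].

Lemma measurable_box m (A : 'I_m -> set R) :
  (forall i, measurable (A i)) -> measurable (box A).
Proof.
move=> mA; have -> : box A = \bigcap_(i in [set: 'I_m]) (@tnth m R ^~ i @^-1` A i).
  by apply/seteqP; split => t h i => [_|]; exact: h.
apply: fin_bigcap_measurable => // i _; rewrite -[X in measurable X]setTI.
exact: measurable_tnth.
Qed.

(** Boxes are stable under intersection and generate the product sigma-algebra. *)
Lemma boxes_unique m (m1 m2 : {measure set (m.-tuple R) -> \bar R}) :
  (m1 setT < +oo)%E ->
  (forall A, (forall i, measurable (A i)) -> m1 (box A) = m2 (box A)) ->
  forall B, measurable B -> m1 B = m2 B.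
Proof.
move=> m1T h B mB.
pose C : set (set (m.-tuple R)) :=
  [set D | exists A, (forall i, measurable (A i)) /\ D = box A].
have boxT : box (fun=> setT) = [set: m.-tuple R] by apply/seteqP; split.
apply: (measure_unique C (fun=> setT)) => //.
- apply/seteqP; split; last first.
    apply: smallest_sub; first exact: sigma_algebra_measurable.
    by move=> _ [A [mA ->]]; exact: measurable_box.
  apply: smallest_sub; first exact: smallest_sigma_algebra.
  rewrite -bigcup_seq/=; apply: bigcup_sub => i _ _ [A mA <-].
  apply: sub_sigma_algebra; exists (fun j => if j == i then A else setT); split.
    by move=> j; case: ifP.
  apply/seteqP; split => t /=.
    by move=> [_ At] j; case: eqP => [->|].
  by move=> /(_ i); rewrite eqxx.
- move=> _ _ [A [mA ->]] [A' [mA' ->]]; exists (fun i => A i `&` A' i); split.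
    by move=> i; exact: measurableI.
  apply/seteqP; split => t; first by move=> [h1 h2] i; split.
  by move=> h1; split => i; have [] := h1 i.
- by move=> _; exists (fun=> setT); split => //; rewrite boxT.
- by rewrite bigcup_const//; exists 0%N.
- by move=> _ [A [mA ->]]; exact: h.
Qed.

End Boxes.

Section IndepPair.
Context {R : realType} {d} {T : measurableType d} (P : probability T R).
Local Open Scope ereal_scope.

Lemma indep_boxes m k (U : T -> m.-tuple R) (V : T -> k.-tuple R) :
  measurable_fun setT U -> measurable_fun setT V ->
  (forall A B, (forall i, measurable (A i)) -> (forall i, measurable (B i)) ->
     P (U @^-1` box A `&` V @^-1` box B) = P (U @^-1` box A) * P (V @^-1` box B)) ->
  forall A B, measurable A -> measurable B ->
     P (U @^-1` A `&` V @^-1` B) = P (U @^-1` A) * P (V @^-1` B).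
Proof.
move=> mU mV h.
have pre l (W : set (l.-tuple R)) (X : T -> l.-tuple R) : measurable_fun setT X -> measurable W ->
    measurable (X @^-1` W).
  by move=> mX mW; rewrite -[_ @^-1` _]setTI; exact: mX.
(* For a fixed event E both sides are finite measures in A that agree on boxes. Applying this once
   to each variable passes from boxes to all measurable sets. *)
have extE l (X : T -> l.-tuple R) (E : set T) : measurable_fun setT X -> measurable E ->
    (forall A, (forall i, measurable (A i)) ->
       P (X @^-1` box A `&` E) = P (X @^-1` box A) * P E) ->
    forall A, measurable A -> P (X @^-1` A `&` E) = P (X @^-1` A) * P E.
  move=> mX mE hX A mA.
  have PE : P E \is a fin_num by exact: fin_num_measure.
  have PE0 : (0 <= fine (P E))%R by apply: fine_ge0.
  pose mXm := isMeasurableFun.Build _ _ _ _ X mX.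
  pose X' : {mfun T >-> l.-tuple R} := HB.pack X mXm.
  pose m1 := distribution P X'.
  pose Q := mrestr P mE.
  have msE D : mscale (NngNum PE0) m1 D = P (X @^-1` D) * P E.
    by rewrite /mscale/= fineK// muleC.
  have H := @boxes_unique R l (pushforward Q X) (mscale (NngNum PE0) m1).
  rewrite -msE; apply: (H mX) => //.
  - change (P (X @^-1` setT `&` E) < +oo); rewrite preimage_setT setTI.
    by rewrite (le_lt_trans (probability_le1 P mE))// ltry.
  - by move=> B mB; apply: etrans (hX B mB) _; rewrite -msE.
move=> A B mA mB.
apply: (@extE) => // [|A' mA']; first exact: pre.
rewrite setIC muleC; apply: (@extE) => //; first by apply: pre => //; exact: measurable_box.
by move=> B' mB'; rewrite setIC muleC h.
Qed.

Lemma integral_indep m k (U : T -> m.-tuple R) (V : T -> k.-tuple R)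
    (f : m.-tuple R -> k.-tuple R -> \bar R) :
  measurable_fun setT U -> measurable_fun setT V ->
  (forall A B, measurable A -> measurable B ->
     P (U @^-1` A `&` V @^-1` B) = P (U @^-1` A) * P (V @^-1` B)) ->
  measurable_fun setT (fun z => f z.1 z.2) -> (forall s t, 0 <= f s t) ->
  \int[P]_w f (U w) (V w) = \int[P]_w \int[P]_v f (U w) (V v).
Proof.
move=> mU mV h mf f0.
pose mUm := isMeasurableFun.Build _ _ _ _ U mU.
pose U' : {mfun T >-> m.-tuple R} := HB.pack U mUm.
pose mVm := isMeasurableFun.Build _ _ _ _ V mV.
pose V' : {mfun T >-> k.-tuple R} := HB.pack V mVm.
have mW : measurable_fun setT (fun w => (U w, V w)) by exact: measurable_fun_pair.
pose mWm := isMeasurableFun.Build _ _ _ _ _ mW.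
pose W' : {mfun T >-> (m.-tuple R * k.-tuple R)%type} := HB.pack (fun w => (U w, V w)) mWm.
have E : forall X, measurable X ->
    (distribution P U' \x distribution P V') X = distribution P W' X.
  apply: product_measure_unique => A B mA mB.
  rewrite /distribution /pushforward/= -h//.
transitivity (\int[distribution P W']_z f z.1 z.2).
  by rewrite ge0_integral_distribution.
transitivity (\int[distribution P U' \x distribution P V']_z f z.1 z.2).
  by apply: eq_measure_integral => A mA _; apply: esym; exact: E.
rewrite fubini_tonelli1// ge0_integral_distribution//.
- apply: eq_integral => w _ /=; rewrite /fubini_F ge0_integral_distribution//=.
  exact: (measurableT_comp mf (pair1_measurable (U w))).
- exact: measurable_fun_fubini_tonelli_F.
- by move=> t; exact: integral_ge0.
Qed.

Lemma measurable_inner_integral m k (V : T -> k.-tuple R)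
    (f : m.-tuple R -> k.-tuple R -> \bar R) :
  measurable_fun setT V ->
  measurable_fun setT (fun z => f z.1 z.2) -> (forall s t, 0 <= f s t) ->
  measurable_fun setT (fun s => \int[P]_v f s (V v)).
Proof.
move=> mV mf f0.
pose mVm := isMeasurableFun.Build _ _ _ _ V mV.
pose V' : {mfun T >-> k.-tuple R} := HB.pack V mVm.
have := @measurable_fun_fubini_tonelli_F _ _ _ _ _ (distribution P V') _ mf (fun z => f0 z.1 z.2).
apply: eq_measurable_fun => s _ /=.
rewrite /fubini_F ge0_integral_distribution//=.
exact: (measurableT_comp mf (pair1_measurable s)).
Qed.

End IndepPair.

(** * Integrating out one row *)

Section Peel.
Context {R : realType} {n N : nat}.

(** Borel measurability in the coordinates, phrased through all measurable families so that no
    sigma-algebra on families of vectors has to be chosen. *)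
Definition mfunc (f : ('I_N -> 'cV[R]_n) -> R) : Prop :=
  forall d' (T' : measurableType d') (Z : T' -> 'I_N -> 'cV[R]_n),
    (forall i k, measurable_fun setT (fun w => Z w i k 0)) ->
    measurable_fun setT (fun w => f (Z w)).

Definition upd (s : 'I_N -> 'cV[R]_n) (i : 'I_N) (v : 'cV[R]_n) : 'I_N -> 'cV[R]_n :=
  fun k => if k == i then v else s k.

Context {d} {T : measurableType d} (P : probability T R).
Variable Xs : 'I_N -> T -> 'cV[R]_n.
Hypothesis mX : forall i, rand_vec (Xs i).
Hypothesis iX : mutually_indep P Xs.

Let X w : 'I_N -> 'cV[R]_n := fun i => Xs i w.

Local Open Scope ereal_scope.

Let F := ('I_N * 'I_n)%type.
(** All coordinates, with row i overwritten by 0 rather than removed, so that the index set does not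
    depend on i. *)
Let U i w : #|{: F}|.-tuple R :=
  [tuple (if (enum_val j).1 == i then 0%R else Xs (enum_val j).1 w (enum_val j).2 0%R) | j < #|{: F}|].
Let V i w : n.-tuple R := [tuple Xs i w l 0%R | l < n].
Let dec (t : #|{: F}|.-tuple R) : 'I_N -> 'cV[R]_n :=
  fun k => \col_l tnth t (enum_rank (k, l)).
Let decv (t : n.-tuple R) : 'cV[R]_n := \col_l tnth t l.

Let updUV i w : upd (dec (U i w)) i (decv (V i w)) = X w.
Proof.
apply/funext => k; rewrite /upd; apply/matrixP => l z; rewrite ord1.
case: eqP => [->|/eqP ki]; rewrite !mxE tnth_mktuple//.
by rewrite enum_rankK/= (negbTE ki).
Qed.

Let mU i : measurable_fun setT (U i).
Proof.
apply/measurable_fun_tnthP => j.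
rewrite (_ : _ \o _ = fun w => if (enum_val j).1 == i then 0%R
    else Xs (enum_val j).1 w (enum_val j).2 0%R); last first.
  by apply/funext => w; rewrite /= tnth_mktuple.
have [_|_] := boolP ((enum_val j).1 == i); [exact: measurable_cst|exact: mX].
Qed.

Let mV i : measurable_fun setT (V i).
Proof.
apply/measurable_fun_tnthP => j.
rewrite (_ : _ \o _ = fun w => Xs i w j 0%R); first exact: mX.
by apply/funext => w; rewrite /= tnth_mktuple.
Qed.

Let indepUV i A B : measurable A -> measurable B ->
  P (U i @^-1` A `&` V i @^-1` B) = P (U i @^-1` A) * P (V i @^-1` B).
Proof.
apply: indep_boxes => // {}A {}B mA mB.
pose Ah k l := A (enum_rank (k, l)).
(* The overwritten coordinates are constantly 0: either the box contains 0 there and does not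
   constrain row i, or the event is empty. *)
have [h0|h0] := pselect (forall l, Ah i l 0%R); last first.
  have -> : U i @^-1` box A = set0.
    apply/seteqP; split => // w /= h; apply: h0 => l.
    by have := h (enum_rank (i, l)); rewrite tnth_mktuple enum_rankK/= eqxx.
  by rewrite set0I measure0 mul0e.
pose E1 k := if k == i then (fun=> setT) else Ah k.
pose E2 k : 'I_n -> set R := if k == i then B else (fun=> setT).
pose E12 k := if k == i then B else Ah k.
have mE1 k l : measurable (E1 k l).
  by rewrite /E1; have [_|_] := boolP (k == i); [exact: measurableT|exact: mA].
have mE2 k l : measurable (E2 k l).
  by rewrite /E2; have [_|_] := boolP (k == i); [exact: mB|exact: measurableT].
have mE12 k l : measurable (E12 k l).
  by rewrite /E12; have [_|_] := boolP (k == i); [exact: mB|exact: mA].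
have UE : U i @^-1` box A = \bigcap_(k in [set: 'I_N]) rect_pre (Xs k) (E1 k).
  apply/seteqP; split => w /=.
    move=> h k _ l; rewrite /E1; case: eqP => // /eqP ki.
    by have := h (enum_rank (k, l)); rewrite tnth_mktuple enum_rankK/= (negbTE ki).
  move=> h j; rewrite tnth_mktuple; have := h (enum_val j).1 I (enum_val j).2.
  rewrite /E1; case: eqP => [ji _|_].
    by have := h0 (enum_val j).2; rewrite /Ah -ji -surjective_pairing enum_valK.
  by rewrite /Ah -surjective_pairing enum_valK.
have VE : V i @^-1` box B = \bigcap_(k in [set: 'I_N]) rect_pre (Xs k) (E2 k).
  apply/seteqP; split => w /=.
    move=> h k _ l; rewrite /E2; case: eqP => // ->.
    by have := h l; rewrite tnth_mktuple.
  by move=> h l; rewrite tnth_mktuple; have := h i I l; rewrite /E2 eqxx.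
have UVE : U i @^-1` box A `&` V i @^-1` box B
    = \bigcap_(k in [set: 'I_N]) rect_pre (Xs k) (E12 k).
  rewrite UE VE; apply/seteqP; split => w /=.
    move=> [h1 h2] k _ l; have := h1 k I l; have := h2 k I l.
    by rewrite /E1 /E2 /E12; case: eqP.
  move=> h; split => k _ l; have := h k I l; rewrite /E1 /E2 /E12; case: eqP => //.
have rT k : P (rect_pre (Xs k) (fun=> setT)) = 1.
  rewrite (_ : rect_pre _ _ = setT) ?probability_setT//.
  by apply/seteqP; split.
rewrite UVE UE VE !iX// (bigD1 i)//= [X in _ = X * _](bigD1 i)//= [X in _ = _ * X](bigD1 i)//=.
rewrite /E1 /E2 /E12 eqxx rT mul1e [X in _ = _ * (_ * X)]big1 ?mule1; last first.
  by move=> k /negbTE ->; rewrite rT.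
rewrite muleC; congr (_ * _).
by apply: eq_bigr => k /negbTE ->.
Qed.

(** Fubini for the independent pair (other rows, row i): [psi] ignores row i, and the integral of
    [phi] over row i is at most c wherever the other rows are frozen. *)
Lemma peel (i : 'I_N) (psi phi : ('I_N -> 'cV[R]_n) -> R) (c : R) :
  mfunc psi -> mfunc phi -> (forall s, 0 <= psi s)%R -> (forall s, 0 <= phi s)%R ->
  (forall s v, psi (upd s i v) = psi s) ->
  (forall s, \int[P]_w (phi (upd s i (Xs i w)))%:E <= c%:E) ->
  \int[P]_w (psi (X w) * phi (X w))%:E <= c%:E * \int[P]_w (psi (X w))%:E.
Proof.
move=> mpsi mphi psi0 phi0 psiu phic.
have mXw : forall k l, measurable_fun setT (fun w => X w k l 0%R) by move=> k l; exact: mX.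
have c0 : 0 <= c%:E.
  by apply: le_trans _ (phic (fun=> 0%R)); apply: integral_ge0 => w _; rewrite lee_fin.
pose f t v := ((psi (dec t)) * phi (upd (dec t) i (decv v)))%:E.
have mdec d' (T' : measurableType d') (g : T' -> #|{: F}|.-tuple R) : measurable_fun setT g ->
   forall k l, measurable_fun setT (fun w => dec (g w) k l 0%R).
  move=> mg k l; rewrite (_ : (fun _ => _) = (@tnth _ R ^~ (enum_rank (k, l))) \o g).
    by move/measurable_fun_tnthP : mg; exact.
  by apply/funext => w; rewrite /dec mxE.
have mdecv d' (T' : measurableType d') (g : T' -> n.-tuple R) : measurable_fun setT g ->
   forall l, measurable_fun setT (fun w => decv (g w) l 0%R).
  move=> mg l; rewrite (_ : (fun _ => _) = (@tnth _ R ^~ l) \o g).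
    by move/measurable_fun_tnthP : mg; exact.
  by apply/funext => w; rewrite /decv mxE.
have mupd : forall k l, measurable_fun setT
    (fun z : #|{: F}|.-tuple R * n.-tuple R => upd (dec z.1) i (decv z.2) k l 0%R).
  move=> k l; rewrite /upd; case: (k == i).
    by apply: mdecv; exact: measurable_snd.
  by apply: mdec; exact: measurable_fst.
have E : \int[P]_w (psi (X w) * phi (X w))%:E = \int[P]_w f (U i w) (V i w).
  apply: eq_integral => w _; rewrite /f updUV; congr (_ * _)%:E.
  by rewrite -[in LHS](updUV i w) psiu.
have mf : measurable_fun setT (fun z => f z.1 z.2).
  apply/measurable_EFinP; apply: measurable_funM.
    by apply: mpsi; apply: mdec; exact: measurable_fst.
  by apply: mphi; exact: mupd.
have f0 s t : 0 <= f s t by rewrite lee_fin mulr_ge0.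
rewrite E (integral_indep (mU i) (mV i) (@indepUV i) mf f0).
have fE w : \int[P]_v f (U i w) (V i v) <= c%:E * (psi (X w))%:E.
  rewrite /f; under eq_integral do rewrite EFinM.
  have mph : measurable_fun setT (fun v => (phi (upd (dec (U i w)) i (decv (V i v))))%:E).
    apply/measurable_EFinP; apply: mphi => k l; rewrite /upd; case: (k == i).
      by apply: mdecv; exact: mV.
    exact: measurable_cst.
  rewrite ge0_integralZl// ?lee_fin//; last by move=> v _; rewrite lee_fin.
  rewrite muleC -[in leRHS](updUV i w) psiu; apply: lee_wpmul2r; rewrite ?lee_fin//.
  apply: le_trans (phic (dec (U i w))).
  apply: ge0_le_integral => //.
  - by move=> v _; rewrite lee_fin.
  - apply/measurable_EFinP; apply: mphi => k l; rewrite /upd; case: (k == i).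
      exact: mX.
    exact: measurable_cst.
  - move=> v _; rewrite lee_fin (_ : decv (V i v) = Xs i v)//.
    by apply/matrixP => l z; rewrite ord1 mxE tnth_mktuple.
rewrite -ge0_integralZl//; last 2 first.
- by apply/measurable_EFinP; apply: mpsi.
- by move=> w _; rewrite lee_fin.
apply: ge0_le_integral => //.
- by move=> w _; apply: integral_ge0 => v _; rewrite lee_fin mulr_ge0.
- exact: (measurableT_comp (measurable_inner_integral P (mV i) mf f0) (mU i)).
- by apply: emeasurable_funM => //; apply/measurable_EFinP; apply: mpsi.
Qed.

End Peel.

Section Meas.
Context {R : realType} {d} {T : measurableType d}.

Lemma measurable_ltR (f g : T -> R) : measurable_fun setT f -> measurable_fun setT g ->
  measurable_fun setT (fun x => (f x < g x)%R%:R : R).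
Proof.
move=> mf mg; rewrite (_ : (fun _ => _) = (fun x => if f x < g x then 1 else 0 : R)).
  apply: measurable_fun_ifT; [exact: measurable_fun_ltr|exact: measurable_cst..].
by apply/funext => x; case: (f x < g x).
Qed.

Lemma measurable_leR (f g : T -> R) : measurable_fun setT f -> measurable_fun setT g ->
  measurable_fun setT (fun x => (f x <= g x)%R%:R : R).
Proof.
move=> mf mg; rewrite (_ : (fun _ => _) = (fun x => if f x <= g x then 1 else 0 : R)).
  apply: measurable_fun_ifT; [exact: measurable_fun_ler|exact: measurable_cst..].
by apply/funext => x; case: (f x <= g x).
Qed.

Lemma measurable_leS (f g : T -> R) : measurable_fun setT f -> measurable_fun setT g ->
  measurable [set w | f w <= g w].
Proof.
move=> mf mg; have := @measurable_fun_ler _ _ _ _ _ _ mf mg measurableT [set true] I.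
rewrite setTI; congr measurable.
Qed.

Variable P : probability T R.

Lemma integral_affine (f : T -> R) (a b c : R) : measurable_fun setT f ->
  (forall w, 0 <= f w) -> 0 <= a -> 0 <= b -> (\int[P]_w (f w)%:E <= c%:E)%E ->
  (\int[P]_w (a + b * f w)%:E <= (a + b * c)%:E)%E.
Proof.
move=> mf f0 a0 b0 fc.
under eq_integral do rewrite EFinD EFinM.
have mfE : measurable_fun setT (EFin \o f) by apply/measurable_EFinP.
rewrite ge0_integralD//; last 2 first.
- by move=> w _; rewrite mule_ge0 ?lee_fin.
- exact: measurable_funeM.
rewrite integral_cst// [X in (a%:E * X)%E](_ : _ = 1%E); last exact: probability_setT.
rewrite mule1 EFinD EFinM.
rewrite ge0_integralZl//; last by move=> w _; rewrite lee_fin.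
by rewrite leeD2l// lee_wpmul2l ?lee_fin.
Qed.

Lemma markov_le (A : set T) (f : T -> R) : measurable A -> measurable_fun setT f ->
  (forall w, 0 <= f w) -> (forall w, A w -> 1 <= f w) ->
  (P A <= \int[P]_w (f w)%:E)%E.
Proof.
move=> mA mf f0 fA; have -> : P A = (\int[P]_w (\1_A w)%:E)%E by rewrite integral_indic// setIT.
apply: ge0_le_integral => //.
- by apply/measurable_EFinP.
- by apply/measurable_EFinP.
- move=> w _; rewrite lee_fin indicE; case: (boolP (w \in A)) => // wA.
  by apply: fA; rewrite -in_setE.
Qed.

Lemma le_integral_pos (f g : T -> R) : measurable_fun setT f -> measurable_fun setT g ->
  (forall w, 0 <= f w) -> (forall w, f w <= g w) ->
  (\int[P]_w (f w)%:E <= \int[P]_w (g w)%:E)%E.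
Proof.
move=> mf mg f0 fg; apply: ge0_le_integral => //.
- by move=> w _; rewrite lee_fin.
- by apply/measurable_EFinP.
- by apply/measurable_EFinP.
- by move=> w _; rewrite lee_fin.
Qed.

End Meas.

(** * Chernoff bounds for counts of rows *)

Section Sample.
Context {R : realType} {n N : nat} {d} {T : measurableType d} (P : probability T R).
Variable Z : T -> 'I_N -> 'cV[R]_n.

(** The only form in which independence is used from here on. It is a property of the family alone
    and survives whitening. *)
Definition peelable : Prop := forall (i : 'I_N) (psi phi : ('I_N -> 'cV[R]_n) -> R) (c : R),
  mfunc psi -> mfunc phi -> (forall s, 0 <= psi s)%R -> (forall s, 0 <= phi s)%R ->
  (forall s v, psi (upd s i v) = psi s) ->
  (forall s, \int[P]_w (phi (upd s i (Z w i)))%:E <= c%:E)%E ->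
  (\int[P]_w (psi (Z w) * phi (Z w))%:E <= c%:E * \int[P]_w (psi (Z w))%:E)%E.

Hypothesis mZ : forall i k, measurable_fun setT (fun w => Z w i k 0).
Hypothesis pZ : peelable.

Lemma updE (s : 'I_N -> 'cV[R]_n) i (v : 'cV[R]_n) : upd s i v i = v.
Proof. by rewrite /upd eqxx. Qed.

Lemma updN (s : 'I_N -> 'cV[R]_n) i k (v : 'cV[R]_n) : k != i -> upd s i v k = s k.
Proof. by rewrite /upd => /negbTE ->. Qed.

Lemma mfuncM (f g : ('I_N -> 'cV[R]_n) -> R) : mfunc f -> mfunc g -> mfunc (fun s => f s * g s).
Proof. by move=> mf mg d' T' Y mY; apply: measurable_funM; [exact: mf|exact: mg]. Qed.

Lemma mfunc_cst c : mfunc (fun _ : 'I_N -> 'cV[R]_n => c).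
Proof. by move=> d' T' Y mY; exact: measurable_cst. Qed.

Lemma mfunc_prod (r : seq 'I_N) (phi : 'I_N -> ('I_N -> 'cV[R]_n) -> R) :
  (forall i, i \in r -> mfunc (phi i)) -> mfunc (fun s => \prod_(i <- r) phi i s).
Proof.
by move=> mphi d' T' Y mY; apply: measurable_prod => i ir; exact: mphi.
Qed.

(** The rows of [r] are peeled one by one. A factor may also depend on rows outside [r]; this is
    what allows tests against a combination of other rows. *)
Lemma prod_bound (r : seq 'I_N) (psi : ('I_N -> 'cV[R]_n) -> R)
    (phi : 'I_N -> ('I_N -> 'cV[R]_n) -> R) (c : 'I_N -> R) :
  uniq r -> mfunc psi -> (forall i, i \in r -> mfunc (phi i)) ->
  (forall s, 0 <= psi s) -> (forall i s, 0 <= phi i s) -> (forall i, 0 <= c i) ->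
  (forall i s v, i \in r -> psi (upd s i v) = psi s) ->
  (forall i k s v, i \in r -> k \in r -> i != k -> phi i (upd s k v) = phi i s) ->
  (forall i s, i \in r -> \int[P]_w (phi i (upd s i (Z w i)))%:E <= (c i)%:E)%E ->
  (\int[P]_w (psi (Z w) * \prod_(i <- r) phi i (Z w))%:E
     <= (\prod_(i <- r) c i)%:E * \int[P]_w (psi (Z w))%:E)%E.
Proof.
move=> + mpsi + psi0 phi0 c0 + + +; elim: r => [|i r IH] /=.
  move=> _ _ _ _ _; rewrite big_nil mul1e.
  by under eq_integral do rewrite big_nil mulr1.
move=> /andP[ir ur] mphi psiu phiu phic.
have mphir k : k \in r -> mfunc (phi k) by move=> kr; apply: mphi; rewrite inE kr orbT.
under eq_integral do rewrite big_cons mulrCA mulrC.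
rewrite big_cons EFinM -muleA.
have h := @pZ i (fun s => psi s * \prod_(k <- r) phi k s) (phi i) (c i).
apply: le_trans (h _ _ _ _ _ _) _.
- by apply: mfuncM => //; exact: mfunc_prod.
- by apply: mphi; rewrite mem_head.
- by move=> s; rewrite mulr_ge0// prodr_ge0.
- by move=> s; exact: phi0.
- move=> s v; rewrite psiu ?mem_head//; congr (_ * _).
  apply: eq_big_seq => k kr; apply: phiu; rewrite ?mem_head ?inE ?kr ?orbT//.
  by apply: contraNneq ir => <-.
- by move=> s; apply: phic; rewrite mem_head.
apply: lee_wpmul2l; first by rewrite lee_fin.
apply: IH => //.
- by move=> k s v kr; apply: psiu; rewrite inE kr orbT.
- by move=> k l s v kr lr; apply: phiu; rewrite inE ?kr ?lr orbT.
- by move=> k s kr; apply: phic; rewrite inE kr orbT.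
Qed.

Lemma mfunc_count (D : {set 'I_N}) (ev : 'I_N -> ('I_N -> 'cV[R]_n) -> bool) (L : nat) :
  (forall i, mfunc (fun s => (ev i s)%:R)) ->
  mfunc (fun s => (L <= #|[set i in ~: D | ev i s]|)%N%:R).
Proof.
move=> mev.
move=> d' T' Y mY.
have cE w : (L <= #|[set i in ~: D | ev i (Y w)]|)%N%:R
    = (L%:R <= \sum_(i <- enum (~: D)) ((ev i (Y w))%:R : R))%R%:R :> R.
  rewrite -natr_sum ler_nat; congr (nat_of_bool (L <= _)%N)%:R.
  rewrite big_enum -big_mkcondr/= sum1_card; apply: eq_card => i.
  by rewrite [LHS]inE unfold_in.
apply: (eq_measurable_fun (fun w => (L%:R <= \sum_(i <- enum (~: D)) ((ev i (Y w))%:R : R))%R%:R : R)).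
  by move=> w _; rewrite cE.
apply: measurable_leR; first exact: measurable_cst.
by apply: measurable_sum => i; exact: mev.
Qed.

(** Binomial tail (e b N / L)^L. The rows in [D] only act as a frozen environment with weight [psi];
    the events of the other rows may depend on them. *)
Lemma count_tail (D : {set 'I_N}) (psi : ('I_N -> 'cV[R]_n) -> R)
    (ev : 'I_N -> ('I_N -> 'cV[R]_n) -> bool) (b : R) (L : nat) :
  mfunc psi -> (forall s, 0 <= psi s) ->
  (forall i, mfunc (fun s => (ev i s)%:R)) ->
  (forall i s v, i \notin D -> psi (upd s i v) = psi s) ->
  (forall i k s v, i \notin D -> k \notin D -> i != k -> ev i (upd s k v) = ev i s) ->
  (forall i s, i \notin D -> \int[P]_w ((ev i (upd s i (Z w i)))%:R)%:E <= b%:E)%E ->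
  0 < b -> (0 < L)%N -> (0 < N)%N -> b * N%:R <= L%:R ->
  (\int[P]_w (psi (Z w) * (L <= #|[set i in ~: D | ev i (Z w)]|)%N%:R)%:E
    <= ((expR 1 * b * N%:R / L%:R) ^+ L)%:E * \int[P]_w (psi (Z w))%:E)%E.
Proof.
move=> mpsi psi0 mev psiu evu evb b0 L0 N0 bNL.
have NR : 0 < N%:R :> R by rewrite ltr0n.
have LR : 0 < L%:R :> R by rewrite ltr0n.
have bN : 0 < b * N%:R by rewrite mulr_gt0.
(* Minimiser of v^(-L) exp(v b N), the bound obtained by Markov applied to v^count. *)
pose v := L%:R / (b * N%:R).
have v1 : 1 <= v by rewrite /v ler_pdivlMr// mul1r.
pose phi i s : R := 1 + (v - 1) * (ev i s)%:R.
have phiE i s : phi i s = if ev i s then v else 1.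
  by rewrite /phi; case: ifP => _; rewrite ?mulr1 ?mulr0 ?addr0// addrC subrK.
have mphi i : mfunc (phi i).
  move=> d' T' Y mY; apply: measurable_funD; first exact: measurable_cst.
  by apply: measurable_funM; [exact: measurable_cst|exact: mev].
have phi0 i s : 0 <= phi i s by rewrite phiE; case: ifP => _ //; exact: le_trans v1.
have c1 : 0 <= 1 + (v - 1) * b by rewrite addr_ge0// mulr_ge0 ?subr_ge0// ltW.
have key s : psi s * (L <= #|[set i in ~: D | ev i s]|)%N%:R
    <= v ^- L * (psi s * \prod_(i <- enum (~: D)) phi i s).
  rewrite mulrCA ler_wpM2l//.
  have prE : \prod_(i <- enum (~: D)) phi i s = v ^+ #|[set i in ~: D | ev i s]|.
    rewrite big_enum/= (eq_bigr (fun i => if ev i s then v else 1)) => [|i _]; last exact: phiE.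
    rewrite -big_mkcondr/= prodr_const; congr (_ ^+ _).
    by apply: eq_card => i; rewrite [RHS]inE unfold_in.
  rewrite prE; have v0 : 0 < v by exact: lt_le_trans v1.
  case: leqP => h /=; last by rewrite mulr_ge0 ?invr_ge0 ?exprn_ge0// ltW.
  by rewrite mulrC ler_pdivlMr ?exprn_gt0// mul1r ler_weXn2l.
have mind : mfunc (fun s => (L <= #|[set i in ~: D | ev i s]|)%N%:R) by exact: mfunc_count.
apply: (@le_trans _ _ (\int[P]_w (v ^- L * (psi (Z w) * \prod_(i <- enum (~: D)) phi i (Z w)))%:E)%E).
  apply: le_integral_pos => //.
  - by apply: measurable_funM; [exact: mpsi|exact: mind].
  - apply: measurable_funM; first exact: measurable_cst.
    apply: measurable_funM; first exact: mpsi.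
    by apply: measurable_prod => i _; exact: mphi.
  - by move=> w; rewrite mulr_ge0.
under eq_integral do rewrite EFinM.
have v0 : 0 < v by exact: lt_le_trans v1.
have vL : 0 <= v ^- L by rewrite invr_ge0 exprn_ge0// ltW.
rewrite ge0_integralZl//; last 2 first.
- apply/measurable_EFinP; apply: measurable_funM; first exact: mpsi.
  by apply: measurable_prod => i _; exact: mphi.
- by move=> w _; rewrite lee_fin mulr_ge0// prodr_ge0.
have := @prod_bound (enum (~: D)) psi phi (fun=> 1 + (v - 1) * b) (enum_uniq _) mpsi
  (fun i _ => mphi i) psi0 phi0 (fun=> c1) _ _ _.
move=> /(_ _ _ _)/(lee_wpmul2l (_ : (0 <= (v ^- L)%:E)%E)) h.
apply: le_trans (h _ _ _ _) _; rewrite ?lee_fin//.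
- by move=> i s w; rewrite mem_enum inE => /psiu.
- move=> i k s w; rewrite !mem_enum !inE => iD kD ik.
  by rewrite /phi (evu i k).
- move=> i s; rewrite mem_enum inE => iD; apply: integral_affine; rewrite ?subr_ge0//.
    apply: (mev i) => k l; rewrite /upd; have [_|_] := boolP (k == i); first exact: mZ.
    exact: measurable_cst.
  exact: evb.
rewrite muleA; apply: lee_wpmul2r.
  by apply: integral_ge0 => w _; rewrite lee_fin.
rewrite -EFinM lee_fin big_const_seq count_predT iter_mulr mulr1 -cardE.
have cN : (1 + (v - 1) * b) ^+ #|~: D| <= expR L%:R.
  apply: (@le_trans _ _ (expR (v * b) ^+ N)).
    apply: (@le_trans _ _ (expR (v * b) ^+ #|~: D|)).
      apply: lerXn2r; rewrite ?nnegrE ?expR_ge0//.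
      apply: le_trans (expR_ge1Dx _); rewrite lerD2l ler_wpM2r ?(ltW b0)//.
      by rewrite lerBlDr lerDl.
    rewrite ler_weXn2l//; first by rewrite -expR0 ler_expR mulr_ge0 ?(ltW b0) ?(ltW v0).
    by rewrite (leq_trans (max_card _))// card_ord.
  rewrite -expRM_natl ler_expR /v le_eqVlt; apply/orP; left; apply/eqP; field.
  by rewrite !gt_eqF.
apply: le_trans (ler_wpM2l vL cN) _.
have -> : expR L%:R = expR 1 ^+ L :> R by rewrite -expRM_natl mulr1.
rewrite /v le_eqVlt; apply/orP; left; apply/eqP.
by rewrite -exprVn -exprMn; congr (_ ^+ _); rewrite invf_div; ring.
Qed.

End Sample.

Section Union.
Context {R : realType} {d} {T : measurableType d} (P : probability T R).
Local Open Scope ereal_scope.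

Lemma union_bound (I : Type) (r : seq I) (Q : pred I) (F : I -> set T) (c : I -> R) :
  (forall i, measurable (F i)) -> (forall i, Q i -> P (F i) <= (c i)%:E) ->
  measurable (\big[setU/set0]_(i <- r | Q i) F i) /\
  P (\big[setU/set0]_(i <- r | Q i) F i) <= (\sum_(i <- r | Q i) c i)%:E.
Proof.
move=> mF Fc; elim: r => [|i r [mr IH]].
  by rewrite !big_nil; split => //; rewrite measure0.
rewrite !big_cons; case: ifP => // Qi; split; first exact: measurableU.
by apply: le_trans (measureU2 _ _ _) _ => //; rewrite EFinD; apply: leeD => //; exact: Fc.
Qed.

End Union.

(** * Weighted counting of integer vectors *)

Section IntVectors.
Context {R : realType}.
Variables N m : nat.

(** The integers of absolute value at most m as a finite type; zero is kept apart as [None], and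
    [Some (s, k)] is k + 1 with sign s. *)
Definition coef := option (bool * 'I_m).
Definition ival (a : coef) : int :=
  if a is Some (s, k) then (if s then - (k.+1)%:Z else (k.+1)%:Z) else 0.

Lemma ival_surj (z : int) : (`|z| <= m)%N -> exists a : coef, ival a = z.
Proof.
case: z => [[|k]|k]; rewrite ?absz_nat => h.
- by exists None.
- by exists (Some (false, Ordinal h)).
- by exists (Some (true, Ordinal (h : k < m)%N)); rewrite /= NegzE.
Qed.

Lemma ival_eq0 a : (ival a == 0) = (a == None).
Proof. by case: a => [[[] k]|] //=; rewrite eq_sym. Qed.

Definition ivec (f : {ffun 'I_N -> coef}) (i : 'I_N) : int := ival (f i).

Lemma ivec_surj (z : 'I_N -> int) : (forall i, `|z i| <= m)%N ->
  exists f, ivec f =1 z.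
Proof.
move=> h; have /choice[g gP] : forall i, exists a : coef, ival a = z i.
  by move=> i; exact: ival_surj.
by exists (finfun g) => i; rewrite /ivec ffunE.
Qed.

Definition isupp (f : {ffun 'I_N -> coef}) : {set 'I_N} := [set i in 'I_N | ivec f i != 0].
Definition il1 (f : {ffun 'I_N -> coef}) : nat := (\sum_i `|ivec f i|)%N.

(** Rankin's trick: inserting u^(|supp| - s0) v^(l1 - l0) >= 1 removes both constraints, and the
    remaining sum factorises over coordinates into (1 + 2 q u / (1 - v))^N at most. *)
Lemma ivec_weight (q u v : R) (s0 l0 : nat) :
  0 <= q -> 0 < u -> u <= 1 -> 0 < v -> v < 1 ->
  \sum_(f : {ffun 'I_N -> coef} | (#|isupp f| <= s0)%N && (il1 f <= l0)%N) q ^+ #|isupp f|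
   <= u ^- s0 * v ^- l0 * expR (2 * q * u / (1 - v) * N%:R).
Proof.
move=> q0 u0 u1 v0 v1.
pose w (a : coef) : R := if a is Some _ then q * u * v ^+ `|ival a| else 1.
have w0 a : 0 <= w a by rewrite /w; case: a => // a; rewrite !mulr_ge0 ?exprn_ge0// ltW.
have wf (f : {ffun 'I_N -> coef}) :
    \prod_i w (f i) = q ^+ #|isupp f| * u ^+ #|isupp f| * v ^+ il1 f.
  rewrite /il1 -prodrXr -!prodr_const.
  rewrite [\prod_(i in isupp f) q]big_mkcond [\prod_(i in isupp f) u]big_mkcond -!big_split/=.
  apply: eq_bigr => i _; rewrite inE /ivec ival_eq0 /w andTb.
  by case: (f i) => [a|]//=; rewrite ?mulr1 ?expr0.
have step : \sum_(f : {ffun 'I_N -> coef} | (#|isupp f| <= s0)%N && (il1 f <= l0)%N) q ^+ #|isupp f|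
   <= u ^- s0 * v ^- l0 * \sum_(f : {ffun 'I_N -> coef}) \prod_i w (f i).
  rewrite mulr_sumr big_mkcond/=; apply: ler_sum => f _; case: ifP => [/andP[fs fl]|_]; last first.
    by rewrite mulr_ge0 ?prodr_ge0// mulr_ge0 ?invr_ge0 ?exprn_ge0// ltW.
  rewrite wf (_ : _ * (_ * _) = q ^+ #|isupp f| *
     ((u ^- s0 * u ^+ #|isupp f|) * (v ^- l0 * v ^+ il1 f))); last by ring.
  rewrite ler_peMr ?exprn_ge0//; apply: mulr_ege1.
    by rewrite mulrC ler_pdivlMr ?exprn_gt0// mul1r ler_wiXn2l// ltW.
  by rewrite mulrC ler_pdivlMr ?exprn_gt0// mul1r ler_wiXn2l// ltW.
apply: le_trans step _; rewrite ler_wpM2l//.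
  by rewrite mulr_ge0 ?invr_ge0 ?exprn_ge0// ltW.
rewrite -(bigA_distr_bigA (fun (i : 'I_N) a => w a))/= prodr_const card_ord.
have ws : \sum_a w a <= 1 + 2 * q * u / (1 - v).
  rewrite (bigD1 None)//= lerD2l (reindex_omap Some id)/=; last by case.
  rewrite (eq_bigl xpredT) => [|a]; last by rewrite eqxx.
  rewrite [leLHS](_ : _ = \sum_(s : bool) \sum_(k < m) q * u * v ^+ `|ival (Some (s, k))|);
    last by rewrite pair_bigA/=; apply: eq_bigr => -[[] k].
  have vsum : \sum_(k < m) v ^+ k.+1 <= (1 - v)^-1.
    have h : (\sum_(k < m) v ^+ k) * (1 - v) <= 1.
      rewrite mulrC -opprB mulNr -subrX1 opprB lerBlDr lerDl exprn_ge0//; exact: ltW.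
    apply: (@le_trans _ _ (\sum_(k < m) v ^+ k)); last by rewrite -div1r ler_pdivlMr ?subr_gt0.
    by apply: ler_sum => k _; rewrite exprS ler_piMl ?exprn_ge0// ltW.
  rewrite big_bool/= -!mulr_sumr.
  rewrite (_ : 2 * q * u / (1 - v) = q * u * (1 - v)^-1 + q * u * (1 - v)^-1); last by ring.
  have qu0 : 0 <= q * u by rewrite mulr_ge0// ltW.
  by apply: lerD; rewrite ler_wpM2l//; under eq_bigr do rewrite ?abszN absz_nat.
rewrite expRM_natr; apply: lerXn2r; rewrite ?nnegrE ?expR_ge0//.
  by apply: sumr_ge0.
by apply: le_trans ws _; exact: expR_ge1Dx.
Qed.

End IntVectors.

(** * Union bound over integer combinations *)

Section LevelEvent.
Context {R : realType} {n N : nat} {d} {T : measurableType d} (P : probability T R).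
Variable Z : T -> 'I_N -> 'cV[R]_n.
Hypothesis mZ : forall i k, measurable_fun setT (fun w => Z w i k 0).
Hypothesis pZ : peelable P Z.
Variables (p B : R).
Hypothesis p0 : 0 < p.
Hypothesis B0 : 0 < B.
Hypothesis momZ : forall i a,
  (\int[P]_w (`|dot (Z w i) a| `^ p)%:E <= (B * dot a a `^ (p / 2))%:E)%E.

Lemma measurable_dot d' (T' : measurableType d') (x y : T' -> 'cV[R]_n) :
  (forall k, measurable_fun setT (fun w => x w k 0)) ->
  (forall k, measurable_fun setT (fun w => y w k 0)) ->
  measurable_fun setT (fun w => dot (x w) (y w)).
Proof.
by move=> mx my; apply: measurable_sum => k; apply: measurable_funM.
Qed.

Lemma measurable_icomb d' (T' : measurableType d') (Y : T' -> 'I_N -> 'cV[R]_n) (z : 'I_N -> int) :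
  (forall i k, measurable_fun setT (fun w => Y w i k 0)) ->
  forall k, measurable_fun setT (fun w => icomb (Y w) z k 0).
Proof.
move=> mY k; apply: (eq_measurable_fun (fun w => \sum_i (z i)%:~R * Y w i k 0)).
  by move=> w _; rewrite /icomb summxE; apply: eq_bigr => i _; rewrite mxE.
by apply: measurable_sum => i; apply: measurable_funM => //; exact: measurable_cst.
Qed.

Lemma sqr_powR (x r : R) : (x ^+ 2) `^ (r / 2) = `|x| `^ r.
Proof.
rewrite -(@real_normK _ x) ?num_real// -powR_mulrn// -powRrM.
by congr (_ `^ _); field.
Qed.

Lemma tail_moment i (t : R) (x : 'cV[R]_n) : 0 < t ->
  (\int[P]_w ((t ^+ 2 * dot x x < dot (Z w i) x ^+ 2)%R%:R)%:E <= (B / t `^ p)%:E)%E.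
Proof.
move=> t0; have [x0|xn0] := eqVneq (dot x x) 0.
  rewrite integral0_eq ?lee_fin ?divr_ge0 ?powR_ge0 ?(ltW B0)// => w _.
  rewrite x0 mulr0 (_ : dot (Z w i) x ^+ 2 = 0) ?ltxx//.
  apply/eqP; rewrite eq_le sqr_ge0 andbT; apply: le_trans (dot_CS _ _) _.
  by rewrite x0 mulr0.
have D0 : 0 < dot x x by rewrite lt_neqAle eq_sym xn0 dot_ge0.
set D := dot x x in D0 xn0 *.
have mdot : measurable_fun setT (fun w => dot (Z w i) x).
  by apply: measurable_dot => k; [exact: mZ|exact: measurable_cst].
have tp0 : 0 < t `^ p * D `^ (p / 2) by rewrite mulr_gt0// powR_gt0.
have mpow : measurable_fun setT (fun w => `|dot (Z w i) x| `^ p).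
  by apply: (measurableT_comp (measurable_powR p)); exact: measurableT_comp.
apply: (@le_trans _ _ (\int[P]_w ((t `^ p * D `^ (p / 2))^-1 * `|dot (Z w i) x| `^ p)%:E)%E).
  apply: le_integral_pos => //.
  - apply: measurable_ltR; first exact: measurable_cst.
    exact: measurable_funX.
  - by apply: measurable_funM => //; exact: measurable_cst.
  - move=> w; case: ltP => h /=; last by rewrite mulr_ge0 ?invr_ge0 ?powR_ge0// ltW.
    rewrite mulrC ler_pdivlMr// mul1r -sqr_powR.
    rewrite (_ : t `^ p * _ = (t ^+ 2 * D) `^ (p / 2)); last first.
      by rewrite powRM ?sqr_ge0 ?ltW// sqr_powR ger0_norm// ltW.
    apply: ge0_ler_powR; rewrite ?nnegrE ?sqr_ge0//; last exact: ltW.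
      by rewrite divr_ge0// ltW.
    by rewrite mulr_ge0 ?sqr_ge0// ltW.
under eq_integral do rewrite EFinM.
rewrite ge0_integralZl//; last 2 first.
- by apply/measurable_EFinP.
- by rewrite lee_fin invr_ge0 ltW.
apply: le_trans (lee_wpmul2l _ (momZ i x)) _; first by rewrite lee_fin invr_ge0 ltW.
rewrite -EFinM lee_fin le_eqVlt; apply/orP; left; apply/eqP; rewrite -/D.
by field; rewrite !gt_eqF// powR_gt0.
Qed.

Variables (cls : 'cV[R]_n -> bool) (q : R).
Hypothesis q0 : 0 <= q.
Hypothesis mcls : forall i, mfunc (fun s : 'I_N -> 'cV[R]_n => (cls (s i))%:R : R).
Hypothesis clsq : forall i, (\int[P]_w ((cls (Z w i))%:R)%:E <= q%:E)%E.

(** For a fixed integer vector, all rows of its support lie in the class with probability at most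
    q^|supp|; the rows outside are independent of the combination, so L large correlations have
    conditional probability at most [rho]. The weight q^|supp| is what makes the union bound cheap
    for a rare class. *)
Lemma level_event (s0 l0 L : nat) (t u v : R) : (0 < N)%N ->
  (0 < L)%N -> 0 < t -> B / t `^ p * N%:R <= L%:R ->
  0 < u -> u <= 1 -> 0 < v -> v < 1 ->
  exists E : set T, [/\ measurable E,
    (P (~` E) <= (u ^- s0 * v ^- l0 * expR (2 * q * u / (1 - v) * N%:R)
                  * (expR 1 * (B / t `^ p) * N%:R / L%:R) ^+ L)%:E)%E &
    forall w, E w -> forall z : 'I_N -> int,
      let C := [set i in 'I_N | cls (Z w i)] in
      (forall i, i \notin C -> z i = 0) -> (#|[set i in C | z i != 0]| <= s0)%N ->
      \sum_i `|(z i)%:~R : R| <= l0%:R ->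
      (#|[set i in C | (z i == 0) && (t ^+ 2 * dot (icomb (Z w) z) (icomb (Z w) z)
              < dot (Z w i) (icomb (Z w) z) ^+ 2)%R]| < L)%N].
Proof.
move=> N0 L0 t0 bNL u0 u1 v0 v1.
set b := B / t `^ p in bNL *; set rho := (expR 1 * b * N%:R / L%:R) ^+ L.
have b0 : 0 < b by rewrite divr_gt0// powR_gt0.
have rho0 : 0 <= rho.
  apply: exprn_ge0; apply: divr_ge0 => //; apply: mulr_ge0 => //.
  by apply: mulr_ge0; [exact: expR_ge0|exact: ltW].
pose ev (f : {ffun 'I_N -> coef l0}) (i : 'I_N) (s : 'I_N -> 'cV[R]_n) :=
  (t ^+ 2 * dot (icomb s (ivec f)) (icomb s (ivec f)) < dot (s i) (icomb s (ivec f)) ^+ 2)%R.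
pose psi (f : {ffun 'I_N -> coef l0}) (s : 'I_N -> 'cV[R]_n) : R := \prod_(i <- enum (isupp f)) (cls (s i))%:R.
have mev f i : mfunc (fun s => (ev f i s)%:R).
  move=> d' T' Y mY; apply: measurable_ltR.
    apply: measurable_funM; first exact: measurable_cst.
    by apply: measurable_dot => k; exact: measurable_icomb.
  apply: measurable_funX; apply: measurable_dot => k; [exact: mY|exact: measurable_icomb].
have mpsi f : mfunc (psi f) by apply: mfunc_prod => i _; exact: mcls.
have psi0 f s : 0 <= psi f s by apply: prodr_ge0.
have icombu (f : {ffun 'I_N -> coef l0}) i (s : 'I_N -> 'cV[R]_n) v' : i \notin isupp f -> icomb (upd s i v') (ivec f) = icomb s (ivec f).
  move=> iD; apply: eq_bigr => k _; have [->|ki] := eqVneq k i; last by rewrite updN.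
  by move: iD; rewrite inE/= negbK => /eqP->; rewrite !scale0r.
pose bad f := [set w | psi f (Z w) * (L <= #|[set i in ~: isupp f | ev f i (Z w)]|)%N%:R >= 1].
have mtot f : mfunc (fun s => psi f s * (L <= #|[set i in ~: isupp f | ev f i s]|)%N%:R).
  by apply: mfuncM => //; exact: mfunc_count.
have mbad f : measurable (bad f).
  apply: measurable_leS; first exact: measurable_cst.
  exact: mtot.
have PB f : (P (bad f) <= (q ^+ #|isupp f| * rho)%:E)%E.
  apply: le_trans (markov_le P (f := fun w => psi f (Z w) *
     (L <= #|[set i in ~: isupp f | ev f i (Z w)]|)%N%:R) _ _ _ _) _.
  - exact: mbad.
  - exact: mtot.
  - by move=> w; rewrite mulr_ge0.
  - by move=> w.
  have := @count_tail R n N d T P Z mZ pZ (isupp f) (psi f) (ev f) b L (mpsi f) (psi0 f)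
    (mev f) _ _ _ b0 L0 N0 bNL.
  move=> /(_ _ _ _)/le_trans h; apply: h.
  - move=> i s v' iD; apply: eq_big_seq => k; rewrite mem_enum => kD.
    by rewrite updN//; apply: contraNneq iD => <-.
  - move=> i k s v' iD kD ik; rewrite /ev icombu// updN//.
  - move=> i s iD; apply: le_trans (tail_moment i (icomb s (ivec f)) t0).
    apply: le_integral_pos => //.
    + apply: (mev f i) => k l; rewrite /upd; have [_|_] := boolP (k == i); first exact: mZ.
      exact: measurable_cst.
    + apply: measurable_ltR; first exact: measurable_cst.
      apply: measurable_funX; apply: measurable_dot => k; [exact: mZ|exact: measurable_cst].
    + by move=> w; rewrite /ev icombu// updE.
  rewrite [q ^+ _ * _]mulrC EFinM; apply: lee_wpmul2l.
    by rewrite lee_fin.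
  have h := @prod_bound R n N d T P Z pZ (enum (isupp f)) (fun=> 1)
    (fun i s => (cls (s i))%:R) (fun=> q) (enum_uniq _) _ _ _ _ _ _ _ _.
  rewrite /psi; under eq_integral do rewrite -[X in X%:E]mul1r.
  apply: le_trans (h _ _ _ _ _ _ _ _) _ => //.
  - by move=> i k s v' _ _ ik; rewrite updN.
  - by move=> i s _; under eq_integral do rewrite updE; exact: clsq.
  rewrite integral_cst// [X in (_ * (_ * X))%E](_ : _ = 1%E); last exact: probability_setT.
  by rewrite !mule1 big_const_seq count_predT iter_mulr mulr1 -cardE.
pose Q (f : {ffun 'I_N -> coef l0}) := (#|isupp f| <= s0)%N && (il1 f <= l0)%N.
have [mU PU] := @union_bound R d T P _ (index_enum _) Q bad _ mbad (fun f _ => PB f).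
exists (~` \big[setU/set0]_(f | Q f) bad f); split.
- exact: measurableC.
- rewrite setCK; apply: le_trans PU _; rewrite lee_fin -mulr_suml.
  rewrite ler_wpM2r//.
  exact: ivec_weight.
move=> w Ew z C zC zs zl; rewrite ltnNge; apply/negP => Lc; apply: Ew.
have zi i : (`|z i| <= l0)%N.
  rewrite -(ler_nat R); apply: le_trans zl; rewrite (bigD1 i)//= natr_absz intr_norm.
  by rewrite ler_wpDr// sumr_ge0.
have [f fz] := ivec_surj zi.
have zf : z = ivec f by apply/funext => i; rewrite fz.
have sf : isupp f = [set i in C | z i != 0].
  apply/setP => i; rewrite !inE/= fz; case: (boolP (z i == 0)) => [|zi0]; first by rewrite andbF.
  rewrite andbT; apply/esym; have : i \in C by apply: contraNT zi0 => /zC->.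
  by rewrite inE.
rewrite -bigcup_seq_cond/=.
exists f.
  rewrite /= mem_index_enum /Q sf zs/= -(ler_nat R) (le_trans _ zl)// /il1 natr_sum.
  by apply: ler_sum => i _; rewrite fz natr_absz intr_norm.
rewrite /bad/= /psi big1_seq; last first.
  by move=> i /andP[_]; rewrite mem_enum sf inE => /andP[+ _]; rewrite inE => /andP[_ ->].
rewrite mul1r (leq_trans Lc)//; apply: subset_leq_card; apply/fintype.subsetP => i.
by rewrite !inE/= /ev -zf => /and3P[_ zi0 ->]; rewrite ?fz zi0.
Qed.

End LevelEvent.

(** * Exceedance probabilities and union bound at each level *)

Section Rate.
Context {R : realType}.

Lemma expR1_ge2 : 2 <= expR 1 :> R.
Proof. by apply: le_trans (expR_ge1Dx _); rewrite -[2]/(1 + 1). Qed.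

Lemma natX_le_expR (k : nat) : (2 ^+ k : R) <= expR k%:R.
Proof.
rewrite -[k%:R]mulr1 expRM_natl; apply: lerXn2r; rewrite ?nnegrE ?expR_ge0//.
exact: expR1_ge2.
Qed.

Lemma expR1_le4 : expR 1 <= 4 :> R.
Proof.
have h : 2^-1 <= expR (- 2^-1) :> R by apply: le_trans (expR_ge1Dx _); lra.
have -> : expR 1 = (expR (- 2^-1) ^+ 2)^-1 :> R.
  by rewrite -expRM_natr -expRN; congr expR; field.
rewrite -[4]invrK lef_pV2 ?posrE ?invr_gt0 ?exprn_gt0 ?expR_gt0//.
rewrite (_ : 4^-1 = 2^-1 ^+ 2 :> R); last by field.
by apply: lerXn2r; rewrite ?nnegrE ?expR_ge0.
Qed.

(** Its square is expR 20 times n [trunc0]. *)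
Definition tau0 (p B n N : R) : R := Num.sqrt (expR 38 * (B `^ (2 / p) * n * (N / n) `^ (2 / p))).
(** For p >= p0 the loss theta0^(-p) per level is at most expR ((p - 2) / 4), half of the gain expR
    ((p - 2) / 2) that the growth of n / 4^j provides. *)
Definition theta0 (p0 : R) : R := expR (- ((p0 - 2) / (4 * p0))).

(** With i = J0 - j and r = n / 4^j the left side is 4 expR 1 expR (- 19 p) theta^(- p i) r^(1 -
    p/2), and 4^J0 <= 3 n gives r >= expR (i - 2). The constant 38 leaves 1 - 18 p < - 34 in the
    exponent. *)
Lemma level_rate (p0 p B : R) (n N J0 j : nat) (t := tlev J0 (tau0 p B n%:R N%:R) (theta0 p0) j) :
  2 < p0 -> p0 <= p -> 0 < B -> (0 < n)%N -> (0 < N)%N -> (0 < j)%N -> (j <= J0)%N ->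
  (4 ^ J0 <= 3 * n)%N ->
  0 < t /\ expR 1 * (B / t `^ p) * N%:R / (4 ^ (j - 1))%:R
            <= expR (- 34 - (p0 - 2) / 4 * (J0 - j)%:R).
Proof.
move=> p02 p0p B0 n0 N0 j1 jJ Jn.
have nR : 0 < n%:R :> R by rewrite ltr0n.
have NR : 0 < N%:R :> R by rewrite ltr0n.
have p00 : 0 < p0 by exact: lt_trans p02.
have pp : 0 < p by exact: lt_le_trans p0p.
set i := (J0 - j)%N; set m := N%:R / n%:R : R.
have m0 : 0 < m by rewrite divr_gt0.
set kap := (p0 - 2) / (4 * p0).
have K0 : 0 < B `^ (2 / p) by rewrite powR_gt0.
have s0 : 0 < expR 38 * (B `^ (2 / p) * n%:R * m `^ (2 / p)).
  by rewrite !mulr_gt0 ?expR_gt0 ?powR_gt0.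
have t0 : 0 < t.
  rewrite /t /tlev divr_gt0 ?exprn_gt0// mulr_gt0 ?exprn_gt0 ?expR_gt0//.
  by rewrite /tau0 sqrtr_gt0.
split=> //.
pose r : R := n%:R / (4 ^ j)%:R.
have fj : 0 < (4 ^ j)%:R :> R by rewrite ltr0n expn_gt0.
have r0 : 0 < r by rewrite divr_gt0.
have t2 : t ^+ 2 = expR (38 - 2 * kap * i%:R) * (B `^ (2 / p) * m `^ (2 / p) * r).
  have h1 : (theta0 p0 ^+ i) ^+ 2 = expR (- (2 * kap * i%:R)).
    by rewrite /theta0 -/kap -exprM -expRM_natr natrM; congr expR; ring.
  have h2 : ((2 ^+ j : R)^-1) ^+ 2 = ((4 ^ j)%:R)^-1.
    by rewrite exprVn exprAC natrX; congr ((_ ^+ _)^-1); rewrite -natrX.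
  rewrite /t /tlev 2!exprMn h2 -/i h1 /tau0 sqr_sqrtr ?(ltW s0)// -/m /r.
  rewrite (_ : expR (38 - 2 * kap * i%:R) = expR 38 * expR (- (2 * kap * i%:R))).
    by move: (expR 38 : R) => E; field; rewrite gt_eqF.
  by rewrite -expRD.
have tp : t `^ p = expR ((38 - 2 * kap * i%:R) * (p / 2)) * (B * m * r `^ (p / 2)).
  rewrite -[in LHS](ger0_norm (ltW t0)) -sqr_powR t2 powRM ?expR_ge0//; last first.
    by rewrite !mulr_ge0 ?powR_ge0// ltW.
  rewrite -expRM powRM ?mulr_ge0 ?powR_ge0 ?(ltW r0)// powRM ?powR_ge0//.
  rewrite -!powRrM (_ : 2 / p * (p / 2) = 1); last by field; rewrite gt_eqF.
  by rewrite !powRr1// ltW.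
have rlo : expR (i%:R - 2) <= r.
  rewrite /r ler_pdivlMr// (expRD i%:R).
  have e4 : expR i%:R <= (4 ^ i)%:R :> R.
    rewrite -[i%:R]mulr1 expRM_natl natrX; apply: lerXn2r; rewrite ?nnegrE ?expR_ge0//.
    exact: expR1_le4.
  have e2 : expR (- 2) <= 3^-1 :> R.
    rewrite expRN lef_pV2 ?posrE ?expR_gt0//.
    by apply: le_trans (natX_le_expR 2); rewrite -natrX ler_nat.
  apply: (@le_trans _ _ ((4 ^ i)%:R * 3^-1 * (4 ^ j)%:R)).
    by rewrite ler_wpM2r ?(ltW fj)//; apply: ler_pM; rewrite ?expR_ge0.
  rewrite mulrAC -natrM -expnD /i subnK// ler_pdivrMr// -natrM ler_nat.
  by rewrite mulnC.
have -> : expR 1 * (B / t `^ p) * N%:R / (4 ^ (j - 1))%:R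
    = 4 * expR 1 * expR (- ((38 - 2 * kap * i%:R) * (p / 2))) * (r / r `^ (p / 2)).
  have -> : (4 ^ (j - 1))%:R = (4 ^ j)%:R / 4 :> R.
    by rewrite -[in RHS](subnK j1) expnD natrM mulfK.
  rewrite tp expRN /r /m; field.
  by rewrite !gt_eqF ?powR_gt0 ?expR_gt0.
have -> : r / r `^ (p / 2) = r `^ (1 - p / 2).
  by rewrite powRD ?powRr1 ?powRN ?(ltW r0)//; apply/implyP => _; rewrite gt_eqF.
have rp : r `^ (1 - p / 2) <= expR ((i%:R - 2) * (1 - p / 2)).
  rewrite expRM -opprB !powRN lef_pV2 ?posrE ?powR_gt0 ?expR_gt0//.
  apply: ge0_ler_powR; rewrite ?nnegrE ?expR_ge0 ?(ltW r0)//.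
  by rewrite subr_ge0 ler_pdivlMr// mul1r (le_trans (ltW p02)).
have four : 4 <= expR 2 :> R.
  by apply: le_trans (natX_le_expR 2); rewrite -natrX.
apply: (@le_trans _ _ (expR 2 * expR 1 * expR (- ((38 - 2 * kap * i%:R) * (p / 2)))
     * expR ((i%:R - 2) * (1 - p / 2)))).
  apply: ler_pM => //; rewrite ?mulr_ge0 ?expR_ge0 ?powR_ge0//.
  by rewrite ler_wpM2r ?expR_ge0// ler_wpM2r ?expR_ge0.
rewrite -!expRD ler_expR.
have kp : kap * p <= (p - 2) / 4.
  rewrite /kap mulrAC ler_pdivrMr ?mulr_gt0// [leRHS](_ : _ = (p - 2) * p0); last by field.
  by move: p0p; lra.
have i0 : 0 <= i%:R :> R by [].
have kpi := ler_wpM2r i0 kp.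
have ppi := ler_wpM2r i0 p0p.
lra.
Qed.

End Rate.

Section LevelProb.
Context {R : realType}.

(** Exponents in units of k = 4^(j-e): the support costs 9 (3 + Lam + 3 (i + e)), the l1 norm 64 and
    the generating function 1, against 4^(e-1) (34 + c i) from the tails. Hence 92 = 27 + 64 + 1,
    while 54 = 2 * 27 lets half of c i pay for 27 i. *)
Lemma level_prob (q Lam c rho : R) (n N J0 j e j0 : nat)
   (i := (J0 - j)%N) (u := (8 * expR Lam * 8 ^+ (i + e))^-1 : R)
   (v := 1 - (2 ^+ (i + e))^-1 : R) (k := (4 ^ (j - e))%N) :
  0 <= q -> 0 <= Lam -> 0 < c -> 0 <= rho -> q * N%:R <= n%:R * expR Lam ->
  rho <= expR (- 34 - c * i%:R) ->
  (4 <= e)%N -> (e <= j0)%N -> (j0 <= j)%N -> (j <= J0)%N -> (3 * n < 4 ^ J0.+1)%N ->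
  92 + 27 * e%:R + 9 * Lam <= 4 ^+ (e - 1) -> 54 <= 4 ^+ (e - 1) * c ->
  4 <= 4 ^+ (j0 - 1) * c ->
  u ^- (9 * k) * v ^- (32 * 2 ^ (j - e + J0)) * expR (2 * q * u / (1 - v) * N%:R)
    * rho ^+ (4 ^ (j - 1)) <= expR (- (2 * (J0 + j + 4)%:R)).
Proof.
move=> q0 L0 c0 rho0 qN rhoe e4 ej0 j0j jJ nJ r1 r2 r3.
have ej : (e <= j)%N := leq_trans ej0 j0j.
have j1 : (0 < j)%N by apply: leq_trans ej; apply: leq_trans e4.
have p2 m : 0 < (2 : R) ^+ m by rewrite exprn_gt0.
have p8 m : 0 < (8 : R) ^+ m by rewrite exprn_gt0.
have e8 m : (8 : R) ^+ m <= expR (3 * m%:R).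
  rewrite -natrM; apply: le_trans (natX_le_expR _).
  by rewrite exprM (_ : 2 ^+ 3 = 8 :> R) // -natrX.
have kR : 0 <= k%:R :> R by [].
have b1 : u ^- (9 * k) <= expR (9 * k%:R * (3 + Lam + 3 * (i + e)%:R)).
  rewrite -exprVn /u invrK -[9 * k%:R]natrM expRM_natl.
  apply: lerXn2r; rewrite ?nnegrE ?expR_ge0//.
  have e0 := expR_gt0 Lam.
  have e3 : 8 <= expR 3 :> R.
    by apply: le_trans (natX_le_expR 3); rewrite -natrX ler_nat.
  rewrite (expRD (3 + Lam)) (expRD 3); apply: ler_pM (e8 _).
  - by apply: mulr_ge0 => //; exact: ltW.
  - exact: ltW.
  - by rewrite (ler_pM2r e0).
set x := (2 ^+ (i + e))^-1 in v *.
have x0 : 0 < x by rewrite invr_gt0.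
have x2 : x <= 2^-1.
  rewrite lef_pV2 ?posrE// -[leLHS]expr1 ler_weXn2l ?ler1n//.
  by rewrite (leq_trans _ (leq_addl _ _))// (leq_trans _ e4).
have v0 : 0 < v by rewrite /v; lra.
(* The l1 bound is thus 32 k 2^(i+e), and 1 - v = 2^-(i+e) is the matching scale. *)
have jei : (j - e + J0 = 2 * (j - e) + (i + e))%N.
  by rewrite /i; move: ej jJ; clear; lia.
have b2 : v ^- (32 * 2 ^ (j - e + J0)) <= expR (64 * k%:R).
  rewrite -exprVn.
  have vx : v^-1 <= expR (2 * x).
    rewrite -[expR _]invrK lef_pV2 ?posrE ?invr_gt0 ?expR_gt0// -expRN.
    have h := expR_ge1Dx (2 * x).
    rewrite expRN -[leLHS]mul1r ler_pdivrMr ?expR_gt0//.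
    apply: (@le_trans _ _ (v * (1 + 2 * x))); last by rewrite ler_wpM2l// ltW.
    have h2 : 0 <= x * (1 - 2 * x) by rewrite mulr_ge0 ?(ltW x0)//; lra.
    by rewrite /v; lra.
  apply: (@le_trans _ _ (expR (2 * x) ^+ (32 * 2 ^ (j - e + J0)))).
    by apply: lerXn2r; rewrite ?nnegrE ?expR_ge0 ?invr_ge0 ?(ltW v0).
  rewrite -expRM_natl ler_expR jei expnD natrM.
  rewrite le_eqVlt; apply/orP; left; apply/eqP.
  have kE : k%:R = 2 ^+ (2 * (j - e)) :> R.
    by rewrite /k natrX exprM; congr (_ ^+ _); ring.
  have x2E : x * 2 ^+ (i + e) = 1 by rewrite mulVf// gt_eqF.
  rewrite kE natrM (natrX _ 2 (2 * (j - e))) (natrX _ 2 (i + e)).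
  move: x2E; move: (2 ^+ (i + e)) (2 ^+ (2 * (j - e))) => a b ab.
  transitivity (64 * b * (x * a)); first by ring.
  by rewrite ab mulr1.
have b3 : expR (2 * q * u / (1 - v) * N%:R) <= expR k%:R.
  rewrite ler_expR (_ : 1 - v = x); last by rewrite /v; ring.
  have uE : u = (8 * expR Lam * 8 ^+ (i + e))^-1 by [].
  have e0 := expR_gt0 Lam.
  rewrite (_ : 2 * q * u / x * N%:R = (q * N%:R) * (2 * u / x)); last by ring.
  have ux : 0 <= 2 * u / x.
    by rewrite uE divr_ge0 ?(ltW x0)// mulr_ge0// invr_ge0 !mulr_ge0 ?(ltW e0) ?(ltW (p8 _)).
  apply: le_trans (ler_wpM2r ux qN) _.
  have -> : n%:R * expR Lam * (2 * u / x) = n%:R / (4 * 4 ^+ (i + e)).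
    rewrite uE /x (_ : 8 ^+ (i + e) = 2 ^+ (i + e) * 4 ^+ (i + e)); last first.
      by rewrite -exprMn; congr (_ ^+ _); ring.
    have := p2 (i + e)%N; have : 0 < 4 ^+ (i + e) :> R by rewrite exprn_gt0.
    move: (2 ^+ (i + e)) (4 ^+ (i + e)) (expR Lam) e0 => a b c' c'0 b0 a0.
    by field; rewrite !gt_eqF.
  rewrite ler_pdivrMr ?mulr_gt0 ?exprn_gt0//.
  rewrite -exprS /k -natrX -natrM ler_nat -expnD.
  have -> : (j - e + (i + e).+1 = J0.+1)%N by rewrite /i; move: ej jJ; clear; lia.
  by move: nJ; clear; lia.
have b4 : rho ^+ (4 ^ (j - 1)) <= expR ((4 ^ (j - 1))%:R * (- 34 - c * i%:R)).
  by rewrite expRM_natl; apply: lerXn2r; rewrite ?nnegrE ?expR_ge0.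
have u0 : 0 < u by rewrite invr_gt0 !mulr_gt0 ?expR_gt0.
apply: (@le_trans _ _ (expR (9 * k%:R * (3 + Lam + 3 * (i + e)%:R)) * expR (64 * k%:R)
   * expR k%:R * expR ((4 ^ (j - 1))%:R * (- 34 - c * i%:R)))).
  apply: ler_pM => //.
  - by rewrite !mulr_ge0 ?expR_ge0 ?invr_ge0 ?exprn_ge0// ltW.
  - exact: exprn_ge0.
  - apply: ler_pM => //; rewrite ?expR_ge0// ?mulr_ge0 ?invr_ge0 ?exprn_ge0 ?(ltW u0) ?(ltW v0)//.
    by apply: ler_pM => //; rewrite invr_ge0 exprn_ge0// ltW.
rewrite -!expRD ler_expR.
have Lk : (4 ^ (j - 1))%:R = k%:R * 4 ^+ (e - 1) :> R.
  rewrite /k -natrX -natrM -expnD; congr (4 ^ _)%:R.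
  by move: ej e4; clear; lia.
rewrite Lk; set F := 4 ^+ (e - 1) in r1 r2 Lk *.
have G1 : j%:R <= k%:R * F.
  rewrite -Lk ler_nat -[X in (X <= _)%N](subnK j1) addn1.
  exact: ltn_expl.
have G3 : 4 <= k%:R * F * c.
  apply: le_trans r3 _; rewrite -Lk ler_wpM2r ?(ltW c0)//.
  by rewrite -natrX ler_nat leq_exp2l// leq_sub2r.
have JE : J0%:R = j%:R + i%:R :> R by rewrite -natrD /i subnKC.
have i0 : 0 <= i%:R :> R by [].
have j1R : 1 <= j%:R :> R by rewrite ler1n.
have h1 := ler_wpM2l kR r1.
have h2 := ler_wpM2l (mulr_ge0 kR i0) r2.
have h3 := ler_wpM2r i0 G3.
rewrite !natrD JE -/F.
move: h1 h2 h3 G1 j1R i0; move: (k%:R : R) (i%:R : R) (j%:R : R) (e%:R : R) => k' i' j' e'.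
move=> h1 h2 h3 G1 j1R i0.
lra.
Qed.

End LevelProb.

Section ClassEvent.
Context {R : realType} {n N : nat} {d} {T : measurableType d} (P : probability T R).
Variable Z : T -> 'I_N -> 'cV[R]_n.
Hypothesis mZ : forall i k, measurable_fun setT (fun w => Z w i k 0).
Hypothesis pZ : peelable P Z.
Variables (p0 p B : R).
Hypothesis p02 : 2 < p0.
Hypothesis p0p : p0 <= p.
Hypothesis B0 : 0 < B.
Hypothesis momZ : forall i a,
  (\int[P]_w (`|dot (Z w i) a| `^ p)%:E <= (B * dot a a `^ (p / 2))%:E)%E.
Variables (cls : 'cV[R]_n -> bool) (q : R).
Hypothesis q0 : 0 <= q.
Hypothesis mcls : forall i, mfunc (fun s : 'I_N -> 'cV[R]_n => (cls (s i))%:R : R).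
Hypothesis clsq : forall i, (\int[P]_w ((cls (Z w i))%:R)%:E <= q%:E)%E.

Lemma sum_level_prob (m : nat) (J0 := trunc_log 4 (3 * m)) : (0 < m)%N ->
  \sum_(j < J0.+1) expR (- (2 * (J0 + j + 4)%:R)) <= (8 * m%:R)^-1 :> R.
Proof.
move=> m0.
have e2 (k : nat) : expR (- (2 * k%:R)) <= 4 ^- k :> R.
  rewrite expRN lef_pV2 ?posrE ?expR_gt0 ?exprn_gt0//.
  rewrite -natrM; apply: le_trans (natX_le_expR _).
  by rewrite exprM (_ : 2 ^+ 2 = 4 :> R)//; ring.
apply: (@le_trans _ _ (\sum_(j < J0.+1) 4 ^- (J0 + 4) * (2 ^+ 0 / 2 ^+ j))).
  apply: ler_sum => j _; apply: le_trans (e2 _) _.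
  rewrite addnAC exprD invfM ler_wpM2l ?invr_ge0 ?exprn_ge0// expr0 mul1r.
  rewrite lef_pV2 ?posrE ?exprn_gt0//; apply: lerXn2r; rewrite ?nnegrE//.
  by rewrite ler_nat.
rewrite -mulr_sumr.
have h := @sum_inv_pow_le R 0 J0.+1.
have := ler_wpM2l (_ : 0 <= 4 ^- (J0 + 4) :> R) h.
move=> /(_ _)/le_trans; apply; first by rewrite invr_ge0 exprn_ge0.
have J1 : (3 * m < 4 ^ J0.+1)%N by apply: trunc_log_ltn.
have h1 : (3 * m)%:R <= 4 ^+ J0.+1 :> R by rewrite -natrX ler_nat ltnW.
have mR : 0 < m%:R :> R by rewrite ltr0n.
rewrite exprD; rewrite natrM exprS in h1.
have f0 : 0 < 4 ^+ J0 :> R by rewrite exprn_gt0.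
move: (4 ^+ J0) f0 h1 => a a0 h1.
rewrite (_ : (a * 4 ^+ 4)^-1 * 2 = (128 * a)^-1); last by field; rewrite gt_eqF.
by rewrite lef_pV2 ?posrE ?mulr_gt0//; lra.
Qed.

Lemma class_event (Lam : R) (e j0 : nat) (c := (p0 - 2) / 4) :
  (0 < n)%N -> (0 < N)%N -> 0 <= Lam -> q * N%:R <= n%:R * expR Lam ->
  (4 <= e)%N -> (e <= j0)%N ->
  92 + 27 * e%:R + 9 * Lam <= 4 ^+ (e - 1) -> 54 <= 4 ^+ (e - 1) * c ->
  4 <= 4 ^+ (j0 - 1) * c ->
  exists E : set T, [/\ measurable E, (P (~` E) <= ((8 * n%:R)^-1)%:E)%E &
   forall w, E w -> forall (M : R) (S : {set 'I_N}) (x : 'cV[R]_n), 0 < M ->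
     (forall i, cls (Z w i) -> dot (Z w i) (Z w i) <= M) ->
     (forall i, i \in S -> cls (Z w i)) -> (#|S| <= n)%N ->
     \sum_(i in S) dot (Z w i) x ^+ 2
       <= sparse_const M e j0 (tau0 p B n%:R N%:R) (theta0 p0) * dot x x].
Proof.
move=> n0 N0 L0 qN e4 ej0 r1 r2 r3.
have c0 : 0 < c by rewrite divr_gt0// subr_gt0.
have pp : 0 < p by apply: lt_le_trans p0p; exact: lt_trans p02.
set J0 := trunc_log 4 (3 * n).
have J1 : (3 * n < 4 ^ J0.+1)%N by apply: trunc_log_ltn.
have J2 : (4 ^ J0 <= 3 * n)%N by apply: trunc_logP => //; move: n0; clear; lia.
set tau := tau0 p B n%:R N%:R; set theta := theta0 p0.
have th0 : 0 <= theta by exact: expR_ge0.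
have th1 : theta < 1.
  by rewrite expR_lt1 oppr_lt0 divr_gt0 ?subr_gt0 ?mulr_gt0// (lt_trans _ p02).
have ta0 : 0 <= tau by rewrite sqrtr_ge0.
pose prop j (w : T) := forall z : 'I_N -> int,
      let C := [set i in 'I_N | cls (Z w i)] in
      (forall i, i \notin C -> z i = 0) -> (#|[set i in C | z i != 0]| <= 9 * 4 ^ (j - e))%N ->
      \sum_i `|(z i)%:~R : R| <= 32 * 2 ^+ (j - e + J0) ->
      (4 * #|[set i in C | (z i == 0) && (tlev J0 tau theta j ^+ 2 * dot (icomb (Z w) z) (icomb (Z w) z)
              < dot (Z w i) (icomb (Z w) z) ^+ 2)%R]| < 4 ^ j)%N.
have ex (j : nat) : (j0 <= j)%N -> (j <= J0)%N -> exists E : set T, [/\ measurable E,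
    (P (~` E) <= (expR (- (2 * (J0 + j + 4)%:R)))%:E)%E & forall w, E w -> prop j w].
  move=> j0j jJ.
  have j1 : (0 < j)%N by apply: leq_trans j0j; apply: leq_trans ej0; apply: leq_trans e4.
  have [t0 rate] := level_rate p02 p0p B0 n0 N0 j1 jJ J2.
  rewrite -/tau -/theta in t0 rate; set t := tlev J0 tau theta j in t0 rate *.
  have ci0 : 0 <= c * (J0 - j)%:R by rewrite mulr_ge0// ltW.
  have F0 : 0 < (4 ^ (j - 1))%:R :> R by rewrite ltr0n expn_gt0.
  have rho1 : expR 1 * (B / t `^ p) * N%:R / (4 ^ (j - 1))%:R <= 1.
    by apply: le_trans rate _; rewrite expR_le1 -/c; move: ci0; lra.
  have b0 : 0 <= B / t `^ p * N%:R.
    by rewrite mulr_ge0// divr_ge0 ?powR_ge0// ltW.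
  have bNL : B / t `^ p * N%:R <= (4 ^ (j - 1))%:R.
    move: rho1; rewrite ler_pdivrMr// mul1r -mulrA => rho1.
    apply: le_trans rho1; rewrite ler_peMl// (le_trans _ expR1_ge2)//.
    by rewrite ler1n.
  set i := (J0 - j)%N in rate ci0.
  have x0 : 0 < (2 ^+ (i + e))^-1 :> R by rewrite invr_gt0 exprn_gt0.
  have x2 : (2 ^+ (i + e))^-1 <= 2^-1 :> R.
    rewrite lef_pV2 ?posrE ?exprn_gt0// -[leLHS]expr1 ler_weXn2l ?ler1n//.
    by rewrite (leq_trans _ (leq_addl _ _))// (leq_trans _ e4).
  have u0 : 0 < (8 * expR Lam * 8 ^+ (i + e))^-1 :> R.
    by rewrite invr_gt0 !mulr_gt0 ?expR_gt0 ?exprn_gt0.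
  have u1 : (8 * expR Lam * 8 ^+ (i + e))^-1 <= 1 :> R.
    rewrite invf_le1 ?mulr_gt0 ?expR_gt0 ?exprn_gt0//.
    have h1 : 1 <= 8 ^+ (i + e) :> R by apply: exprn_ege1; rewrite ler1n.
    have h2 : 1 <= expR Lam by rewrite -expR0 ler_expR.
    have h3 : 1 <= 8 * expR Lam by lra.
    by have := ler_pM ler01 ler01 h3 h1; rewrite mulr1.
  have v0 : 0 < 1 - (2 ^+ (i + e))^-1 :> R by move: x2; lra.
  have v1 : 1 - (2 ^+ (i + e))^-1 < 1 :> R by move: x0; lra.
  have F0' : (0 < 4 ^ (j - 1))%N by rewrite expn_gt0.
  (* Counting up to 4^(j-1) leaves the factor 4 that [level_bound] asks for. *)
  have [E [mE PE EE]] := @level_event R n N d T P Z mZ pZ p B pp B0 momZ cls q q0 mcls clsq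
    (9 * 4 ^ (j - e)) (32 * 2 ^ (j - e + J0)) (4 ^ (j - 1)) t _ (1 - (2 ^+ (i + e))^-1)
    N0 F0' t0 bNL u0 u1 v0 v1.
  exists E; split => //.
    apply: le_trans PE _; rewrite lee_fin.
    apply: (@level_prob R q Lam c _ n N J0 j e j0) => //.
    by rewrite divr_ge0// -mulrA mulr_ge0 ?expR_ge0.
  move=> w Ew z C zC zs zl; have := EE w Ew z zC zs.
  rewrite natrM !natrX => /(_ zl).
  have -> : (4 ^ j = 4 * 4 ^ (j - 1))%N by rewrite -expnS subn1 prednK.
  by rewrite ltn_pmul2l.
have /choice [E EE] : forall j : 'I_J0.+1, exists E : set T, [/\ measurable E,
    (P (~` E) <= (expR (- (2 * (J0 + j + 4)%:R)))%:E)%E & (j0 <= j)%N -> forall w, E w -> prop j w].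
  move=> j; have [j0j|jj0] := leqP j0 j; last first.
    by exists setT; split => //; rewrite setCT measure0 lee_fin expR_ge0.
  have [E [mE PE EE]] := ex j j0j (ltn_ord j).
  by exists E; split.
have mE j : measurable (~` E j) by apply: measurableC; case: (EE j).
have PE j : (P (~` E j) <= (expR (- (2 * (J0 + j + 4)%:R)))%:E)%E by case: (EE j).
have [mU PU] := @union_bound R d T P _ (index_enum _) xpredT (fun j => ~` E j) _ mE (fun j _ => PE j).
exists (~` \big[setU/set0]_(j < J0.+1) ~` E j); split.
- exact: measurableC.
- by rewrite setCK; apply: le_trans PU _; rewrite lee_fin; exact: sum_level_prob.
move=> w Ew M S x M0 CM SC Sn.
have Ew' j : E j w.
  apply: contrapT => nE; apply: Ew.
  by rewrite -bigcup_seq_cond/=; exists j => //=; rewrite mem_index_enum.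
apply: (@sparse_bound R n N (Z w) [set i in 'I_N | cls (Z w i)] M J0 e j0 tau theta) => //.
- by move=> i; rewrite inE => /andP[_ /CM].
- move=> j j0j jJ z zC zs zl.
  have jJ' : (j < J0.+1)%N by [].
  have [_ _ /(_ j0j w (Ew' _))] := EE (Ordinal jJ').
  exact.
- by apply/fintype.subsetP => i iS; rewrite inE SC.
- by apply: leq_ltn_trans J1; rewrite leq_mul2l Sn.
Qed.

End ClassEvent.

(** * Truncated sums over a net *)

(** Above t one has (x^2)^(p/2 - 1) >= t^(p/2 - 1). *)
Lemma sqr_le_trunc {R : realType} (p t x : R) : 2 < p -> 0 < t ->
  x ^+ 2 <= Num.min (x ^+ 2) t + t `^ (1 - p / 2) * `|x| `^ p.
Proof.
move=> p2 t0; set g := t `^ _.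
have g0 : 0 <= g by exact: powR_ge0.
  case: (leP (x ^+ 2) t) => [h|h].
  by rewrite lerDl mulr_ge0// powR_ge0.
have x0 : 0 < x ^+ 2 by exact: lt_trans h.
rewrite -sqr_powR; apply: le_trans (_ : g * (x ^+ 2) `^ (p / 2) <= _); last by rewrite lerDr ltW.
rewrite (_ : g = (t `^ (p / 2 - 1))^-1); last by rewrite -powRN opprB.
rewrite mulrC ler_pdivlMr ?powR_gt0//.
rewrite [leRHS](_ : _ = x ^+ 2 * (x ^+ 2) `^ (p / 2 - 1)); last first.
  have -> : p / 2 = 1 + (p / 2 - 1) by ring.
  rewrite powRD ?powRr1 ?sqr_ge0//; last by apply/implyP => _; rewrite gt_eqF.
  by congr (_ * _ `^ _); ring.
rewrite ler_wpM2l ?sqr_ge0//; apply: ge0_ler_powR; rewrite ?nnegrE ?sqr_ge0 ?(ltW t0)// ?(ltW h)//.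
by rewrite subr_ge0 ler_pdivlMr// mul1r ltW.
Qed.

(** * Laplace transforms of truncated squares *)

Section Laplace.
Context {R : realType} {d} {T : measurableType d} (P : probability T R).
Variables (u : T -> R) (p B : R).
Hypothesis mu : measurable_fun setT u.
Hypothesis p2 : 2 < p.
Hypothesis B0 : 0 < B.
Hypothesis Eu2 : (\int[P]_w (u w ^+ 2)%:E = 1)%E.
Hypothesis Eup : (\int[P]_w (`|u w| `^ p)%:E <= B%:E)%E.

Lemma expR_le_quad (y : R) : 0 <= y -> y <= 1 -> expR y <= 1 + y + 2 * y ^+ 2.
Proof.
move=> y0 y1; have h : 1 - y / 2 <= expR (- (y / 2)) by exact: expR_ge1Dx.
have h2 : (1 - y / 2) ^+ 2 <= expR (- y).
  have -> : expR (- y) = expR (- (y / 2)) ^+ 2.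
    by rewrite -expRM_natr; congr expR; field.
  by apply: lerXn2r; rewrite ?nnegrE ?expR_ge0//; lra.
rewrite -[expR y]invrK -expRN -[leLHS]mul1r ler_pdivrMr ?expR_gt0//.
apply: (@le_trans _ _ ((1 + y + 2 * y ^+ 2) * (1 - y / 2) ^+ 2)).
  have : 0 <= y ^+ 2 * ((1 - y) * (5 - 2 * y)).
    by rewrite mulr_ge0 ?sqr_ge0// mulr_ge0//; lra.
  lra.
by rewrite ler_wpM2l// addr_ge0 ?addr_ge0// mulr_ge0 ?sqr_ge0.
Qed.

Lemma expRN_le_quad (y : R) : 0 <= y -> expR (- y) <= 1 - y + 2 * y ^+ 2.
Proof.
move=> y0; rewrite expRN -[leLHS]mul1r ler_pdivrMr ?expR_gt0//.
apply: (@le_trans _ _ ((1 - y + 2 * y ^+ 2) * (1 + y))).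
  have : 0 <= y ^+ 2 * (1 + 2 * y) by rewrite mulr_ge0 ?sqr_ge0//; lra.
  lra.
apply: ler_wpM2l; last exact: expR_ge1Dx.
by have := sqr_ge0 (y - 2^-1); have := sqr_ge0 y; lra.
Qed.

Variables (t lam al be : R).
Hypothesis t0 : 0 < t.
Hypothesis lam0 : 0 < lam.
Hypothesis lamt : lam * t <= 1.
Hypothesis al0 : 0 <= al.
Hypothesis be0 : 0 <= be.
Hypothesis ab : forall x : R, Num.min (x ^+ 2) t ^+ 2 <= al + be * `|x| `^ p.

Let f w := Num.min (u w ^+ 2) t.
Let f0 w : 0 <= f w. Proof. by rewrite le_min sqr_ge0 ltW. Qed.
Let fu w : f w <= u w ^+ 2. Proof. by rewrite ge_min lexx. Qed.
Let ft w : f w <= t. Proof. by rewrite ge_min lexx orbT. Qed.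
Let mf : measurable_fun setT f.
Proof. by apply: measurable_minr; [exact: measurable_funX|exact: measurable_cst]. Qed.
Let mup : measurable_fun setT (fun w => `|u w| `^ p).
Proof. by apply: (measurableT_comp (measurable_powR p)); exact: measurableT_comp. Qed.
Let mu2 : measurable_fun setT (fun w => u w ^+ 2).
Proof. exact: measurable_funX. Qed.

Lemma laplace_up :
  (\int[P]_w (expR (lam * f w))%:E <= (expR (lam + 2 * lam ^+ 2 * (al + be * B)))%:E)%E.
Proof.
have l2 : 0 <= 2 * lam ^+ 2 by rewrite mulr_ge0 ?sqr_ge0.
apply: (@le_trans _ _ (\int[P]_w ((1 + 2 * lam ^+ 2 * al + (2 * lam ^+ 2 * be) * `|u w| `^ p)%:E
     + (lam * u w ^+ 2)%:E)))%E.
  under [X in (_ <= X)%E]eq_integral do rewrite -EFinD.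
  apply: le_integral_pos.
  - by apply: measurableT_comp => //; apply: measurable_funM => //; exact: measurable_cst.
  - apply: measurable_funD; last by apply: measurable_funM => //; exact: measurable_cst.
    by apply: measurable_funD; [exact: measurable_cst|apply: measurable_funM => //; exact: measurable_cst].
  - by move=> w; exact: expR_ge0.
  move=> w; apply: le_trans (expR_le_quad _ _) _.
  - by rewrite mulr_ge0// ltW.
  - by apply: le_trans lamt; rewrite ler_wpM2l// ltW.
  have h1 := ler_wpM2l (ltW lam0) (fu w).
  have h2 := ler_wpM2l l2 (ab (u w)); rewrite -/(f w) in h2.
  by rewrite exprMn; lra.
rewrite ge0_integralD//; first last.
- by apply/measurable_EFinP; apply: measurable_funM => //; exact: measurable_cst.
- by move=> w _; rewrite lee_fin mulr_ge0 ?sqr_ge0// ltW.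
- apply/measurable_EFinP; apply: measurable_funD; first exact: measurable_cst.
  by apply: measurable_funM => //; exact: measurable_cst.
- by move=> w _; rewrite lee_fin; apply: addr_ge0 (mulr_ge0 (mulr_ge0 l2 be0) (powR_ge0 _ _)); apply: addr_ge0 (mulr_ge0 l2 al0).
apply: (@le_trans _ _ ((1 + 2 * lam ^+ 2 * al + (2 * lam ^+ 2 * be) * B)%:E + lam%:E)%E).
  apply: leeD.
    apply: integral_affine => //.
    - exact: addr_ge0 ler01 (mulr_ge0 l2 al0).
    - exact: mulr_ge0 l2 be0.
  under eq_integral do rewrite EFinM.
  rewrite ge0_integralZl//.
  - by rewrite Eu2 mule1.
  - exact/measurable_EFinP.
  - by move=> w _; rewrite lee_fin sqr_ge0.
  - by rewrite lee_fin ltW.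
rewrite -EFinD lee_fin; apply: le_trans (expR_ge1Dx _); lra.
Qed.

(** Truncation lowers the mean of u^2 by at most t^(1 - p/2) B, which is the last term of the
    exponent; the upper tail has no such bias. *)
Lemma laplace_low : (\int[P]_w (expR (- (lam * f w)))%:E
   <= (expR (- lam + 2 * lam ^+ 2 * (al + be * B) + lam * (t `^ (1 - p / 2) * B)))%:E)%E.
Proof.
have l2 : 0 <= 2 * lam ^+ 2 by rewrite mulr_ge0 ?sqr_ge0.
set g := t `^ (1 - p / 2).
have g0 : 0 <= g by exact: powR_ge0.
have ufg w : u w ^+ 2 <= f w + g * `|u w| `^ p by exact: sqr_le_trunc.
(* Adding lam u^2 keeps both integrands nonnegative; its integral is lam, to be subtracted at the
   end. *)
have key : (\int[P]_w ((expR (- (lam * f w)))%:E + (lam * u w ^+ 2)%:E)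
    <= (1 + 2 * lam ^+ 2 * al + (2 * lam ^+ 2 * be + lam * g) * B)%:E)%E.
  under eq_integral do rewrite -EFinD.
  have c0 : 0 <= 2 * lam ^+ 2 * be + lam * g by exact: addr_ge0 (mulr_ge0 l2 be0) (mulr_ge0 (ltW lam0) g0).
  apply: le_trans (integral_affine mup _ _ c0 Eup); last 2 first.
  - by move=> w; exact: powR_ge0.
  - exact: addr_ge0 ler01 (mulr_ge0 l2 al0).
  apply: le_integral_pos.
  - apply: measurable_funD; last by apply: measurable_funM => //; exact: measurable_cst.
    apply: measurableT_comp => //; apply: measurableT_comp => //.
    by apply: measurable_funM => //; exact: measurable_cst.
  - by apply: measurable_funD; [exact: measurable_cst|apply: measurable_funM => //; exact: measurable_cst].
  - by move=> w; rewrite addr_ge0 ?expR_ge0// mulr_ge0 ?sqr_ge0// ltW.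
  move=> w; have lf0 : 0 <= lam * f w by rewrite mulr_ge0// ltW.
  have h0 := expRN_le_quad lf0; rewrite exprMn in h0.
  have h1 := ler_wpM2l (ltW lam0) (ufg w).
  have h2 := ler_wpM2l l2 (ab (u w)); rewrite -/(f w) in h2.
  by lra.
move: key; rewrite ge0_integralD//; first last.
- by apply/measurable_EFinP; apply: measurable_funM => //; exact: measurable_cst.
- by move=> w _; rewrite lee_fin mulr_ge0 ?sqr_ge0// ltW.
- apply/measurable_EFinP; apply: measurableT_comp => //; apply: measurableT_comp => //.
  by apply: measurable_funM => //; exact: measurable_cst.
have -> : (\int[P]_w (lam * u w ^+ 2)%:E = lam%:E)%E.
  under eq_integral do rewrite EFinM.
  rewrite ge0_integralZl//.
  - by rewrite Eu2 mule1.
  - exact/measurable_EFinP.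
  - by move=> w _; rewrite lee_fin sqr_ge0.
  - by rewrite lee_fin ltW.
rewrite -leeBrDr// -EFinB => /le_trans; apply; rewrite lee_fin.
apply: le_trans (expR_ge1Dx _); lra.
Qed.

End Laplace.

Section BulkConst.
Context {R : realType}.

(* The factor [expR 18] makes the exceedance probability at most [expR (- 18) * (n / N)],
   which survives the union bound over the [expR (13 * n)] vectors of the net. *)
Definition trunc0 (p B n N : R) : R := expR 18 * (B `^ (2 / p) * (N / n) `^ (2 / p)).
(** Fluctuation scale from fourth moments: N terms of variance about B^(4/p) deviate by B^(2/p)
    sqrt(n N) = n Q at probability expR (- n). For p < 4 the truncation level alone controls the
    variance. *)
Definition flat0 (p B n N : R) : R :=
  if 4 <= p then B `^ (2 / p) * Num.sqrt (N / n) else 0.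

Variables (p B : R) (n N : nat).
Hypothesis p2 : 2 < p.
Hypothesis B1 : 1 <= B.
Hypothesis n0 : (0 < n)%N.
Hypothesis nN : (n <= N)%N.

Notation t := (trunc0 p B n%:R N%:R).
Notation Q := (flat0 p B n%:R N%:R).

Let B0 : 0 < B. Proof. exact: lt_le_trans B1. Qed.
Let p0 : 0 < p. Proof. exact: lt_trans p2. Qed.
Let nR : 0 < n%:R :> R. Proof. by rewrite ltr0n. Qed.
Let NR : 0 < N%:R :> R. Proof. by rewrite ltr0n (leq_trans n0). Qed.
Let m0 : 0 < N%:R / n%:R :> R. Proof. by rewrite divr_gt0. Qed.
Let K0 : 0 < B `^ (2 / p). Proof. by rewrite powR_gt0. Qed.

Lemma trunc0_gt0 : 0 < t.
Proof. by rewrite /trunc0 !mulr_gt0 ?expR_gt0 ?powR_gt0. Qed.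

Lemma flat0_ge0 : 0 <= Q.
Proof. by rewrite /flat0; case: ifP => // _; rewrite mulr_ge0 ?sqrtr_ge0// ltW. Qed.

Lemma trunc0_powR : t `^ (p / 2) = expR (9 * p) * (B * (N%:R / n%:R)).
Proof.
rewrite /trunc0 powRM ?expR_ge0//; last by rewrite mulr_ge0 ?powR_ge0.
rewrite -expRM powRM ?powR_ge0// -!powRrM (_ : 2 / p * (p / 2) = 1); last first.
  by field; rewrite gt_eqF.
rewrite !powRr1 ?(ltW B0) ?(ltW m0)//; congr (expR _ * _).  by field.
Qed.

Lemma trunc0_tail : B / t `^ (p / 2) <= expR (- 18) * (n%:R / N%:R).
Proof.
rewrite trunc0_powR.
have -> : B / (expR (9 * p) * (B * (N%:R / n%:R))) = expR (- (9 * p)) * (n%:R / N%:R).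
  by rewrite expRN; field; rewrite !gt_eqF ?expR_gt0.
by rewrite ler_wpM2r ?ler_expR ?divr_ge0//; move: p2; lra.
Qed.

Lemma trunc0_tail1 : B / t `^ (p / 2) <= n%:R / N%:R.
Proof.
apply: le_trans trunc0_tail _; rewrite ler_piMl ?divr_ge0// expR_le1; lra.
Qed.

Lemma trunc0_bias : t `^ (1 - p / 2) * B <= t * (n%:R / N%:R).
Proof.
rewrite powRD; last by apply/implyP => _; rewrite gt_eqF// trunc0_gt0.
rewrite powRr1 ?(ltW trunc0_gt0)// -mulrA ler_wpM2l ?(ltW trunc0_gt0)//.
by rewrite powRN mulrC; exact: trunc0_tail1.
Qed.

(** Put K = B^(2/p). For p >= 4, y^2 <= K^2 (1 + (y / K)^(p/2)), so the second moment is at most 2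
    K^2 = 2 Q^2 n / N. For p < 4, y^2 <= t^(2 - p/2) y^(p/2) as long as y <= t. *)
Lemma trunc0_var : exists al be : R, [/\ 0 <= al, 0 <= be,
  forall x : R, Num.min (x ^+ 2) t ^+ 2 <= al + be * `|x| `^ p &
  N%:R * ((t + Q)^-1 ^+ 2 * (al + be * B)) <= 2 * n%:R].
Proof.
have t0 := trunc0_gt0; have q0 := flat0_ge0.
have tQ0 : 0 < t + Q by rewrite ltr_wpDr.
have [p4|p4] := leP 4 p.
  exists (B `^ (2 / p) ^+ 2), (B `^ (2 / p) ^+ 2 / B); split.
  - exact: sqr_ge0.
  - by rewrite divr_ge0 ?sqr_ge0// ltW.
  - move=> x; apply: (@le_trans _ _ ((x ^+ 2) ^+ 2)).
      by apply: lerXn2r; rewrite ?nnegrE ?sqr_ge0// ?ge_min ?lexx// le_min sqr_ge0 ltW.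
    rewrite -sqr_powR; set y := x ^+ 2; have y0 : 0 <= y by exact: sqr_ge0.
    have [yK|yK] := leP y (B `^ (2 / p)).
      apply: (@le_trans _ _ (B `^ (2 / p) ^+ 2)).
        by apply: lerXn2r; rewrite ?nnegrE// ltW.
      by rewrite lerDl mulr_ge0 ?powR_ge0// divr_ge0 ?sqr_ge0// ltW.
    have y1 : 1 <= y / B `^ (2 / p) by rewrite ler_pdivlMr// mul1r ltW.
    apply: le_trans (_ : B `^ (2 / p) ^+ 2 * (y / B `^ (2 / p)) `^ (p / 2) <= _).
      apply: (@le_trans _ _ (B `^ (2 / p) ^+ 2 * (y / B `^ (2 / p)) `^ 2)).
        by rewrite powR_mulrn ?(le_trans _ y1)// expr_div_n mulrC divfK// gt_eqF// exprn_gt0.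
      rewrite ler_wpM2l ?sqr_ge0//; apply: ler_powR => //.
      by rewrite ler_pdivlMr//; move: p4; lra.
    have KV : (B `^ (2 / p))^-1 `^ (p / 2) = B^-1.
      rewrite -powRN -powRrM (_ : - (2 / p) * (p / 2) = - 1); last by field; rewrite gt_eqF.
      by rewrite powRN powRr1// ltW.
    rewrite powRM ?invr_ge0 ?powR_ge0// KV.
    by rewrite [leLHS](_ : _ = B `^ (2 / p) ^+ 2 / B * y `^ (p / 2)) ?lerDr ?sqr_ge0//; ring.
  rewrite divfK ?gt_eqF//.
  have QE : Q = B `^ (2 / p) * Num.sqrt (N%:R / n%:R) by rewrite /flat0 p4.
  have Q0 : 0 < Q by rewrite QE mulr_gt0 ?sqrtr_gt0.
  have : (t + Q)^-1 ^+ 2 <= Q^-1 ^+ 2.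
    apply: lerXn2r; rewrite ?nnegrE ?invr_ge0 ?(ltW tQ0) ?(ltW Q0)//.
    by rewrite lef_pV2 ?posrE// lerDr ltW.
  have -> : Q^-1 ^+ 2 = (B `^ (2 / p) ^+ 2)^-1 * (n%:R / N%:R).
    by rewrite exprVn QE exprMn sqr_sqrtr ?(ltW m0)// invfM invf_div.
  set S := B `^ (2 / p) ^+ 2; have S0 : 0 < S by rewrite exprn_gt0.
  move=> h; apply: (@le_trans _ _ (N%:R * ((S^-1 * (n%:R / N%:R)) * (S + S)))).
    by rewrite ler_wpM2l// ler_wpM2r// addr_ge0// ltW.
  rewrite le_eqVlt; apply/orP; left; apply/eqP.
  by field; rewrite !gt_eqF.
exists 0, (t `^ (2 - p / 2)); split => //.
- exact: powR_ge0.
- move=> x; rewrite add0r -sqr_powR; set y := Num.min _ _.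
  have y0 : 0 <= y by rewrite le_min sqr_ge0 ltW.
  have yx : y <= x ^+ 2 by rewrite ge_min lexx.
  have yt : y <= t by rewrite ge_min lexx orbT.
  rewrite (_ : y ^+ 2 = y `^ (2 - p / 2) * y `^ (p / 2)); last first.
    rewrite -powRD ?subrK ?powR_mulrn//.
    by apply/implyP => /eqP; move: p2; lra.
  apply: ler_pM; rewrite ?powR_ge0//; apply: ge0_ler_powR; rewrite ?nnegrE ?sqr_ge0// ?(ltW t0)//.
    by move: p4; lra.
  by rewrite divr_ge0// ltW.
- have QE : Q = 0 by rewrite /flat0 leNgt p4.
  rewrite QE addr0 add0r powRD; last by apply/implyP => _; rewrite gt_eqF.
  rewrite powR_mulrn ?(ltW t0)// powRN.
  rewrite (_ : N%:R * _ = N%:R * (B / t `^ (p / 2))); last first.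
    by field; rewrite !gt_eqF ?powR_gt0.
  apply: (@le_trans _ _ (N%:R * (n%:R / N%:R))); first by rewrite ler_wpM2l// trunc0_tail1.
  by rewrite mulrC divfK ?gt_eqF//; move: nR; lra.
Qed.

End BulkConst.

Section Bulk.
Context {R : realType} {n N : nat} {d} {T : measurableType d} (P : probability T R).
Variable Z : T -> 'I_N -> 'cV[R]_n.
Hypothesis mZ : forall i k, measurable_fun setT (fun w => Z w i k 0).
Hypothesis pZ : peelable P Z.
Variables (p B : R).
Hypothesis p2 : 2 < p.
Hypothesis B1 : 1 <= B.
Hypothesis n0 : (0 < n)%N.
Hypothesis nN : (n <= N)%N.
Hypothesis momZ : forall i a,
  (\int[P]_w (`|dot (Z w i) a| `^ p)%:E <= (B * dot a a `^ (p / 2))%:E)%E.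
Hypothesis isoZ : forall i a, (\int[P]_w (dot (Z w i) a ^+ 2)%:E = (dot a a)%:E)%E.

Notation t := (trunc0 p B n%:R N%:R).
Notation Q := (flat0 p B n%:R N%:R).
Notation s := (24 * n%:R * (t + Q)).

Let t0 : 0 < t. Proof. exact: trunc0_gt0. Qed.
Let Q0 : 0 <= Q. Proof. exact: flat0_ge0. Qed.
Let tQ0 : 0 < t + Q. Proof. by rewrite ltr_wpDr. Qed.
Let nR : 0 < n%:R :> R. Proof. by rewrite ltr0n. Qed.
Let NR : 0 < N%:R :> R. Proof. by rewrite ltr0n (leq_trans n0). Qed.

Definition tsum (a : 'cV[R]_n) (w : T) : R := \sum_i Num.min (dot (Z w i) a ^+ 2) t.

Lemma measurable_tsum a : measurable_fun setT (tsum a).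
Proof.
apply: measurable_sum => i; apply: measurable_minr; last exact: measurable_cst.
by apply: measurable_funX; apply: measurable_dot => k; [exact: mZ|exact: measurable_cst].
Qed.

(* One-sided Chernoff bound; [e] is 1 for the upper and -1 for the lower tail. *)
Lemma tsum_chernoff (a : 'cV[R]_n) (e lam c x : R) :
  (forall i, (\int[P]_w (expR (e * lam * Num.min (dot (Z w i) a ^+ 2) t))%:E <= (expR c)%:E)%E) ->
  (P [set w | (0 <= e * lam * tsum a w - x)%R] <= (expR (c * N%:R - x))%:E)%E.
Proof.
move=> Ec.
pose phi i (z : 'I_N -> 'cV[R]_n) := expR (e * lam * Num.min (dot (z i) a ^+ 2) t).
have mphi i : mfunc (phi i).
  move=> d' T' Y mY; apply: measurableT_comp => //; apply: measurable_funM; first exact: measurable_cst.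
  apply: measurable_minr; last exact: measurable_cst.
  by apply: measurable_funX; apply: measurable_dot => k; [exact: mY|exact: measurable_cst].
have prodE w : expR (- x) * \prod_(i <- enum 'I_N) phi i (Z w) = expR (e * lam * tsum a w - x).
  rewrite [in RHS]addrC expRD; congr (_ * _).
  by rewrite /tsum mulr_sumr expR_sum big_enum.
apply: le_trans (markov_le P (f := fun w => expR (- x) * \prod_(i <- enum 'I_N) phi i (Z w)) _ _ _ _) _.
- apply: measurable_leS; first exact: measurable_cst.
  apply: measurable_funB; last exact: measurable_cst.
  by apply: measurable_funM; [exact: measurable_cst|exact: measurable_tsum].
- by apply: (mfuncM (mfunc_cst (expR (- x))) (mfunc_prod (fun i _ => mphi i))).
- by move=> w; rewrite prodE expR_ge0.
- by move=> w /= h; rewrite prodE -expR0 ler_expR.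
apply: le_trans (prod_bound pZ (psi := fun=> expR (- x)) (c := fun=> expR c) (enum_uniq _) _ _ _ _ _ _ _ _) _ => //.
- by move=> i z; exact: expR_ge0.
- by move=> i k z v _ _ ik; rewrite /phi updN.
- by move=> i z _; under eq_integral do rewrite /phi updE; exact: Ec.
rewrite integral_cst// [X in (_ * (_ * X))%E](_ : _ = 1%E); last exact: probability_setT.
rewrite mule1 -EFinM lee_fin big_const_seq count_predT iter_mulr mulr1 -cardE card_ord.
by rewrite -expRM_natr -expRD.
Qed.

(** With lam = 1 / (t + Q) the deviation s is worth 24 n in the exponent. The variance costs 4 n and
    the bias of the lower tail n, which leaves more than 17 n. *)
Lemma tsum_prob (a : 'cV[R]_n) : dot a a = 1 ->
  measurable [set w | s < `|tsum a w - N%:R| ] /\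
  (P [set w | (s < `|tsum a w - N%:R|)%R] <= (2 * expR (- (17 * n%:R)))%:E)%E.
Proof.
move=> a1.
have mB : measurable [set w | s < `|tsum a w - N%:R| ].
  rewrite (_ : mkset _ = ~` [set w | `|tsum a w - N%:R| <= s]); last first.
    by apply/seteqP; split => w /=; rewrite ltNge => /negP.
  apply: measurableC; apply: measurable_leS; last exact: measurable_cst.
  apply: measurableT_comp => //; apply: measurable_funB; last exact: measurable_cst.
  exact: measurable_tsum.
split => //.
have [al [be [al0 be0 ab var]]] := trunc0_var p2 B1 n0 nN.
set lam := (t + Q)^-1 in var.
have lam0 : 0 < lam by rewrite invr_gt0.
have lamt : lam * t <= 1 by rewrite mulrC ler_pdivrMr// mul1r lerDl.
have lams : lam * s = 24 * n%:R by rewrite /lam; field; rewrite gt_eqF.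
have B0 : 0 < B by exact: lt_le_trans B1.
have mdot i : measurable_fun setT (fun w => dot (Z w i) a).
  by apply: measurable_dot => k; [exact: mZ|exact: measurable_cst].
have E2 i : (\int[P]_w (dot (Z w i) a ^+ 2)%:E = 1)%E by rewrite isoZ a1.
have Ep i : (\int[P]_w (`|dot (Z w i) a| `^ p)%:E <= B%:E)%E.
  by apply: le_trans (momZ i a) _; rewrite a1 powR1 mulr1.
set V := al + be * B in var.
pose U1 := [set w | 0 <= 1 * lam * tsum a w - lam * (N%:R + s)].
pose U2 := [set w | 0 <= -1 * lam * tsum a w - lam * (s - N%:R)].
have PU1 : (P U1 <= (expR (- (17 * n%:R)))%:E)%E.
  apply: le_trans (@tsum_chernoff a 1 lam (lam + 2 * lam ^+ 2 * V) _ _) _.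
    move=> i; rewrite mul1r.
    exact: (laplace_up (mdot i) (E2 i) (Ep i) t0 lam0 lamt al0 be0 ab).
  rewrite lee_fin ler_expR (mulrDr lam) lams; move: var nR; rewrite -/V; lra.
have PU2 : (P U2 <= (expR (- (17 * n%:R)))%:E)%E.
  apply: le_trans (@tsum_chernoff a (-1) lam (- lam + 2 * lam ^+ 2 * V + lam * (t `^ (1 - p / 2) * B)) _ _) _.
    move=> i; rewrite mulN1r; under eq_integral do rewrite mulNr.
    exact: (laplace_low (mdot i) p2 (E2 i) (Ep i) t0 lam0 al0 be0 ab).
  have bias : lam * (t `^ (1 - p / 2) * B) * N%:R <= n%:R.
    apply: (@le_trans _ _ (lam * (t * (n%:R / N%:R)) * N%:R)).
      by rewrite ler_wpM2r ?(ltW NR)// ler_wpM2l ?(ltW lam0)// trunc0_bias.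
    have -> : lam * (t * (n%:R / N%:R)) * N%:R = lam * t * n%:R by field; rewrite gt_eqF.
    by rewrite ler_piMl// ltW.
  rewrite lee_fin ler_expR (mulrBr lam) lams; move: var nR bias; rewrite -/V; lra.
have mU : measurable U1 /\ measurable U2.
  split; (apply: measurable_leS; first exact: measurable_cst);
  (apply: measurable_funB; last exact: measurable_cst);
  by apply: measurable_funM; [exact: measurable_cst|exact: measurable_tsum].
apply: (@le_trans _ _ (P (U1 `|` U2))).
  apply: le_measure; rewrite ?inE//; first by apply: measurableU; case: mU.
  move=> w /= h.
  have [h1|h1] := leP 0 (tsum a w - N%:R).
    left; rewrite /U1 /= mul1r -mulrBr mulr_ge0 ?(ltW lam0)//.
    by move: h; rewrite ger0_norm//; lra.
  right; rewrite /U2 /= mulN1r mulNr -opprD -mulrDr oppr_ge0 mulr_ge0_le0 ?(ltW lam0)//.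
  by move: h; rewrite ltr0_norm//; lra.
case: mU => mU1 mU2.
apply: le_trans (measureU2 _ mU1 mU2) _.
by rewrite mulr_natl mulr2n EFinD; exact: leeD.
Qed.

(** The expected number of exceedances is at most expR (- 18) n, so the binomial tail at n is at
    most (expR (1 - 18))^n. *)
Lemma count_prob (a : 'cV[R]_n) : dot a a = 1 ->
  let A := [set w | (n <= #|[set i in 'I_N | (t < dot (Z w i) a ^+ 2)%R]|)%N] in
  measurable A /\ (P A <= (expR (- (17 * n%:R)))%:E)%E.
Proof.
move=> a1; set A := mkset _ => /=.
have B0 : 0 < B by exact: lt_le_trans B1.
pose ev i (z : 'I_N -> 'cV[R]_n) := (t < dot (z i) a ^+ 2)%R.
have mev i : mfunc (fun z => (ev i z)%:R : R).
  move=> d' T' Y mY; apply: measurable_ltR; first exact: measurable_cst.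
  by apply: measurable_funX; apply: measurable_dot => k; [exact: mY|exact: measurable_cst].
pose b : R := expR (- 18) * (n%:R / N%:R).
have b0 : 0 < b by rewrite mulr_gt0 ?expR_gt0 ?divr_gt0.
have tp : Num.sqrt t `^ p = t `^ (p / 2).
  by rewrite -[Num.sqrt t]ger0_norm ?sqrtr_ge0// -sqr_powR sqr_sqrtr// ltW.
have evb i z : (\int[P]_w ((ev i (upd z i (Z w i)))%:R)%:E <= b%:E)%E.
  have st : 0 < Num.sqrt t by rewrite sqrtr_gt0.
  have p0 : 0 < p by apply: lt_trans p2.
  have h := tail_moment mZ p0 B0 momZ i a st.
  rewrite sqr_sqrtr ?(ltW t0)// a1 mulr1 tp in h.
  under eq_integral do rewrite /ev updE.
  by apply: le_trans h _; rewrite lee_fin; exact: trunc0_tail.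
have bE : b * N%:R = expR (- 18) * n%:R by rewrite /b; field; rewrite gt_eqF.
have bN : b * N%:R <= n%:R.
  by rewrite bE ler_piMl ?(ltW nR)// expR_le1; lra.
have ct := @count_tail R n N d T P Z mZ pZ finset.set0 (fun=> 1) ev b n (mfunc_cst 1) (fun=> ler01) mev.
have {}ct := ct (fun _ _ _ _ => erefl) _ (fun i z _ => evb i z) b0 n0 (leq_trans n0 nN) bN.
have AE w : (n <= #|[set i in ~: finset.set0 | ev i (Z w)]|)%N = (n <= #|[set i in 'I_N | (t < dot (Z w i) a ^+ 2)%R]|)%N.
  by congr (_ <= _)%N; apply: eq_card => i; rewrite !inE.
have mc : measurable_fun setT (fun w => (n <= #|[set i in ~: finset.set0 | ev i (Z w)]|)%N%:R : R).
  exact: (mfunc_count finset.set0 n mev mZ).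
have mA : measurable A.
  rewrite (_ : A = [set w | 1 <= (n <= #|[set i in ~: finset.set0 | ev i (Z w)]|)%N%:R :> R]); last first.
    by apply/seteqP; split => w; rewrite /A /= AE; case: (_ <= _)%N; rewrite ?ler10.
  by apply: measurable_leS => //; exact: measurable_cst.
split=> //.
apply: le_trans (markov_le P (f := fun w => 1 * (n <= #|[set i in ~: finset.set0 | ev i (Z w)]|)%N%:R) _ _ _ _) _ => //.
- by apply: measurable_funM => //; exact: measurable_cst.
- by move=> w; rewrite /A /= AE => ->; rewrite mulr1.
apply: le_trans (ct _) _.
  by move=> i k z v _ _ ik; rewrite /ev updN.
rewrite integral_cst// [X in (_ * (_ * X))%E](_ : _ = 1%E); last exact: probability_setT.
rewrite !mule1 lee_fin -(mulrA (expR 1) b) bE (mulrA (expR 1)) -expRD mulfK ?gt_eqF//.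
rewrite -expRM_natr ler_expR.
by rewrite (_ : (1 + - 18) * _ = - (17 * n%:R))//; ring.
Qed.

Definition zvec (z : 'I_n -> int) : 'cV[R]_n := \col_k (z k)%:~R.

Lemma bulk_event : exists E : set T, [/\ measurable E, (P (~` E) <= (3 / (8 * n%:R))%:E)%E &
  forall w, E w -> forall z : 'I_n -> int, \sum_k `|(z k)%:~R : R| <= (9 * n)%:R ->
   let a := zvec z in
   (#|[set i in 'I_N | (t * dot a a < dot (Z w i) a ^+ 2)%R]| <= n)%N /\
   `|\sum_i Num.min (dot (Z w i) a ^+ 2) (t * dot a a) - N%:R * dot a a| <= s * dot a a].
Proof.
pose nrm (a : 'cV[R]_n) := (Num.sqrt (dot a a))^-1 *: a.
have nrm1 a : dot a a != 0 -> dot (nrm a) (nrm a) = 1.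
  move=> a0; have ap : 0 < dot a a by rewrite lt_neqAle eq_sym a0 dot_ge0.
  rewrite dotZl dotZr mulrA -invfM -expr2 sqr_sqrtr ?(ltW ap)//.
  by rewrite mulVf.
pose bad (f : {ffun 'I_n -> coef (9 * n)}) : set T := if dot (zvec (ivec f)) (zvec (ivec f)) == 0 then set0 else
  let a := nrm (zvec (ivec f)) in
  [set w | s < `|tsum a w - N%:R| ] `|`
  [set w | (n <= #|[set i in 'I_N | (t < dot (Z w i) a ^+ 2)%R]|)%N].
have badP f : measurable (bad f) /\ (P (bad f) <= (3 * expR (- (17 * n%:R)))%:E)%E.
  rewrite /bad; case: eqP => [_|/eqP/nrm1 a1].
    by split => //; rewrite measure0 lee_fin mulr_ge0 ?expR_ge0.
  have [mA PA] := count_prob a1; have [mB PB] := tsum_prob a1.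
  split; first exact: measurableU.
  apply: le_trans (measureU2 _ mB mA) _.
  rewrite (_ : 3 * _ = 2 * expR (- (17 * n%:R)) + expR (- (17 * n%:R))); last by ring.
  by rewrite EFinD; apply: leeD.
pose Qf (f : {ffun 'I_n -> coef (9 * n)}) := (#|isupp f| <= n)%N && (il1 f <= 9 * n)%N.
have [mU PU] := @union_bound R d T P _ (index_enum _) Qf bad _ (fun f => (badP f).1) (fun f _ => (badP f).2).
exists (~` \big[setU/set0]_(f | Qf f) bad f); split.
- exact: measurableC.
- rewrite setCK; apply: le_trans PU _; rewrite lee_fin.
  (* With u = 1 and v = 1/2 the net has at most 2^(9 n) expR (4 n) <= expR (13 n) vectors; the
     remaining expR (- 4 n) is below 1 / (8 n). *)
  have h := @ivec_weight R n (9 * n) 1 1 (2^-1) n (9 * n) ler01 ltr01 (lexx _) _ _.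
  rewrite (eq_bigr (fun f : {ffun 'I_n -> coef (9 * n)} => 1 ^+ #|isupp f| * (3 * expR (- (17 * n%:R))))); last first.
    by move=> f _; rewrite expr1n mul1r.
  rewrite -mulr_suml.
  apply: (@le_trans _ _ (expR (13 * n%:R) * (3 * expR (- (17 * n%:R))))).
    rewrite ler_wpM2r ?mulr_ge0 ?expR_ge0//.
    apply: le_trans (h _ _) _; [by rewrite invr_gt0|by rewrite invf_lt1 ?ltr1n|].
    rewrite expr1n invr1 mul1r -exprVn invrK.
    apply: le_trans (ler_wpM2r (expR_ge0 _) (natX_le_expR _)) _.
    by rewrite -expRD ler_expR natrM (_ : 1 - 2^-1 = 2^-1 :> R) ?invrK; lra.
  rewrite mulrCA -expRD (_ : 13 * n%:R + - (17 * n%:R) = - (4 * n%:R)); last by ring.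
  rewrite ler_wpM2l// expRN lef_pV2 ?posrE ?expR_gt0 ?mulr_gt0//.
  have h8 : (8 * n <= 2 ^ (4 * n))%N.
    rewrite expnM (_ : (2 ^ 4 = 16)%N)//; case: (n) n0 => // m _; rewrite expnS.
    by have := ltn_expl m (isT : 1 < 16)%N; move: (16 ^ m)%N => M; clear; lia.
  rewrite -(ler_nat R) natrM natrX in h8; apply: le_trans h8 _.
  by rewrite -natrM; exact: natX_le_expR.
move=> w Ew z zl a.
have zi k : (`|z k| <= 9 * n)%N.
  rewrite -(ler_nat R); apply: le_trans zl; rewrite (bigD1 k)//= natr_absz intr_norm.
  by rewrite ler_wpDr// sumr_ge0.
have [f fz] := ivec_surj zi.
have zf : ivec f = z by apply/funext => i; rewrite fz.
have Qff : Qf f.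
  apply/andP; split; first by rewrite -[X in (_ <= X)%N]card_ord max_card.
  rewrite -(ler_nat R) (le_trans _ zl)// /il1 natr_sum.
  by apply: ler_sum => i _; rewrite fz natr_absz intr_norm.
have nb : ~ bad f w.
  by move=> bw; apply: Ew; rewrite -bigcup_seq_cond/=; exists f => //=; rewrite mem_index_enum.
have [a0|a0] := eqVneq (dot a a) 0.
  have d0 i : dot (Z w i) a ^+ 2 = 0.
    apply/eqP; rewrite eq_le sqr_ge0 andbT; apply: le_trans (dot_CS _ _) _.
    by rewrite a0 mulr0.
  split.
    rewrite (_ : [set i in 'I_N | _] = finset.set0) ?cards0//.
    by apply/setP => i; rewrite !inE d0 a0 mulr0 ltxx.
  rewrite a0 !mulr0 subr0 big1 ?normr0// => i _.
  by rewrite d0 minxx.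
have ap : 0 < dot a a by rewrite lt_neqAle eq_sym a0 dot_ge0.
move: nb; rewrite /bad zf -/a (negbTE a0) /= => /not_orP[/negP nb1 /negP nb2].
have dn i : dot (Z w i) (nrm a) ^+ 2 = (dot a a)^-1 * dot (Z w i) a ^+ 2.
  by rewrite dotZr exprMn exprVn sqr_sqrtr// ltW.
split.
  rewrite leqNgt; apply: contra nb2 => h; apply: leq_trans (ltnW h) _.
  apply: subset_leq_card; apply/fintype.subsetP => i; rewrite !inE /= dn.
  by rewrite ltr_pdivlMl// mulrC.
move: nb1; rewrite -leNgt => h.
rewrite (_ : \sum_i _ = tsum (nrm a) w * dot a a); last first.
  rewrite /tsum mulr_suml; apply: eq_bigr => i _.
  rewrite dn minr_pMl ?(ltW ap)// (_ : (dot a a)^-1 * dot (Z w i) a ^+ 2 * dot a a = dot (Z w i) a ^+ 2)//.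
  by field.
by rewrite -mulrBl normrM (ger0_norm (ltW ap)) ler_wpM2r// ltW.
Qed.

End Bulk.

(** * From integer vectors to all directions *)

Section Net.
Context {R : realType} {n N : nat}.
Variables (Y : 'I_N -> 'cV[R]_n) (c : R).
Hypothesis c0 : 0 <= c.
Hypothesis n0 : (0 < n)%N.

Definition qform (x : 'cV[R]_n) : R := \sum_i dot (Y i) x ^+ 2 - c * dot x x.

Definition bform (x y : 'cV[R]_n) : R := \sum_i dot (Y i) x * dot (Y i) y - c * dot x y.

Lemma qformD (x y : 'cV[R]_n) : qform (x + y) = qform x + qform y + 2 * bform x y.
Proof.
rewrite /qform /bform.
have -> : \sum_i dot (Y i) (x + y) ^+ 2 = \sum_i dot (Y i) x ^+ 2 + \sum_i dot (Y i) y ^+ 2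
    + 2 * \sum_i dot (Y i) x * dot (Y i) y.
  rewrite mulr_sumr -!big_split /=; apply: eq_bigr => i _; rewrite dotDr; ring.
rewrite dotDl !dotDr (dotC y x); ring.
Qed.

Lemma qformZ (a : R) (x : 'cV[R]_n) : qform (a *: x) = a ^+ 2 * qform x.
Proof.
rewrite /qform dotZl dotZr mulrBr; congr (_ - _); last by ring.
rewrite mulr_sumr; by apply: eq_bigr => i _; rewrite dotZr exprMn.
Qed.

Lemma bformZ (a b : R) (x y : 'cV[R]_n) : bform (a *: x) (b *: y) = a * b * bform x y.
Proof.
rewrite /bform dotZl dotZr mulrBr; congr (_ - _); last by ring.
rewrite mulr_sumr; by apply: eq_bigr => i _; rewrite !dotZr; ring.
Qed.

(** Polarisation and the parallelogram law, after scaling x by sqrt a and y by its inverse. *)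
Lemma bform_le (C : R) (x y : 'cV[R]_n) (a : R) : 0 < a ->
  (forall x, `|qform x| <= C * dot x x) ->
  `|2 * bform x y| <= C * (a * dot x x + a^-1 * dot y y).
Proof.
move=> a0 qC; pose r := Num.sqrt a.
have r0 : 0 < r by rewrite sqrtr_gt0.
have rr : r ^+ 2 = a by rewrite sqr_sqrtr// ltW.
have -> : 2 * bform x y = 2 * bform (r *: x) (r^-1 *: y).
  by rewrite bformZ mulfV ?gt_eqF// mul1r.
have -> : a * dot x x + a^-1 * dot y y = dot (r *: x) (r *: x) + dot (r^-1 *: y) (r^-1 *: y).
  by rewrite !dotZl !dotZr -rr; field; rewrite gt_eqF.
move: (r *: x) (r^-1 *: y) => {}x {}y.
have h1 := qC (x + y); have h2 := qC (x + (-1) *: y).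
rewrite !qformD !qformZ -[x in bform x (_ *: _)]scale1r bformZ in h1 h2.
rewrite !dotDl !dotDr !dotZl !dotZr in h1 h2.
rewrite (dotC y x) in h1 h2.
move: h1 h2; rewrite !ler_norml => /andP[h1 h2] /andP[h3 h4].
apply/andP; split; lra.
Qed.

Lemma qform_crude (x : 'cV[R]_n) : `|qform x| <= (\sum_i dot (Y i) (Y i) + c) * dot x x.
Proof.
rewrite /qform; apply: le_trans (ler_normB _ _) _.
have s0 : 0 <= \sum_i dot (Y i) x ^+ 2 by apply: sumr_ge0 => i _; exact: sqr_ge0.
rewrite (ger0_norm s0).
rewrite ger0_norm ?mulr_ge0 ?dot_ge0// mulrDl lerD2r mulr_suml.
by apply: ler_sum => i _; exact: dot_CS.
Qed.

Lemma dotBB (x y : 'cV[R]_n) : dot (x - y) (x - y) = dot x x - 2 * dot x y + dot y y.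
Proof. rewrite dotBr !(dotC (x - y)) !dotBr (dotC y x); ring. Qed.

Lemma perturb_le (y r : 'cV[R]_n) : dot y y = 1 -> dot r r <= 64^-1 ->
  dot (y - r) (y - r) <= 81 / 64.
Proof.
move=> y1 rl; rewrite dotBB y1.
have : dot (y + 8 *: r) (y + 8 *: r) = 1 + 16 * dot y r + 64 * dot r r.
  by rewrite dotDl !dotDr !dotZl !dotZr (dotC r y) y1; ring.
have := dot_ge0 (y + 8 *: r).
lra.
Qed.

(** Coordinatewise floor with mesh h = 1 / (8 sqrt n): the squared error is at most n h^2 = 1/64,
    and |z_k| <= |x_k| / h + 1 sums to at most 8 n + n by Cauchy-Schwarz. *)
Lemma round_unit (x : 'cV[R]_n) : dot x x = 1 ->
  exists (z : 'I_n -> int) (h : R), \sum_k `|(z k)%:~R : R| <= (9 * n)%:R /\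
    dot (x - h *: zvec z) (x - h *: zvec z) <= 64^-1.
Proof.
move=> x1; have nR : 0 < n%:R :> R by rewrite ltr0n.
pose sn : R := Num.sqrt n%:R; have sn0 : 0 < sn by rewrite sqrtr_gt0.
have snE : sn ^+ 2 = n%:R by rewrite sqr_sqrtr.
pose h := (8 * sn)^-1; have h0 : 0 < h by rewrite invr_gt0 mulr_gt0.
pose z k : int := Num.floor (x k 0 / h).
have zle k : (z k)%:~R <= x k 0 / h by exact: floor_le_tmp.
have zlt k : x k 0 / h < (z k)%:~R + 1.
  by have := floorD1_gt (x k 0 / h); rewrite intrD.
exists z, h; split.
  apply: (@le_trans _ _ (\sum_k (8 * sn * `|x k 0| + 1))).
    apply: ler_sum => k _.
    have -> : 8 * sn * `|x k 0| = `|x k 0 / h|.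
      by rewrite normrM /h invrK (gtr0_norm (_ : 0 < 8 * sn)) ?mulr_gt0// mulrC.
    have := zle k; have := zlt k; move: (x k 0 / h) => y; move: ((z k)%:~R : R) => zz.
    by case: (ger0P y); case: (ger0P zz); lra.
  rewrite big_split /= sumr_const card_ord -mulr_sumr.
  have h2 : \sum_k `|x k 0| <= sn.
    rewrite -(@ler_pXn2r _ 2) ?nnegrE ?(ltW sn0) ?sumr_ge0// snE.
    have := sum_CS xpredT (fun=> 1 : R) (fun k => `|x k 0|).
    under eq_bigr do rewrite mul1r.
    move=> /le_trans; apply.
    rewrite (_ : \sum_k `|x k 0| ^+ 2 = 1).
      by rewrite mulr1 expr1n sumr_const card_ord.
    by rewrite -x1 /dot; apply: eq_bigr => k _; rewrite real_normK ?num_real// expr2.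
  have := ler_wpM2l (_ : 0 <= 8 * sn) h2.
  rewrite mulr_ge0 ?(ltW sn0)// => /(_ isT).
  have -> : 8 * sn * sn = 8 * n%:R by rewrite -snE; ring.
  rewrite natrM; lra.
rewrite {1}/dot; apply: (@le_trans _ _ (\sum_(k < n) h ^+ 2)).
  apply: ler_sum => k _; rewrite !mxE -expr2.
  have := zle k; have := zlt k; rewrite ltr_pdivrMr// ler_pdivlMr// => a1 a2.
  by apply: lerXn2r; rewrite ?nnegrE ?(ltW h0)//; lra.
rewrite sumr_const card_ord -mulr_natl /h exprVn exprMn snE.
by rewrite le_eqVlt; apply/orP; left; apply/eqP; field; rewrite gt_eqF.
Qed.

(** A valid constant C can be improved to 4/3 al + C/3, whose fixed point is 2 al; iteration starts
    from the crude bound by the norms of all rows. The step works because 81/64 <= 4/3 and 1/64 +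
    (81/64)/8 + 8/64 <= 1/3. *)
Lemma net_bound (al : R) : 0 <= al ->
  (forall z : 'I_n -> int, \sum_k `|(z k)%:~R : R| <= (9 * n)%:R ->
     `|qform (zvec z)| <= al * dot (zvec z) (zvec z)) ->
  forall x, `|qform x| <= 2 * al * dot x x.
Proof.
move=> al0 net.
have step C : 0 <= C -> (forall x, `|qform x| <= C * dot x x) ->
    forall x, `|qform x| <= (4 / 3 * al + C / 3) * dot x x.
  move=> C0 qC x.
  have [x0|xn0] := eqVneq (dot x x) 0.
    by have := qC x; rewrite x0 !mulr0.
  have xp : 0 < dot x x by rewrite lt_neqAle eq_sym xn0 dot_ge0.
  pose s := Num.sqrt (dot x x); have s0 : 0 < s by rewrite sqrtr_gt0.
  have sE : s ^+ 2 = dot x x by rewrite sqr_sqrtr// ltW.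
  pose y := s^-1 *: x.
  have xy : x = s *: y by rewrite scalerA mulfV ?scale1r// gt_eqF.
  have y1 : dot y y = 1 by rewrite dotZl dotZr mulrA -expr2 exprVn sE mulVf.
  suff H : `|qform y| <= 4 / 3 * al + C / 3.
    rewrite {1}xy qformZ sE normrM (ger0_norm (ltW xp)) mulrC.
    by rewrite ler_wpM2r// ltW.
  have [z [h [zl rl]]] := round_unit y1.
  set a := h *: zvec z in rl; set r := y - a in rl.
  have yE : y = a + r by rewrite addrC subrK.
  have qa : `|qform a| <= al * dot a a.
    rewrite qformZ normrM ger0_norm ?sqr_ge0// dotZl dotZr.
    rewrite (_ : al * _ = h ^+ 2 * (al * dot (zvec z) (zvec z))); last by ring.
    by rewrite ler_wpM2l ?sqr_ge0// net.
  have r0 : 0 <= dot r r by exact: dot_ge0.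
  have a0 : 0 <= dot a a by exact: dot_ge0.
  have aa : dot a a <= 81 / 64.
    have aE : a = y - r by rewrite /r opprB addrC subrK.
    by rewrite {1 2}aE perturb_le.
  have br := bform_le a r (_ : 0 < 8^-1) qC.
  have {}br := br (_ : 0 < 8^-1).
  have qr := qC r.
  rewrite yE qformD.
  apply: le_trans (ler_normD _ _) _.
  apply: le_trans (lerD (ler_normD _ _) (br _)) _ => //.
  apply: le_trans (lerD (lerD qa qr) (lexx _)) _.
  rewrite invrK.
  have e1 := ler_wpM2l al0 aa.
  have e2 := ler_wpM2l C0 aa.
  have e3 := ler_wpM2l C0 rl.
  lra.
pose C0 := \sum_i dot (Y i) (Y i) + c.
have C00 : 0 <= C0 by rewrite addr_ge0// sumr_ge0// => i _; exact: dot_ge0.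
have it (k : nat) : forall x, `|qform x| <= (2 * al + C0 / 3 ^+ k) * dot x x.
  elim: k => [|k IH] x.
    rewrite expr0 divr1; apply: le_trans (qform_crude x) _.
    by rewrite ler_wpM2r ?dot_ge0// lerDr mulr_ge0.
  have Ck : 0 <= 2 * al + C0 / 3 ^+ k by rewrite addr_ge0 ?mulr_ge0// invr_ge0 exprn_ge0.
  apply: le_trans (step _ Ck IH x) _.
  rewrite (_ : 4 / 3 * al + _ = 2 * al + C0 / 3 ^+ k.+1)//.
  by rewrite exprS; field; rewrite expf_neq0.
move=> x; apply/ler_addgt0Pr => eps eps0.
set D := C0 * dot x x.
have D0 : 0 <= D by rewrite mulr_ge0 ?dot_ge0.
pose k := Num.truncn (D / eps).
have Dk : D / eps < 3 ^+ k.+1.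
  apply: lt_le_trans (truncnS_gt _) _; rewrite -natrX ler_nat -/k.
  by apply: ltnW; apply: ltn_expl.
apply: le_trans (it k.+1 x) _; rewrite mulrDl lerD2l mulrAC -/D.
rewrite ler_pdivrMr ?exprn_gt0// mulrC -ler_pdivrMr//; exact: ltW.
Qed.

End Net.

(** * Isotropic vectors *)

Section Constants.
Context {R : realType}.

(** In terms of x = 2^e, [Zlev] is at most of order x^4, and the coefficient of M is of order
    (x^3)^2 = 64^e. *)
Lemma sparse_const_le (theta : R) : 0 <= theta -> theta < 1 -> exists C : R, 0 < C /\
  forall (M tau : R) (e : nat), 0 <= M ->
  sparse_const M e e tau theta <= C * 64 ^+ e * (tau ^+ 2 + M).
Proof.
move=> th0 th1.
have [a [a0 aE]] : exists a : R, 0 <= a /\ a = 2 ^+ 10 by exists (2 ^+ 10); rewrite exprn_ge0.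
have [b [b0 bE]] : exists b : R, 0 <= b /\ b = 2 ^+ 11 by exists (2 ^+ 11); rewrite exprn_ge0.
have [q [q0 qE]] : exists q : R, 0 <= q /\ q = (48 / (1 - theta)) ^+ 2.
  by exists ((48 / (1 - theta)) ^+ 2); rewrite sqr_ge0.
have [z [z0 zE]] : exists z : R, 0 <= z /\ z = 20 + (33 * a + 1) * (8 + 33 * b).
  eexists; split; last reflexivity.
  by have := mulr_ge0 a0 b0; move: a0 b0; lra.
have [h [h0 hE]] : exists h : R, 0 <= h /\ h = (320 * a + 504) ^+ 2.
  by eexists; split; last reflexivity; exact: sqr_ge0.
exists (8 * (q * z + h) + 1); split.
  by rewrite ltr_pwDr// mulr_ge0// addr_ge0// mulr_ge0.
move=> M tau e M0.
have [x [x1 [x4 x8 x64 ex]]] : exists x : R, 1 <= x /\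
    [/\ 4 ^+ e = x ^+ 2, 8 ^+ e = x ^+ 3, 64 ^+ e = x ^+ 6 & e%:R <= x].
  exists (2 ^+ e); split; first by rewrite exprn_ege1// ler1n.
  split; rewrite ?(exprAC _ e).
  - by congr (_ ^+ _); ring.
  - by congr (_ ^+ _); ring.
  - by congr (_ ^+ _); ring.
  - by rewrite -natrX ler_nat ltnW// ltn_expl.
have x0 : 0 <= x by exact: le_trans x1.
have xX (i j : nat) : (i <= j)%N -> x ^+ i <= x ^+ j by move=> ij; exact: ler_weXn2l.
have zl : Zlev e <= z * x ^+ 6.
  rewrite /Zlev -aE -bE x4; set D := 3 * _.
  have D0 : 0 <= D by rewrite mulr_ge0.
  have Dx : D <= 33 * x by rewrite /D natrD; move: ex x1; lra.
  apply: (@le_trans _ _ (20 * x ^+ 6 + ((33 * a + 1) * x ^+ 3) * ((8 + 33 * b) * x))).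
    apply: lerD; first by rewrite ler_peMr// exprn_ege1.
    apply: ler_pM.
    - by rewrite addr_ge0// !mulr_ge0// exprn_ge0.
    - by rewrite addr_ge0// mulr_ge0.
    - rewrite mulrDl mul1r; apply: lerD; last by rewrite exprn_ege1.
      have -> : 33 * a * x ^+ 3 = x ^+ 2 * a * (33 * x) by ring.
      by rewrite ler_wpM2l// mulr_ge0// exprn_ge0.
    - rewrite mulrDl; apply: lerD; first by rewrite ler_peMr.
      have -> : 33 * b * x = b * (33 * x) by ring.
      by rewrite ler_wpM2l.
  have c0 : 0 <= (33 * a + 1) * (8 + 33 * b) by have := mulr_ge0 a0 b0; move: a0 b0; lra.
  have := ler_wpM2l c0 (xX 4 6 isT); rewrite zE; lra.
have hl : (320 * 8 ^+ e * 2 ^+ 10 + 384 + 120 * 4 ^+ e) ^+ 2 <= h * x ^+ 6.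
  rewrite -aE x8 x4 hE (_ : x ^+ 6 = (x ^+ 3) ^+ 2); last by rewrite -exprM.
  have n2 : 0 <= x ^+ 2 by exact: exprn_ge0.
  have n3 : 0 <= x ^+ 3 by exact: exprn_ge0.
  have n4 := mulr_ge0 n3 a0.
  have := xX 2 3 isT; have := xX 0 3 isT; rewrite expr0.
  move: (x ^+ 2) (x ^+ 3) n2 n3 n4 => x2 x3 n2 n3 n4 l1 l2.
  by rewrite -exprMn ler_pXn2r// ?nnegrE; lra.
rewrite /sparse_const x64.
have -> : (48 * tau / (1 - theta)) ^+ 2 = q * tau ^+ 2.
  by rewrite qE -exprMn; congr (_ ^+ 2); rewrite mulrAC.
have t20 := sqr_ge0 tau; have x60 : 0 <= x ^+ 6 by rewrite exprn_ge0.
have := ler_wpM2l (mulr_ge0 q0 t20) zl.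
have := ler_wpM2r M0 hl.
move: (_ ^+ 2 * M) (Zlev e) => HM ZL h1 h2.
have g1 := mulr_ge0 (mulr_ge0 (mulr_ge0 q0 z0) x60) M0.
have g2 := mulr_ge0 (mulr_ge0 h0 x60) t20.
have g3 := mulr_ge0 x60 (addr_ge0 t20 M0).
move: (x ^+ 6) (tau ^+ 2) h1 h2 g1 g2 g3 => X TT h1 h2 g1 g2 g3.
lra.
Qed.

(** e is log_4 (1 + L) up to a constant: in e = k + 6 + r the part k handles L, r handles 54 / c,
    and 6 the numerical constants. *)
Lemma choose_e (c : R) : 0 < c -> exists C : R, 0 < C /\ forall L : R, 0 <= L ->
  exists e : nat, [/\ (4 <= e)%N, 92 + 27 * e%:R + 9 * L <= 4 ^+ (e - 1),
    54 <= 4 ^+ (e - 1) * c & 64 ^+ e <= C * (1 + L) ^+ 3].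
Proof.
move=> c0.
pose r := (Num.truncn (54 / c)).+1.
have rc : 54 <= 4 ^+ r * c.
  rewrite -ler_pdivrMr//; apply: ltW; apply: lt_le_trans (truncnS_gt _) _.
  by rewrite -natrX ler_nat ltnW// ltn_expl.
exists (64 ^+ (6 + r)); split; first by rewrite exprn_gt0.
move=> L L0; pose l := (Num.truncn L).+1.
have Ll : L <= l%:R by apply: ltW; exact: truncnS_gt.
have lL : l%:R <= 1 + L.
  by rewrite /l -addn1 natrD addrC lerD2l truncn_le.
pose k := trunc_log 4 l.
have /andP[k1 k2] : (4 ^ k <= l < 4 ^ k.+1)%N by apply: trunc_log_bounds.
exists (k + (6 + r))%N.
have E1 : 4 ^+ (k + (6 + r) - 1) = 4 ^+ k * (4 ^+ 5 * 4 ^+ r) :> R.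
  by rewrite -!exprD; congr (4 ^+ _); clear; lia.
have f0 : 1 <= 4 ^+ k :> R by rewrite exprn_ege1// ler1n.
have g0 : 1 <= 4 ^+ r :> R by rewrite exprn_ege1// ler1n.
have fk : k%:R <= 4 ^+ k :> R by rewrite -natrX ler_nat ltnW// ltn_expl.
have gr : r%:R <= 4 ^+ r :> R by rewrite -natrX ler_nat ltnW// ltn_expl.
have Lf : L <= 4 * 4 ^+ k.
  by rewrite -exprS; apply: le_trans Ll _; rewrite -natrX ler_nat ltnW.
rewrite E1; split.
- by clear; lia.
- rewrite !natrD; move: f0 g0 fk gr Lf; move: (4 ^+ k) (4 ^+ r) => f g f0 g0 fk gr Lf.
  rewrite (_ : 4 ^+ 5 = 1024 :> R); last by ring.
  have h1 : 0 <= (f - 1) * g by rewrite mulr_ge0//; lra.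
  have h2 : 0 <= f * (g - 1) by rewrite mulr_ge0//; lra.
  move: h1 h2; nra.
- apply: le_trans rc _.
  have gc : 0 <= 4 ^+ r * c by rewrite mulr_ge0// ?ltW// exprn_gt0.
  have h1 : 1 <= 4 ^+ k * 4 ^+ 5 :> R by rewrite mulr_ege1// exprn_ege1// ler1n.
  have -> : 4 ^+ k * (4 ^+ 5 * 4 ^+ r) * c = (4 ^+ k * 4 ^+ 5) * (4 ^+ r * c) by ring.
  by rewrite ler_peMl.
- rewrite exprD mulrC ler_wpM2l ?exprn_ge0//.
  rewrite (_ : 64 ^+ k = (4 ^+ k) ^+ 3); last by rewrite exprAC; congr (_ ^+ _); ring.
  apply: lerXn2r; rewrite ?nnegrE ?exprn_ge0 ?addr_ge0//.
  by apply: le_trans lL; rewrite -natrX ler_nat.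
Qed.

End Constants.

(** * Rows of large norm *)

Section BigRows.
Context {R : realType} {n N : nat} {d} {T : measurableType d} (P : probability T R).
Variable Z : T -> 'I_N -> 'cV[R]_n.
Hypothesis mZ : forall i k, measurable_fun setT (fun w => Z w i k 0).
Variables (p B : R).
Hypothesis p2 : 2 < p.
Hypothesis B1 : 1 <= B.
Hypothesis n0 : (0 < n)%N.
Hypothesis nN : (n <= N)%N.
Hypothesis momZ : forall i a,
  (\int[P]_w (`|dot (Z w i) a| `^ p)%:E <= (B * dot a a `^ (p / 2))%:E)%E.

Notation t := (trunc0 p B n%:R N%:R).

(** Truncating each coordinate gives |Z|^2 <= n t + t^(1-p/2) sum_k |Z_k|^p. Exceeding 2 n t
    therefore has probability at most t^(1-p/2) B / t, which [trunc0_bias] bounds by n / N. *)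
Lemma big_row_prob i :
  (\int[P]_w ((2 * (n%:R * t) < dot (Z w i) (Z w i))%R%:R)%:E <= (n%:R / N%:R)%:E)%E.
Proof.
have t0 : 0 < t by exact: trunc0_gt0.
have B0 : 0 < B by exact: lt_le_trans B1.
have nR : 0 < n%:R :> R by rewrite ltr0n.
set g := t `^ (1 - p / 2).
have g0 : 0 <= g by exact: powR_ge0.
pose c : R := g / (n%:R * t).
have c0 : 0 <= c by rewrite divr_ge0// mulr_ge0// ltW.
have mk k : measurable_fun setT (fun w => `|Z w i k 0| `^ p).
  by apply: (measurableT_comp (measurable_powR p)); apply: measurableT_comp => //; exact: mZ.
have momk k : (\int[P]_w (`|Z w i k 0| `^ p)%:E <= B%:E)%E.
  have e1 : dot (delta_mx k 0 : 'cV[R]_n) (delta_mx k 0) = 1.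
    rewrite /dot (bigD1 k)//= big1 ?addr0 => [|l lk]; rewrite !mxE ?eqxx ?mulr1//.
    by rewrite (negbTE lk) mul0r.
  have := momZ i (delta_mx k 0); rewrite e1 powR1 mulr1.
  under eq_integral => w _.
    rewrite (_ : dot (Z w i) (delta_mx k 0) = Z w i k 0); last first.
      rewrite /dot (bigD1 k)//= big1 ?addr0 => [|l lk]; rewrite !mxE ?eqxx ?mulr1//.
      by rewrite (negbTE lk) mulr0.
    over.
  by [].
apply: (@le_trans _ _ (\int[P]_w (c * \sum_k `|Z w i k 0| `^ p)%:E)%E).
  apply: le_integral_pos => //.
  - apply: measurable_ltR; first exact: measurable_cst.
    by apply: measurable_dot => k; exact: mZ.
  - by apply: measurable_funM; [exact: measurable_cst|apply: measurable_sum => k].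
  move=> w; case: ltP => h /=; last by rewrite mulr_ge0// sumr_ge0// => k _; exact: powR_ge0.
  have nt0 : 0 < n%:R * t by rewrite mulr_gt0.
  rewrite /c mulrAC ler_pdivlMr// mul1r -(lerD2l (n%:R * t)).
  apply: (@le_trans _ _ (dot (Z w i) (Z w i))); first by move: h; lra.
  rewrite [n%:R * t](_ : _ = \sum_(k < n) t); last by rewrite sumr_const card_ord mulr_natl.
  rewrite mulr_sumr -big_split /=; apply: ler_sum => k _; rewrite -expr2.
  apply: le_trans (sqr_le_trunc (Z w i k 0) p2 t0) _.
  by rewrite lerD2r ge_min lexx orbT.
under eq_integral do rewrite EFinM.
rewrite ge0_integralZl//; first last.
- by move=> w _; rewrite lee_fin sumr_ge0// => k _; exact: powR_ge0.
- by apply/measurable_EFinP; apply: measurable_sum => k.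
under eq_integral do rewrite -sumEFin.
rewrite ge0_integral_sum//; first last.
- by move=> k; apply/measurable_EFinP.
apply: (@le_trans _ _ (c%:E * \sum_(k < n) B%:E)%E).
  by apply: lee_wpmul2l => //; apply: lee_sum => k _; exact: momk.
rewrite sumEFin -EFinM lee_fin sumr_const card_ord -(mulr_natr B n).
apply: (@le_trans _ _ (g * B / t)); last first.
  by rewrite ler_pdivrMr// [leRHS]mulrC; exact: trunc0_bias.
by rewrite /c le_eqVlt; apply/orP; left; apply/eqP; field; rewrite !gt_eqF.
Qed.

End BigRows.

Lemma log_bounds {R : realType} (L : R) : 2^-1 <= L ->
  1 <= 16 * L ^+ 4 /\ (1 + L) ^+ 3 <= 54 * L ^+ 4.
Proof.
move=> L2; have L0 : 0 <= L by apply: le_trans L2.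
split.
  rewrite (_ : 16 * L ^+ 4 = (2 * L) ^+ 4); last by ring.
  by apply: exprn_ege1; lra.
apply: (@le_trans _ _ ((3 * L) ^+ 3)).
  by apply: lerXn2r; rewrite ?nnegrE ?addr_ge0 ?mulr_ge0//; lra.
have := ler_wpM2l (exprn_ge0 3 L0) L2; rewrite (_ : L ^+ 3 * L = L ^+ 4); last by ring.
rewrite (_ : (3 * L) ^+ 3 = 27 * L ^+ 3); last by ring.
lra.
Qed.

Lemma whitened_bound {R : realType} (p0 : R) : 2 < p0 -> exists C : R, 0 < C /\
  forall (d : measure_display) (T : measurableType d) (P : probability T R) (n N : nat)
    (Z : T -> 'I_N -> 'cV[R]_n) (p B : R),
  (forall i k, measurable_fun setT (fun w => Z w i k 0)) -> peelable P Z ->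
  p0 <= p -> 1 <= B -> (0 < n)%N -> (2 * n <= N)%N ->
  (forall i a, (\int[P]_w (`|dot (Z w i) a| `^ p)%:E <= (B * dot a a `^ (p / 2))%:E)%E) ->
  (forall i a, (\int[P]_w (dot (Z w i) a ^+ 2)%:E = (dot a a)%:E)%E) ->
  exists E : set T, [/\ measurable E, (P (~` E) <= (n%:R^-1)%:E)%E &
    forall w, E w -> forall x, `|qform (Z w) N%:R x| <=
      C * (\big[Num.max/0]_i dot (Z w i) (Z w i)
           + n%:R * trunc0 p B n%:R N%:R * ln (N%:R / n%:R) ^+ 4
           + n%:R * flat0 p B n%:R N%:R) * dot x x].
Proof.
move=> p02.
have p00 : 0 < p0 by exact: lt_trans p02.
pose c := (p0 - 2) / 4.
have c0 : 0 < c by rewrite divr_gt0// subr_gt0.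
have th0 : 0 <= theta0 p0 by exact: expR_ge0.
have th1 : theta0 p0 < 1 by rewrite expR_lt1 oppr_lt0 divr_gt0 ?subr_gt0 ?mulr_gt0.
have [C1 [C10 sparseC]] := sparse_const_le th0 th1.
have [Ce [Ce0 chooseC]] := choose_e c0.
have [A [A0 AE]] : exists A : R, 0 < A /\ A = expR 20 by exists (expR 20); rewrite expR_gt0.
pose G := C1 * Ce; have G0 : 0 < G by exact: mulr_gt0.
(* 2 comes from the net, 408 = 24 * 16 + 24 from the bulk deviation (using 1 <= 16 L^4), and 70 = 16
   + 54 from the two classes of rows. *)
exists (2 * (408 + G * (1 + 70 * (A + 2)))); split.
  by have := mulr_gt0 G0 A0; move: G0; lra.
move=> d T P n N Z p B mZ pZ p0p B1 n0 nN momZ isoZ.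
have p2 : 2 < p by exact: lt_le_trans p0p.
have B0 : 0 < B by exact: lt_le_trans B1.
have nN1 : (n <= N)%N by apply: leq_trans nN; rewrite leq_pmull.
have N0 : (0 < N)%N by exact: leq_trans nN1.
have nR : 0 < n%:R :> R by rewrite ltr0n.
have NR : 0 < N%:R :> R by rewrite ltr0n.
set t := trunc0 p B n%:R N%:R; set Q := flat0 p B n%:R N%:R.
have t0 : 0 < t by exact: trunc0_gt0.
have Q0 : 0 <= Q by exact: flat0_ge0.
pose y := n%:R * t; have y0 : 0 < y by exact: mulr_gt0.
pose M0 := 2 * y; have M00 : 0 < M0 by rewrite mulr_gt0.
set L := ln (N%:R / n%:R).
have L2 : 2^-1 <= L.
  rewrite -[2^-1]expRK; rewrite ler_ln ?posrE ?expR_gt0 ?divr_gt0//.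
  apply: (@le_trans _ _ 2); last by rewrite ler_pdivlMr// -natrM ler_nat.
  rewrite -(@ler_pXn2r _ 2) ?nnegrE ?expR_ge0//.
  rewrite -expRM_natr mulVf//; apply: le_trans expR1_le4 _.
  by rewrite -natrX ler_nat.
have L0 : 0 <= L by apply: le_trans L2.
have eL : N%:R = n%:R * expR L.
  by rewrite /L lnK ?posrE ?divr_gt0//; field; rewrite gt_eqF.
have [ea [a4 ar1 ar2 aC]] := chooseC 0 (lexx _).
have [eb [b4 br1 br2 bC]] := chooseC L L0.
pose ca (v : 'cV[R]_n) := (M0 < dot v v)%R.
pose cb (v : 'cV[R]_n) := (dot v v <= M0)%R.
have mca i : mfunc (fun z : 'I_N -> 'cV[R]_n => (ca (z i))%:R : R).
  move=> d' T' Y mY; apply: measurable_ltR; first exact: measurable_cst.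
  by apply: measurable_dot => k; exact: mY.
have mcb i : mfunc (fun z : 'I_N -> 'cV[R]_n => (cb (z i))%:R : R).
  move=> d' T' Y mY; apply: measurable_leR; last exact: measurable_cst.
  by apply: measurable_dot => k; exact: mY.
have r3 e : 54 <= 4 ^+ (e - 1) * c -> 4 <= 4 ^+ (e - 1) * c by lra.
have qa0 : 0 <= n%:R / N%:R :> R by rewrite divr_ge0.
have cqa i : (\int[P]_w ((ca (Z w i))%:R)%:E <= (n%:R / N%:R)%:E)%E.
  exact: (big_row_prob mZ p2 B1 n0 nN1 momZ).
have cqb i : (\int[P]_w ((cb (Z w i))%:R)%:E <= 1%:E)%E.
  apply: (@le_trans _ _ (\int[P]_w (1 : R)%:E)%E).
    apply: le_integral_pos => //; first by apply: (mcb i); exact: mZ.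
    by move=> w; case: (cb _).
  rewrite integral_cst// [X in (_ * X)%E](_ : _ = 1%E); last exact: probability_setT.
  by rewrite mule1.
have qan : n%:R / N%:R * N%:R <= n%:R * expR 0 :> R.
  by rewrite expR0 mulr1 divfK// gt_eqF.
have qbn : 1 * N%:R <= n%:R * expR L :> R by rewrite mul1r -eL.
(* Class [ca] has probability at most n / N, so Lam = 0 suffices; [cb] is given probability 1, which
   requires Lam = ln (N / n). *)
have [Ea [mEa PEa EaP]] := class_event mZ pZ p02 p0p B0 momZ qa0 mca cqa n0 N0 (lexx 0)
  qan a4 (leqnn ea) ar1 ar2 (r3 _ ar2).
have [Eb [mEb PEb EbP]] := class_event mZ pZ p02 p0p B0 momZ ler01 mcb cqb n0 N0 L0
  qbn b4 (leqnn eb) br1 br2 (r3 _ br2).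
have [Ec [mEc PEc EcP]] := bulk_event mZ pZ p2 B1 n0 nN1 momZ isoZ.
exists (Ea `&` Eb `&` Ec); split.
- by apply: measurableI => //; exact: measurableI.
- rewrite !setCI.
  apply: le_trans (measureU2 _ _ _) _; rewrite ?inE; [|exact: measurableC|].
    by apply: measurableU; exact: measurableC.
  apply: le_trans (leeD (measureU2 _ _ _) PEc) _; [exact: measurableC|exact: measurableC|].
  apply: le_trans (leeD (leeD PEa PEb) (lexx _)) _.
  rewrite -!EFinD lee_fin.
  rewrite (_ : _ + _ + _ = 5 / 8 * n%:R^-1); last by field; rewrite gt_eqF.
  by rewrite ler_piMl ?invr_ge0//; lra.
move=> w [[Ewa Ewb] Ewc].
set Mx := \big[Num.max/0]_i _.
have Mxi i : dot (Z w i) (Z w i) <= Mx by exact: le_bigmax.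
have Mx0 : 0 <= Mx by exact: bigmax_ge_id.
set tau := tau0 p B n%:R N%:R.
have tauE : tau ^+ 2 = A * y.
  rewrite /tau /tau0 sqr_sqrtr; last by rewrite !mulr_ge0 ?expR_ge0 ?powR_ge0.
  rewrite AE /y /t /trunc0 (_ : expR 38 = expR 20 * expR 18 :> R); last first.
    by rewrite -expRD; congr expR; ring.
  by ring.
pose sa := C1 * 64 ^+ ea * (tau ^+ 2 + (Mx + M0)).
pose sb := C1 * 64 ^+ eb * (tau ^+ 2 + M0).
have e64 e : 0 <= C1 * 64 ^+ e by rewrite mulr_ge0 ?exprn_ge0// ltW.
have sa0 : 0 <= sa by rewrite mulr_ge0// !addr_ge0 ?sqr_ge0 ?(ltW M00).
have sb0 : 0 <= sb by rewrite mulr_ge0// !addr_ge0 ?sqr_ge0 ?(ltW M00).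
have s0 : 0 <= 24 * n%:R * (t + Q) by rewrite mulr_ge0 ?mulr_ge0// addr_ge0// ltW.
have al0 : 0 <= 24 * n%:R * (t + Q) + (sa + sb) by rewrite addr_ge0// addr_ge0.
have MM0 : 0 < Mx + M0 by rewrite ltr_wpDl.
move=> x; apply: le_trans (net_bound (Y := Z w) (ler0n _ N) n0 al0 _ x) _.
  move=> z zl; have [cnt bulk] := EcP w Ewc z zl.
  set a := zvec z in cnt bulk *; set D := dot a a in cnt bulk *.
  have D0 : 0 <= D by exact: dot_ge0.
  set S := [set i in 'I_N | (t * D < dot (Z w i) a ^+ 2)%R] in cnt.
  (* The truncation error lives on the at most n exceeding rows, which are split between the two
     classes. *)
  have Sle : 0 <= \sum_i (dot (Z w i) a ^+ 2 - Num.min (dot (Z w i) a ^+ 2) (t * D)) <= (sa + sb) * D.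
    apply/andP; split.
      by apply: sumr_ge0 => i _; rewrite subr_ge0 ge_min lexx.
    apply: (@le_trans _ _ (\sum_(i in S) dot (Z w i) a ^+ 2)).
      rewrite [leRHS]big_mkcond /=; apply: ler_sum => i _; rewrite inE /=.
      case: ltP => h; last by rewrite subrr.
      by rewrite lerBlDr lerDl mulr_ge0// ltW.
    rewrite (bigID (fun i => ca (Z w i))) /= mulrDl.
    have Sa := EaP w Ewa (Mx + M0) [set i in S | ca (Z w i)] a MM0.
    have Sb := EbP w Ewb M0 [set i in S | cb (Z w i)] a M00.
    have card_le (q : pred 'I_N) : (#|[set i in S | q i]| <= n)%N.
      apply: leq_trans cnt; apply: subset_leq_card.
      by apply/fintype.subsetP => i; rewrite inE => /andP[].
    apply: lerD.
      apply: (@le_trans _ _ (sparse_const (Mx + M0) ea ea tau (theta0 p0) * D)).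
        have := Sa _ _ (card_le _).
        rewrite (eq_bigl (fun i => (i \in S) && ca (Z w i))); last by move=> i; rewrite inE.
        apply; first by move=> i _; apply: (le_trans (Mxi i)); rewrite lerDl ltW.
        by move=> i; rewrite inE => /andP[].
      rewrite ler_wpM2r//; exact: sparseC (ltW MM0).
    apply: (@le_trans _ _ (sparse_const M0 eb eb tau (theta0 p0) * D)).
      have := Sb _ _ (card_le _).
      rewrite (eq_bigl (fun i => (i \in S) && ~~ ca (Z w i))); last first.
        by move=> i; rewrite inE /ca -leNgt.
      apply; first by [].
      by move=> i; rewrite inE => /andP[].
    rewrite ler_wpM2r//; exact: sparseC (ltW M00).
  rewrite /qform -/D (_ : _ - _ = (\sum_i Num.min (dot (Z w i) a ^+ 2) (t * D) - N%:R * D)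
     + \sum_i (dot (Z w i) a ^+ 2 - Num.min (dot (Z w i) a ^+ 2) (t * D))); last first.
    by rewrite sumrB; ring.
  apply: le_trans (ler_normD _ _) _; rewrite mulrDl; apply: lerD => //.
  by case/andP: Sle => S0 S1; rewrite ger0_norm.
rewrite ler_wpM2r ?dot_ge0// -[leRHS]mulrA ler_wpM2l//.
have [L4 L3] := log_bounds L2.
have L40 : 0 <= L ^+ 4 by exact: exprn_ge0.
rewrite addr0 expr1n mulr1 in aC.
have ga : C1 * 64 ^+ ea <= G by rewrite ler_wpM2l// ltW.
have gb : C1 * 64 ^+ eb <= G * (54 * L ^+ 4).
  rewrite /G -mulrA ler_wpM2l// ?(ltW C10)//; apply: le_trans bC _.
  by rewrite ler_wpM2l// ltW.
have Ty : 0 <= A * y + M0 by exact: addr_ge0 (mulr_ge0 (ltW A0) (ltW y0)) (ltW M00).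
have h1 : sa <= G * (A * y + (Mx + M0)).
  by rewrite /sa tauE ler_wpM2r// addrCA; exact: addr_ge0.
have h2 : sb <= G * (54 * L ^+ 4) * (A * y + M0) by rewrite /sb tauE ler_wpM2r.
have y1 : y <= 16 * (y * L ^+ 4).
  by have := ler_wpM2l (ltW y0) L4; rewrite mulr1 mulrCA.
have A2 : 0 <= A + 2 by move: A0; lra.
have h3 : G * (A * y + (Mx + M0)) <= G * Mx + G * ((A + 2) * (16 * (y * L ^+ 4))).
  rewrite -mulrDr ler_wpM2l ?(ltW G0)//.
  by have := ler_wpM2l A2 y1; rewrite /M0; lra.
have nQ : 0 <= n%:R * Q by rewrite mulr_ge0.
rewrite -/y.
have yL0 : 0 <= y * L ^+ 4 by rewrite mulr_ge0// ltW.
have -> : 24 * n%:R * (t + Q) = 24 * y + 24 * (n%:R * Q) by rewrite /y; ring.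
have g1 := mulr_ge0 (ltW G0) (mulr_ge0 A2 Mx0).
have g2 := mulr_ge0 (ltW G0) (mulr_ge0 A2 nQ).
have g3 := mulr_ge0 (ltW G0) Mx0.
have g4 := mulr_ge0 (ltW G0) nQ.
have g5 := mulr_ge0 (ltW G0) yL0.
have h4 : G * (54 * L ^+ 4) * (A * y + M0) = 54 * (G * ((A + 2) * (y * L ^+ 4))).
  by rewrite /M0; ring.
rewrite h4 in h2.
have h5 : G * ((A + 2) * (16 * (y * L ^+ 4))) = 16 * (G * ((A + 2) * (y * L ^+ 4))) by ring.
rewrite h5 in h3.
move: h1 h2 h3 y1 g1 g2 g3 g4 g5 yL0 nQ Mx0.
move: (y * L ^+ 4) (n%:R * Q) (sa) (sb) (G * (A * y + (Mx + M0))) (y) (Mx) (G) (A) => *.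
lra.
Qed.

(** * Whitening *)

Section SameLaw.
Context {R : realType} {n : nat} {d} {T : measurableType d} (P : probability T R).

Definition borel (g : 'cV[R]_n -> R) : Prop :=
  forall d' (T' : measurableType d') (Z : T' -> 'cV[R]_n),
    (forall k, measurable_fun setT (fun w => Z w k 0)) -> measurable_fun setT (fun w => g (Z w)).

Lemma same_law_integral (Y X : T -> 'cV[R]_n) (g : 'cV[R]_n -> R) :
  rand_vec Y -> rand_vec X -> same_law P Y X -> borel g -> (forall v, 0 <= g v) ->
  (\int[P]_w (g (Y w))%:E = \int[P]_w (g (X w))%:E)%E.
Proof.
move=> mY mX YX mg g0.
pose tup (U : T -> 'cV[R]_n) w := [tuple U w k 0 | k < n].
have mtup U : rand_vec U -> measurable_fun setT (tup U).
  move=> mU; apply/measurable_fun_tnthP => k.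
  apply: eq_measurable_fun (mU k) => w _ /=.
  by rewrite tnth_mktuple.
pose h (t : n.-tuple R) : \bar R := (g (\col_k tnth t k))%:E.
have mh : measurable_fun setT h.
  apply/measurable_EFinP; apply: mg => k.
  apply: (eq_measurable_fun (@tnth n R ^~ k)) => [t _|]; first by rewrite mxE.
  exact: measurable_tnth.
have hE U w : (g (U w))%:E = h (tup U w).
  by rewrite /h; congr (g _)%:E; apply/matrixP => k z; rewrite ord1 !mxE tnth_mktuple.
pose mY' := isMeasurableFun.Build _ _ _ _ _ (mtup Y mY).
pose Y' : {mfun T >-> n.-tuple R} := HB.pack (tup Y) mY'.
pose mX' := isMeasurableFun.Build _ _ _ _ _ (mtup X mX).
pose X' : {mfun T >-> n.-tuple R} := HB.pack (tup X) mX'.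
have h0 t : (0 <= h t)%E by rewrite lee_fin.
transitivity (\int[distribution P Y']_t h t)%E.
  by rewrite ge0_integral_distribution//; apply: eq_integral => w _; rewrite hE.
transitivity (\int[distribution P X']_t h t)%E; last first.
  by rewrite ge0_integral_distribution//; apply: eq_integral => w _; rewrite hE.
apply: eq_measure_integral => A mA _.
apply: boxes_unique => //; first by rewrite (le_lt_trans (probability_le1 _ _))// ltry.
move=> D mD.
have preE U : rect_pre U D = tup U @^-1` box D.
  by apply/seteqP; split => w /= hw i; have := hw i; rewrite tnth_mktuple.
by have := YX D mD; rewrite !preE.
Qed.

Lemma borel_dot (f : R -> R) (b : 'cV[R]_n) : measurable_fun setT f -> borel (fun v => f (dot v b)).
Proof.
move=> mf d' T' Z mZ; apply: measurableT_comp => //.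
by apply: measurable_sum => k; apply: measurable_funM; [exact: mZ|exact: measurable_cst].
Qed.

End SameLaw.

Section LinearPeel.
Context {R : realType} {n N : nat} {d} {T : measurableType d} (P : probability T R).
Variable Xs : 'I_N -> T -> 'cV[R]_n.
Hypothesis mX : forall i, rand_vec (Xs i).
Hypothesis iX : mutually_indep P Xs.

Lemma measurable_mulmx d' (T' : measurableType d') (W : 'M[R]_n) (Y : T' -> 'cV[R]_n) :
  (forall k, measurable_fun setT (fun w => Y w k 0)) ->
  forall k, measurable_fun setT (fun w => (W *m Y w) k 0).
Proof.
move=> mY k; apply: (eq_measurable_fun (fun w => \sum_j W k j * Y w j 0)).
  by move=> w _; rewrite mxE.
by apply: measurable_sum => j; apply: measurable_funM => //; exact: measurable_cst.
Qed.

(** A linear map applied to every row commutes with [upd]. *)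
Lemma mulmx_peelable (W : 'M[R]_n) : peelable P (fun w i => W *m Xs i w).
Proof.
move=> i psi phi c mpsi mphi psi0 phi0 psiu phic.
have updW s v : (fun k => W *m upd s i v k) = upd (fun k => W *m s k) i (W *m v).
  by apply/funext => k; rewrite /upd; case: eqP.
have mW f : mfunc f -> mfunc (fun s : 'I_N -> 'cV[R]_n => f (fun k => W *m s k)).
  by move=> mf d' T' Y mY; apply: mf => l k; apply: measurable_mulmx => j; exact: mY.
have := @peel R n N d T P Xs mX iX i (fun s => psi (fun k => W *m s k))
  (fun s => phi (fun k => W *m s k)) c (mW _ mpsi) (mW _ mphi).
apply => // [s v|s]; first by rewrite updW psiu.
by under eq_integral do rewrite updW; exact: phic.
Qed.

End LinearPeel.

(** * Factorisation of the covariance matrix *)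

Section Cholesky.
Context {R : realType}.

Lemma dotE n (x y : 'cV[R]_n) : (x^T *m y) 0 0 = dot x y.
Proof. by rewrite mxE; apply: eq_bigr => k _; rewrite mxE. Qed.

Lemma dot_mulmx n m (A : 'M[R]_(n, m)) (x : 'cV[R]_n) (y : 'cV[R]_m) :
  dot x (A *m y) = dot (A^T *m x) y.
Proof. by rewrite -!dotE trmx_mul trmxK mulmxA. Qed.

Lemma dot_eq0 n (x : 'cV[R]_n) : dot x x = 0 -> x = 0.
Proof.
move=> h; apply/matrixP => k z; rewrite ord1 mxE; apply/eqP.
have /eqP := h; rewrite /dot psumr_eq0 => [/allP/(_ k (mem_index_enum _))|l _].
  by rewrite mulf_eq0 orbb.
by rewrite -expr2 sqr_ge0.
Qed.

Lemma dot_col m n (x x' : 'cV[R]_m) (y y' : 'cV[R]_n) :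
  dot (col_mx x y) (col_mx x' y') = dot x x' + dot y y'.
Proof.
rewrite /dot big_split_ord /=; congr (_ + _); apply: eq_bigr => k _.
  by rewrite !col_mxEu.
by rewrite !col_mxEd.
Qed.

Definition psd n (S : 'M[R]_n) : Prop := forall x : 'cV[R]_n, 0 <= dot x (S *m x).

(** Along x + t S x the form is 2 t |S x|^2 + Q t^2, negative for small t < 0 unless S x = 0.
    Dividing by Q + 1 rather than Q covers Q = 0. *)
Lemma psd_ker n (S : 'M[R]_n) (x : 'cV[R]_n) : S^T = S -> psd S ->
  dot x (S *m x) = 0 -> S *m x = 0.
Proof.
move=> symS pS x0; apply: dot_eq0.
set y := S *m x; set s := dot y y; set Q := dot y (S *m y).
have s0 : 0 <= s by exact: dot_ge0.
have Q0 : 0 <= Q by exact: pS.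
pose t := - s / (Q + 1).
have := pS (x + t *: y).
have -> : dot (x + t *: y) (S *m (x + t *: y)) = 2 * t * s + t ^+ 2 * Q.
  rewrite mulmxDr -scalemxAr !dotDl !dotDr !dotZl !dotZr x0 (dot_mulmx S x) symS -/y -/s -/Q.
  by ring.
have Q1 : 0 < Q + 1 by lra.
have -> : 2 * t * s + t ^+ 2 * Q = - (s ^+ 2 * (Q + 2)) / (Q + 1) ^+ 2.
  by rewrite /t; field; rewrite gt_eqF.
rewrite pmulr_lge0 ?invr_gt0 ?exprn_gt0// oppr_ge0 pmulr_lle0; last by lra.
by move=> h; apply/eqP; rewrite -sqrf_eq0 eq_le h sqr_ge0.
Qed.

(** Induction on Schur complements. A zero pivot forces its column to vanish by [psd_ker]; otherwise
    the complement is the minimum of the form over the first coordinate, attained at - <b, x> /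
    a. *)
Lemma cholesky n (S : 'M[R]_n) : S^T = S -> psd S -> exists C : 'M[R]_n, S = C *m C^T.
Proof.
elim: n S => [|n IH] S; first by move=> _ _; exists 0; apply/matrixP => - [].
rewrite -[n.+1]/(1 + n)%N in S *; move=> symS pS.
pose a := S 0 0.
pose b : 'cV[R]_n := dlsubmx S.
pose S' := drsubmx S.
have ulE : ulsubmx S = a%:M.
  by apply/matrixP => i j; rewrite !ord1 !mxE eqxx; congr (S _ _); apply: val_inj.
have urE : ursubmx S = b^T by rewrite /b trmx_dlsub symS.
have SE : S = block_mx a%:M b^T b S' by rewrite -ulE -urE submxK.
have symS' : S'^T = S' by rewrite /S' trmx_drsub symS.
have quad (u : R) (x : 'cV[R]_n) : dot (col_mx u%:M x) (S *m col_mx u%:M x)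
    = a * u ^+ 2 + 2 * u * dot b x + dot x (S' *m x).
  have sc (r : R) : (r%:M : 'M[R]_1) 0 0 = r by rewrite mxE eqxx mulr1n.
  rewrite SE mul_block_col dot_col -scalar_mxM mul_mx_scalar.
  have -> : dot u%:M ((a * u)%:M + b^T *m x) = u * (a * u + dot b x).
    rewrite dotDr -[X in _ + X]dotE tr_scalar_mx mul_scalar_mx mxE dotE.
    by rewrite /dot !big_ord1 !sc; ring.
  by rewrite dotDr dotZr (dotC x b); ring.
have a0 : 0 <= a.
  by have := pS (col_mx 1%:M 0); rewrite quad mulmx0 !(dotC _ 0) !dot0l; lra.
have key (c : 'cV[R]_n) (r : R) : r ^+ 2 = a -> r *: c = b -> psd (S' - c *m c^T) ->
    exists C : 'M[R]_(1 + n), S = C *m C^T.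
  move=> ra rb pc.
  have [|C' C'E] := IH (S' - c *m c^T) _ pc.
    by rewrite linearB /= symS' trmx_mul trmxK.
  exists (block_mx r%:M 0 c C').
  rewrite tr_block_mx mulmx_block !tr_scalar_mx trmx0 !mul0mx !mulmx0 !addr0 -C'E.
  rewrite addrC subrK SE -scalar_mxM -expr2 ra mul_scalar_mx mul_mx_scalar rb.
  by rewrite -rb linearZ.
have quadc (c x : 'cV[R]_n) : dot x ((S' - c *m c^T) *m x) = dot x (S' *m x) - dot c x ^+ 2.
  have -> : dot c x ^+ 2 = dot x (c *m c^T *m x).
    rewrite -mulmxA dot_mulmx {2}/dot big_ord1 -expr2; congr (_ ^+ 2).
    by rewrite mxE; apply: eq_bigr => k _; rewrite mxE.
  by rewrite mulmxBl dotBr.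
have [az|an] := eqVneq a 0.
  have b0 : b = 0.
    have := @psd_ker _ S (col_mx 1%:M 0) symS pS.
    rewrite quad az mulmx0 !(dotC _ 0) !dot0l mul0r mulr0 !addr0 => /(_ erefl).
    rewrite SE mul_block_col !mulmx0 !addr0 mulmx1 -[0]col_mx0 => /eq_col_mx[_].
    by rewrite mulmx1.
  apply: (key 0 0); rewrite ?expr0n ?az ?scale0r ?b0//.
  by move=> x; rewrite quadc dot0l expr0n subr0; have := pS (col_mx 0%:M x); rewrite quad; lra.
have ap : 0 < a by rewrite lt_neqAle eq_sym an.
have r0 : 0 < Num.sqrt a by rewrite sqrtr_gt0.
apply: (key ((Num.sqrt a)^-1 *: b) (Num.sqrt a)).
- by rewrite sqr_sqrtr.
- by rewrite scalerA mulfV ?scale1r// gt_eqF.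
move=> x; rewrite quadc dotZl exprMn exprVn sqr_sqrtr//.
have := pS (col_mx (- (dot b x / a))%:M x); rewrite quad.
rewrite (_ : a * _ + _ + _ = dot x (S' *m x) - a^-1 * dot b x ^+ 2)//.
by field.
Qed.

End Cholesky.

Section Covariance.
Context {R : realType} {n : nat} {d} {T : measurableType d} (P : probability T R).
Variable X : T -> 'cV[R]_n.
Hypothesis mX : rand_vec X.
Hypothesis iX : forall j, P.-integrable setT (fun w => (X w j 0 ^+ 2)%:E).

Lemma integrable_prod j k : P.-integrable setT (fun w => (X w j 0 * X w k 0)%:E).
Proof.
apply: (le_integrable _ _ _ (integrableD _ (iX j) (iX k))) => //.
- by apply/measurable_EFinP; apply: measurable_funM; exact: mX.
- move=> w _; rewrite -EFinD !abse_EFin lee_fin.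
  rewrite [leRHS]ger0_norm ?addr_ge0 ?sqr_ge0// ler_norml.
  have := sqr_ge0 (X w j 0 + X w k 0); have := sqr_ge0 (X w j 0 - X w k 0).
  have := sqr_ge0 (X w j 0); have := sqr_ge0 (X w k 0).
  move: (X w j 0) (X w k 0) => a b h1 h2 h3 h4.
  apply/andP; split; lra.
Qed.

Lemma cov_quad (b : 'cV[R]_n) :
  (\int[P]_w (dot (X w) b ^+ 2)%:E = (dot b (cov_mx P X *m b))%:E)%E.
Proof.
have sqE w : (dot (X w) b ^+ 2)%:E =
    (\sum_(jk : 'I_n * 'I_n) (b jk.1 0 * b jk.2 0)%:E * (X w jk.1 0 * X w jk.2 0)%:E)%E.
  under eq_bigr do rewrite -EFinM.
  rewrite sumEFin; congr EFin.
  rewrite expr2 /dot big_distrlr pair_big /=; apply: eq_bigr => jk _; ring.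
under eq_integral do rewrite sqE.
rewrite integral_sum//; last by move=> jk; apply: integrableZl => //; exact: integrable_prod.
have intE jk : (\int[P]_w ((b jk.1 0 * b jk.2 0)%:E * (X w jk.1 0 * X w jk.2 0)%:E)
    = (b jk.1 0 * b jk.2 0 * cov_mx P X jk.1 jk.2)%:E)%E.
  rewrite integralZl//; last exact: integrable_prod.
  rewrite mxE [RHS]EFinM fineK//.
  by apply: integrable_fin_num => //; exact: integrable_prod.
under eq_bigr do rewrite intE.
rewrite sumEFin; congr EFin; rewrite /dot.
under [RHS]eq_bigr do rewrite mxE mulr_sumr.
by rewrite pair_big /=; apply: eq_bigr => jk _; ring.
Qed.

Lemma cov_sym : (cov_mx P X)^T = cov_mx P X.
Proof.
apply/matrixP => j k; rewrite !mxE; congr fine; apply: eq_integral => w _.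
by rewrite mulrC.
Qed.

Lemma cov_psd : psd (cov_mx P X).
Proof.
move=> b; rewrite -lee_fin -cov_quad; apply: integral_ge0 => w _.
by rewrite lee_fin sqr_ge0.
Qed.

End Covariance.

(** * Spectral norms and undoing the whitening *)

Section SpecNorm.
Context {R : realType} {n : nat}.
Implicit Type A : 'M[R]_n.

Lemma vnorm2E (x : 'cV[R]_n) : vnorm2 x = Num.sqrt (dot x x).
Proof. by rewrite /vnorm2 /dot; congr Num.sqrt; apply: eq_bigr => k _; rewrite expr2. Qed.

Lemma vnorm2_ge0 (x : 'cV[R]_n) : 0 <= vnorm2 x. Proof. exact: sqrtr_ge0. Qed.

Lemma vnorm2_sqr (x : 'cV[R]_n) : vnorm2 x ^+ 2 = dot x x.
Proof. by rewrite vnorm2E sqr_sqrtr// dot_ge0. Qed.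

Lemma vnorm2_le1 (x : 'cV[R]_n) : (vnorm2 x <= 1) = (dot x x <= 1).
Proof. by rewrite -vnorm2_sqr -[1 in RHS](expr1n _ 2) ler_pXn2r ?nnegrE ?vnorm2_ge0. Qed.

Lemma spec_norm_ub A (x : 'cV[R]_n) : dot x x <= 1 -> vnorm2 (A *m x) <= spec_norm A.
Proof.
move=> x1; apply: ub_le_sup; last by exists x => //=; rewrite vnorm2_le1.
(* The Frobenius norm shows that the set under [sup] is bounded. *)
exists (Num.sqrt (\sum_i dot (row i A)^T (row i A)^T)) => _ [y /= y1 <-].
rewrite vnorm2E; apply: ler_wsqrtr; rewrite {1}/dot; apply: ler_sum => i _.
have -> : (A *m y) i 0 = dot (row i A)^T y.
  by rewrite mxE; apply: eq_bigr => k _; rewrite !mxE.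
rewrite -expr2; apply: le_trans (dot_CS _ _) _.
by rewrite ler_piMr ?dot_ge0// -vnorm2_le1.
Qed.

Lemma spec_norm_le A (c : R) : (forall x : 'cV[R]_n, dot x x <= 1 -> vnorm2 (A *m x) <= c) ->
  spec_norm A <= c.
Proof.
move=> h; apply: ge_sup; last by move=> _ [x /= x1 <-]; apply: h; rewrite -vnorm2_le1.
by exists (vnorm2 (A *m 0)), 0 => //=; rewrite vnorm2_le1 dot0l.
Qed.

Lemma spec_norm_ge0 A : 0 <= spec_norm A.
Proof.
by apply: le_trans (spec_norm_ub A (x := 0) _); rewrite ?vnorm2_ge0// dot0l.
Qed.

Lemma dot_le_spec_norm A (x : 'cV[R]_n) : dot x (A *m x) <= spec_norm A * dot x x.
Proof.
have [x0|xn0] := eqVneq (dot x x) 0.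
  by rewrite x0 mulr0 (dot_eq0 x0) dot0l.
have xp : 0 < dot x x by rewrite lt_neqAle eq_sym xn0 dot_ge0.
pose s := Num.sqrt (dot x x); have s0 : 0 < s by rewrite sqrtr_gt0.
have sE : s ^+ 2 = dot x x by rewrite sqr_sqrtr// ltW.
pose y := s^-1 *: x.
have y1 : dot y y = 1 by rewrite dotZl dotZr mulrA -expr2 exprVn sE mulVf.
have xE : x = s *: y by rewrite scalerA mulfV ?scale1r// gt_eqF.
rewrite -sE {1 2}xE -scalemxAr dotZl dotZr mulrA -expr2 mulrC ler_wpM2r ?sqr_ge0//.
apply: le_trans (spec_norm_ub A (x := y) _); last by rewrite y1.
rewrite vnorm2E; apply: le_trans (ler_norm _) _.
rewrite -sqrtr_sqr; apply: ler_wsqrtr.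
by apply: le_trans (dot_CS _ _) _; rewrite y1 mul1r.
Qed.

(** <y, A x> is the bilinear form of the whitened rows at C^T y and C^T x, and |C^T x|^2 <= |C C^T|
    |x|^2. Taking y = A x, with the weights of [bform_le] balanced by |y|, gives the norm without
    eigenvalues. *)
Lemma unwhiten (N : nat) (Y : 'I_N -> 'cV[R]_n) (C : 'M[R]_n) (g : R) : (0 < N)%N -> 0 <= g ->
  (forall x, `|qform Y N%:R x| <= g * dot x x) ->
  spec_norm (N%:R^-1 *: \sum_i (C *m Y i) *m (C *m Y i)^T - C *m C^T)
    <= N%:R^-1 * g * spec_norm (C *m C^T).
Proof.
move=> N0 g0 qY; set A := _ - _; set S := C *m C^T; set s := spec_norm S.
have NR : 0 < N%:R :> R by rewrite ltr0n.
have s0 : 0 <= s by exact: spec_norm_ge0.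
have biE (x y : 'cV[R]_n) : dot y (A *m x) = N%:R^-1 * bform Y N%:R (C^T *m y) (C^T *m x).
  rewrite /A mulmxBl dotBr -scalemxAl dotZr mulmx_suml dot_sumr /bform mulrBr mulKf ?gt_eqF//.
  congr (_ * _ - _); last first.
    by rewrite -mulmxA; exact: dot_mulmx.
  apply: eq_bigr => i _.
  have dd (v z : 'cV[R]_n) : dot v (z *m z^T *m x) = dot z v * dot z x.
    rewrite -mulmxA (dot_mulmx z v) {1}/dot big_ord1; congr (_ * _);
    by rewrite mxE; apply: eq_bigr => k _; rewrite mxE.
  by rewrite dd !(dotC (C *m Y i)) !(dotC (Y i)); congr (_ * _); exact: dot_mulmx.
have CS (x : 'cV[R]_n) : dot (C^T *m x) (C^T *m x) <= s * dot x x.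
  by rewrite -(dot_mulmx C x) mulmxA; exact: dot_le_spec_norm.
apply: spec_norm_le => x x1.
set y := A *m x.
have [y0|yn0] := eqVneq (dot y y) 0.
  by rewrite vnorm2E y0 sqrtr0 !mulr_ge0// invr_ge0 ltW.
have yp : 0 < dot y y by rewrite lt_neqAle eq_sym yn0 dot_ge0.
set r := vnorm2 y; have rE : r ^+ 2 = dot y y by exact: vnorm2_sqr.
have r0 : 0 < r by rewrite /r vnorm2E sqrtr_gt0.
have ir0 : 0 < r^-1 by rewrite invr_gt0.
have := bform_le (C^T *m y) (C^T *m x) ir0 qY.
move=> /(le_trans (ler_norm _)) h.
have E : r ^+ 2 = N%:R^-1 * bform Y N%:R (C^T *m y) (C^T *m x) by rewrite rE -biE.
have sx : s * dot x x <= s by rewrite ler_piMr.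
have hy := ler_wpM2l (ltW ir0) (CS y); have hx := ler_wpM2l (ltW r0) (le_trans (CS x) sx).
rewrite invrK in h.
have yr : r^-1 * (s * dot y y) = r * s by rewrite -rE; field; rewrite gt_eqF.
have hh := ler_wpM2l g0 (lerD hy hx).
rewrite yr in hh.
have E2 : N%:R * r ^+ 2 = bform Y N%:R (C^T *m y) (C^T *m x).
  by rewrite E mulVKf// gt_eqF.
rewrite -(ler_pM2r r0) -mulrA -mulrA ler_pdivlMl// -expr2 E2.
by have := le_trans h hh; lra.
Qed.

End SpecNorm.

(** * Back to the original vectors *)

Section Final.
Context {R : realType}.

(** In the second claim p >= 4 gives the exponent 1/2 with equality, and for p < 4 [flat0] is 0. *)
Lemma rate_terms (p B : R) (n N : nat) : 2 < p -> 0 < B -> (0 < n)%N -> (0 < N)%N ->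
  N%:R^-1 * (n%:R * trunc0 p B n%:R N%:R)
    = expR 18 * (B `^ (2 / p) * (n%:R / N%:R) `^ ((p - 2) / p)) /\
  N%:R^-1 * (n%:R * flat0 p B n%:R N%:R)
    <= B `^ (2 / p) * (n%:R / N%:R) `^ ((Num.min p 4 - 2) / Num.min p 4).
Proof.
move=> p2 B0 n0 N0.
have nR : 0 < n%:R :> R by rewrite ltr0n.
have NR : 0 < N%:R :> R by rewrite ltr0n.
have p0 : 0 < p by exact: lt_trans p2.
have r0 : 0 < n%:R / N%:R :> R by rewrite divr_gt0.
have rV : N%:R / n%:R = (n%:R / N%:R)^-1 :> R by rewrite invf_div.
split.
  rewrite /trunc0 rV; set r := n%:R / N%:R in r0 *.
  have -> : (r^-1) `^ (2 / p) = (r `^ (2 / p))^-1.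
    by rewrite -(powR_inv1 (ltW r0)) -powRrM mulN1r powRN.
  have -> : (p - 2) / p = 1 - 2 / p by field; rewrite gt_eqF.
  rewrite powRD; last by apply/implyP => _; rewrite gt_eqF.
  rewrite powRr1 ?(ltW r0)// powRN.
  have := powR_gt0 (2 / p) r0; move: (r `^ (2 / p)) (B `^ (2 / p)) (expR 18) => a b c a0.
  by rewrite /r; field; rewrite !gt_eqF.
rewrite /flat0; case: ifP => p4; last by rewrite !mulr0 mulr_ge0 ?powR_ge0.
rewrite min_r// rV (_ : (4 - 2) / 4 = 2^-1); last by field.
rewrite powR12_sqrt ?(ltW r0)// sqrtrV ?(ltW r0)//.
set r := n%:R / N%:R in r0 *.
have s0 : 0 < Num.sqrt r by rewrite sqrtr_gt0.
have -> : N%:R^-1 * (n%:R * (B `^ (2 / p) / Num.sqrt r)) = B `^ (2 / p) * (r / Num.sqrt r).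
  by rewrite /r; field; rewrite !gt_eqF.
have -> // : r / Num.sqrt r = Num.sqrt r.
by rewrite -[X in X / _](sqr_sqrtr (ltW r0)) expr2 mulfK ?gt_eqF.
Qed.

Lemma fixed_exponent (p0 : R) : 2 < p0 -> exists C : R, 0 < C /\
  forall (d : measure_display) (T : measurableType d) (P : probability T R)
      (p B : R) (n N : nat) (X : T -> 'cV[R]_n) (Xs : 'I_N -> T -> 'cV[R]_n),
  p0 <= p -> 1 <= B -> (0 < n)%N -> (2 * n <= N)%N ->
  in_class_C P p B X -> (forall i, rand_vec (Xs i)) ->
  (forall i, same_law P (Xs i) X) -> mutually_indep P Xs ->
  exists E : set T, measurable E /\ ((1 - n%:R^-1)%:E <= P E)%E /\
    forall w, E w ->
      C^-1 * (spec_norm (emp_cov Xs w - cov_mx P X) / spec_norm (cov_mx P X))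
      <= N%:R^-1 * \big[Num.max/0]_(i < N)
                     ((Xs i w)^T *m invmx (cov_mx P X) *m Xs i w) 0 0
         + B `^ (2 / p) * ((n%:R / N%:R) `^ ((p - 2) / p)) * (ln (N%:R / n%:R)) ^+ 4
         + B `^ (2 / p) * ((n%:R / N%:R) `^ ((Num.min p 4 - 2) / Num.min p 4)).
Proof.
move=> p02; have [C0 [C00 bound]] := whitened_bound p02.
have e18 : 1 <= expR 18 :> R by rewrite -expR0 ler_expR.
exists (C0 * expR 18); split; first by rewrite mulr_gt0 ?expR_gt0.
move=> d T P p B n N X Xs p0p B1 n0 nN [mX [iX [_ [uS mom]]]] mXs law indep.
have p2 : 2 < p by exact: lt_le_trans p0p.
have B0 : 0 < B by exact: lt_le_trans B1.
have N0 : (0 < N)%N by apply: leq_trans nN; rewrite muln_gt0.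
have NR : 0 < N%:R :> R by rewrite ltr0n.
have [C SE] := cholesky (cov_sym P X) (cov_psd mX iX).
set S := cov_mx P X in uS mom SE *.
have uC : C \in unitmx by move: uS; rewrite SE unitmx_mul => /andP[].
pose W := invmx C.
have WC : W *m C = 1%:M by exact: mulVmx.
pose Z w i := W *m Xs i w.
have dotW (Y a : 'cV[R]_n) : dot (W *m Y) a = dot Y (W^T *m a).
  by rewrite dotC dot_mulmx dotC.
have quadS (b : 'cV[R]_n) : dot b (S *m b) = dot (C^T *m b) (C^T *m b).
  by rewrite SE -mulmxA; exact: dot_mulmx.
have CWa (a : 'cV[R]_n) : C^T *m (W^T *m a) = a.
  by rewrite mulmxA -trmx_mul WC trmx1 mul1mx.
have mZ i k : measurable_fun setT (fun w => Z w i k 0).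
  by apply: measurable_mulmx => j; exact: mXs.
have pZ : peelable P Z by exact: mulmx_peelable.
have momZ i a : (\int[P]_w (`|dot (Z w i) a| `^ p)%:E <= (B * dot a a `^ (p / 2))%:E)%E.
  set b := W^T *m a.
  under eq_integral do rewrite dotW -/b.
  rewrite (same_law_integral (g := fun v => `|dot v b| `^ p) (mXs i) mX (law i)); last 2 first.
  - apply: (borel_dot (f := fun x => `|x| `^ p)).
    apply: (measurableT_comp (measurable_powR p)).
    exact: normr_measurable.
  - by move=> v; exact: powR_ge0.
  have := mom b; rewrite -mulmxA dotE quadS CWa.
  by under eq_integral do rewrite dotE dotC.
have isoZ i a : (\int[P]_w (dot (Z w i) a ^+ 2)%:E = (dot a a)%:E)%E.
  set b := W^T *m a.
  under eq_integral do rewrite dotW -/b.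
  rewrite (same_law_integral (g := fun v => dot v b ^+ 2) (mXs i) mX (law i)); last 2 first.
  - by apply: (borel_dot (f := fun x => x ^+ 2)); exact: measurable_funX.
  - by move=> v; exact: sqr_ge0.
  by rewrite (cov_quad mX iX) quadS CWa.
have [E [mE PE EP]] := bound d T P n N Z p B mZ pZ p0p B1 n0 nN momZ isoZ.
exists E; split => //; split.
  have -> : P E = (1 - P (~` E))%E.
    by rewrite -probability_setC ?setCK//; exact: measurableC.
  by rewrite EFinB; apply: leeB.
move=> w Ew.
set Mx := \big[Num.max/0]_i _.
have MxE : \big[Num.max/0]_i dot (Z w i) (Z w i) = Mx.
  apply: eq_bigr => i _.
  have WWS : W^T *m W *m S = 1%:M.
    by rewrite SE -mulmxA (mulmxA W) WC mul1mx -trmx_mul mulmxV// trmx1.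
  have -> : invmx S = W^T *m W by rewrite -[LHS]mul1mx -WWS -mulmxA mulmxV// mulmx1.
  by rewrite -!mulmxA dotE dot_mulmx trmxK.
have Mx0 : 0 <= Mx by exact: bigmax_ge_id.
have [t1 t2] := rate_terms p2 B0 n0 N0.
have K0 := powR_ge0 B (2 / p).
set L4 := ln (N%:R / n%:R) ^+ 4.
have L40 : 0 <= L4 by rewrite /L4 (_ : 4%N = (2 * 2)%N)// exprM sqr_ge0.
set A1 := B `^ (2 / p) * _ in t1 *; set A2 := B `^ (2 / p) * _ in t2 *.
have A10 : 0 <= A1 by rewrite mulr_ge0// powR_ge0.
have A20 : 0 <= A2 by rewrite mulr_ge0// powR_ge0.
have NV0 : 0 <= N%:R^-1 :> R by rewrite invr_ge0 ltW.
have rhs0 : 0 <= N%:R^-1 * Mx + A1 * L4 + A2.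
  exact: addr_ge0 (addr_ge0 (mulr_ge0 NV0 Mx0) (mulr_ge0 A10 L40)) A20.
set s := spec_norm S.
(* For s = 0 the quotient is 0, as the inverse of 0 is 0. *)
have [s0|sn0] := eqVneq s 0; first by rewrite s0 invr0 !mulr0.
have sp : 0 < s by rewrite lt_neqAle eq_sym sn0 spec_norm_ge0.
rewrite ler_pdivrMl ?mulr_gt0 ?expR_gt0// ler_pdivrMr//.
have nN1 : (n <= N)%N by apply: leq_trans nN; rewrite leq_pmull.
have Q0 : 0 <= flat0 p B n%:R N%:R by exact: flat0_ge0.
have t0 : 0 < trunc0 p B n%:R N%:R by exact: trunc0_gt0.
pose g := C0 * (\big[Num.max/0]_i dot (Z w i) (Z w i)
           + n%:R * trunc0 p B n%:R N%:R * ln (N%:R / n%:R) ^+ 4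
           + n%:R * flat0 p B n%:R N%:R).
have gE : N%:R^-1 * g <= C0 * expR 18 * (N%:R^-1 * Mx + A1 * L4 + A2).
  have -> : N%:R^-1 * g = C0 * (N%:R^-1 * Mx + N%:R^-1 * (n%:R * trunc0 p B n%:R N%:R) * L4
       + N%:R^-1 * (n%:R * flat0 p B n%:R N%:R)) by rewrite /g MxE -/L4; ring.
  rewrite t1 -mulrA ler_wpM2l ?(ltW C00)// !mulrDr; apply: lerD; first apply: lerD.
  - by rewrite ler_peMl ?(mulr_ge0 NV0 Mx0).
  - by rewrite mulrA.
  - by apply: le_trans t2 _; rewrite ler_peMl.
have g0 : 0 <= g.
  apply: mulr_ge0 (ltW C00) _; rewrite MxE.
  have h1 := mulr_ge0 (mulr_ge0 (ler0n R n) (ltW t0)) L40.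
  exact: addr_ge0 (addr_ge0 Mx0 h1) (mulr_ge0 (ler0n R n) Q0).
have := unwhiten C N0 g0 (EP w Ew).
rewrite -SE -/s (_ : N%:R^-1 *: _ = emp_cov Xs w); last first.
  rewrite /emp_cov; congr (_ *: _); apply: eq_bigr => i _.
  by rewrite /Z mulmxA mulmxV// mul1mx.
move=> /le_trans; apply.
by rewrite ler_wpM2r// ltW.
Qed.

End Final.
Unset Implicit Arguments. Set Strict Implicit. Set Printing Implicit Defensive.

Theorem theorem1p1 (R : realType) :
  exists nu : R -> R,
    (forall p q : R, 2 < p -> p <= q -> nu q <= nu p) /\
    (forall p : R, 2 < p -> 0 < nu p) /\
    forall (d : measure_display) (T : measurableType d) (P : probability T R)
      (p B : R) (n N : nat) (X : T -> 'cV[R]_n) (Xs : 'I_N -> T -> 'cV[R]_n),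
      2 < p -> 1 <= B -> (0 < n)%N -> (2 * n <= N)%N ->
      in_class_C P p B X ->
      (forall i, rand_vec (Xs i)) ->
      (forall i, same_law P (Xs i) X) ->
      mutually_indep P Xs ->
      let Sigma := cov_mx P X in
      exists E : set T, measurable E /\
        ((1 - n%:R^-1)%:E <= P E)%E /\
        forall w, E w ->
          (nu p)^-1 * (spec_norm (emp_cov Xs w - Sigma) / spec_norm Sigma)
          <= N%:R^-1 * \big[Num.max/0]_(i < N)
                         ((Xs i w)^T *m invmx Sigma *m Xs i w) 0 0
             + B `^ (2 / p) * ((n%:R / N%:R) `^ ((p - 2) / p))
                 * (ln (N%:R / n%:R)) ^+ 4
             + B `^ (2 / p) * ((n%:R / N%:R)
                 `^ ((Num.min p 4 - 2) / Num.min p 4)).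
Proof.
have p_i (i : nat) : 2 < 2 + (i.+1%:R)^-1 :> R by rewrite ltrDl invr_gt0.
have /choice [C CP] := fun i => fixed_exponent (p_i i).
have C0 i : 0 < C i by case: (CP i).
(* j p + 1 > 1 / (p - 2), so 2 + 1 / (j p + 1) is a lower bound for p; and j decreases in p, so a
   smaller p sums more constants. *)
pose j (p : R) := Num.truncn (p - 2)^-1.
have jle p : 2 < p -> 2 + ((j p).+1%:R)^-1 <= p.
  move=> p2; have pp : 0 < p - 2 by rewrite subr_gt0.
  rewrite -lerBrDl -[p - 2]invrK lef_pV2 ?posrE ?invr_gt0// ltW//.
  exact: truncnS_gt.
have jmono p q : 2 < p -> p <= q -> (j q <= j p)%N.
  move=> p2 pq; apply: le_truncn; rewrite lef_pV2 ?posrE ?subr_gt0 ?lerD2r//.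
  exact: lt_le_trans pq.
exists (fun p => \sum_(i < (j p).+1) C i); split; [|split].
- move=> p q p2 pq.
  rewrite -!(big_mkord xpredT C) (big_cat_nat _ (n := (j q).+1) _ (p := (j p).+1))//=; last first.
    by rewrite ltnS jmono.
  by rewrite lerDl sumr_ge0// => i _; exact: ltW.
- move=> p _; rewrite big_ord_recr /= ltr_wpDl// sumr_ge0// => i _; exact: ltW.
move=> d T P p B n N X Xs p2 B1 n0 nN cX mXs law indep Sigma.
have [E [mE [PE EP]]] := (CP (j p)).2 d T P p B n N X Xs (jle p p2) B1 n0 nN cX mXs law indep.
exists E; split => //; split => // w Ew.
apply: le_trans (EP w Ew); rewrite ler_wpM2r//.
  by rewrite divr_ge0 ?spec_norm_ge0.
have Cs : C (j p) <= \sum_(i < (j p).+1) C i.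
  by rewrite big_ord_recr /= lerDr sumr_ge0// => i _; exact: ltW.
by rewrite lef_pV2 ?posrE// (lt_le_trans (C0 _) Cs).
Qed.
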